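(* Let $1 \le p < \infty$. Suppose the Banach spaces $X_1$ and $X_2$ have unconditional FDD, $X_1$ satisfies the lower $p$-estimate and $X_2$ satisfies the upper $p$-estimate (with respect to these FDDs), and both $X_1^*$ and $X_2$ are subprojective. Then $\mathcal{K}(X_1,X_2)$ is subprojective.
   Context: All Banach spaces are assumed infinite dimensional, and subspaces are closed and infinite dimensional. A Banach space $X$ is subprojective if every subspace $Y \subset X$ contains a further subspace $Z \subset Y$ that is complemented in $X$. $\mathcal{K}(X_1,X_2)$ is the space of compact operators from $X_1$ to $X_2$ with the operator norm. A Banach space $X$ has an unconditional FDD implemented by finite rank projections $(P'_n)$ if $P'_nP'_m = 0$ for $n\neq m$, $\sup_{N,\pm}\|\sum_{n=1}^N \pm P'_n\|<\infty$, and $\lim_N\sum_{n=1}^N P'_n x = x$ for every $x \in X$. Then $X$ satisfies the lower $p$-estimate if there is a constant $C>0$ such that $\|\sum_j \xi_j\|^p \geq C\sum_j\|\xi_j\|^p$ for every finite sequence $(\xi_j)$ of vectors disjointly supported with respect to the FDD, i.e. $\xi_j \in \mathrm{ran}\big(\sum_{n\in S_j}P'_n\big)$ with pairwise disjoint finite sets $S_j\subset\mathbb{N}$. Similarly, $X$ satisfies the upper $p$-estimate if there is a constant $C$ such that $\|\sum_j \xi_j\|^p \leq C\sum_j\|\xi_j\|^p$ for all such sequences. *)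

(* Defs.v *)
From HB Require Import structures.
From mathcomp Require Import all_boot all_order all_algebra.
From mathcomp Require Import finmap.
From mathcomp Require Import complex.
From mathcomp Require Import all_classical all_reals all_analysis.
Set Implicit Arguments.
Unset Strict Implicit.
Unset Printing Implicit Defensive.
Import Order.TTheory GRing.Theory Num.Theory.
Import numFieldNormedType.Exports.
Local Open Scope classical_set_scope.
Local Open Scope ring_scope.

(* Banach spaces may be real or complex: everything is developed over         *)
(* [scalar_field R k], which is [R] or [R[i]] according to [k].               *)
Variant scalar_kind := RealScalars | ComplexScalars.

Definition scalar_field (R : realType) (k : scalar_kind) : numFieldType :=
  match k with
  | RealScalars => R : numFieldType
  | ComplexScalars => R[i] : numFieldType
  end.

Definition of_real (R : realType) (k : scalar_kind) : R -> scalar_field R k :=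
  match k with
  | RealScalars => fun a => a
  | ComplexScalars => fun a => (a%:C)%C
  end.

Definition real_part (R : realType) (k : scalar_kind) : scalar_field R k -> R :=
  match k with
  | RealScalars => fun a => a
  | ComplexScalars => fun a => complex.Re a
  end.

(* MathComp norms take values in the scalar field; [rnorm x] is the same      *)
(* number seen in [R] (see [rnormE]).                                         *)
Definition rnorm (R : realType) (k : scalar_kind)
  (V : normedModType (scalar_field R k)) (x : V) : R := real_part `|x|.

Section Scalars.
Context {R : realType} {k : scalar_kind}.
Local Notation K := (scalar_field R k).

Lemma of_realK (a : R) : real_part (of_real k a) = a.
Proof. by case: k. Qed.

Lemma of_realD (a b : R) : of_real k (a + b) = of_real k a + of_real k b.
Proof. by case: k => //=; rewrite rmorphD. Qed.

Lemma of_realM (a b : R) : of_real k (a * b) = of_real k a * of_real k b.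
Proof. by case: k => //=; rewrite rmorphM. Qed.

Lemma of_real0 : of_real k 0 = 0 :> K.
Proof. by case: k. Qed.

Lemma of_real1 : of_real k 1 = 1 :> K.
Proof. by case: k. Qed.

Lemma ler_of_real (a b : R) : (of_real k a <= of_real k b) = (a <= b).
Proof. by case: k => //=; rewrite lecR. Qed.

Lemma real_partK (a : K) : 0 <= a -> of_real k (real_part a) = a.
Proof.
by case: k a => //= -[a b]; rewrite lecE /= => /andP[/eqP -> _].
Qed.

Lemma rnormE (V : normedModType K) (x : V) : `|x| = of_real k (rnorm x).
Proof. by rewrite real_partK. Qed.

Lemma rnorm_ge0 (V : normedModType K) (x : V) : 0 <= rnorm x.
Proof. by rewrite -(ler_of_real) -rnormE of_real0. Qed.

Lemma ler_rnormD (V : normedModType K) (x y : V) :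
  rnorm (x + y) <= rnorm x + rnorm y.
Proof. by rewrite -ler_of_real of_realD -!rnormE ler_normD. Qed.

Lemma rnormZ (V : normedModType K) (a : K) (x : V) :
  rnorm (a *: x) = real_part `|a| * rnorm x.
Proof.
by rewrite /rnorm normrZ -[ `|a| ]real_partK// -[ `|x| ]real_partK// -of_realM
  !of_realK.
Qed.

Lemma rnorm0 (V : normedModType K) : rnorm (0 : V) = 0.
Proof. by rewrite /rnorm normr0 -of_real0 of_realK. Qed.

Lemma rnorm0_eq0 (V : normedModType K) (x : V) : rnorm x = 0 -> x = 0.
Proof. by move=> x0; apply/normr0_eq0; rewrite rnormE x0 of_real0. Qed.

End Scalars.

Section BoundedOperators.
Context {R : realType} {k : scalar_kind}.
Local Notation K := (scalar_field R k).
Context {X Y : normedModType K}.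

Definition bounded_op_pred : {pred X -> Y} :=
  mem [set f : X -> Y | linear f /\ continuous f].

Lemma bounded_op_submod_closed : submod_closed bounded_op_pred.
Proof.
split.
  rewrite inE; split; last by move=> x; exact: cvg_cst.
  by move=> a x y /=; rewrite scaler0 addr0.
move=> a f g; rewrite !inE => -[lf cf] [lg cg]; split.
  move=> b x y /=; rewrite !fctE lf lg !scalerDr !scalerA (mulrC a b).
  by rewrite addrACA.
by move=> x; apply: cvgD; [apply: cvgZr; exact: cf|exact: cg].
Qed.

HB.instance Definition _ := GRing.isSubmodClosed.Build K (X -> Y)
  bounded_op_pred bounded_op_submod_closed.

End BoundedOperators.

Record bounded_op (R : realType) (k : scalar_kind)
    (X Y : normedModType (scalar_field R k)) : Type := BoundedOp {
  bounded_op_fun :> X -> Y;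
  bounded_op_subproof : bounded_op_fun \in bounded_op_pred }.

Section BoundedOperatorSpace.
Context {R : realType} {k : scalar_kind}.
Local Notation K := (scalar_field R k).
Context {X Y : normedModType K}.
Local Notation L := (bounded_op X Y).
Implicit Types T S : L.

HB.instance Definition _ := [isSub of L for @bounded_op_fun R k X Y].
HB.instance Definition _ := [Choice of L by <:].
HB.instance Definition _ := [SubChoice_isSubLmodule of L by <:].

Lemma bounded_op_linear T : linear T.
Proof. by have := bounded_op_subproof T; rewrite inE => -[]. Qed.

Lemma bounded_op_continuous T : continuous T.
Proof. by have := bounded_op_subproof T; rewrite inE => -[]. Qed.

HB.instance Definition _ T :=
  GRing.isLinear.Build K X Y *:%R (bounded_op_fun T) (bounded_op_linear T).

Definition opnorm T : R := sup [set rnorm (T x) | x in [set x | rnorm x <= 1]].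

Lemma opnorm_has_sup T :
  has_sup [set rnorm (T x) | x in [set x | rnorm x <= 1]].
Proof.
split; first by exists (rnorm (T 0)); exists 0 => //=; rewrite rnorm0.
have /linear_bounded_continuous/bounded_funP/(_ 1)[M TM] :=
  @bounded_op_continuous T.
exists (real_part M) => _ [x /= x1 <-].
have x1' : `|x| <= 1 by rewrite rnormE -of_real1 ler_of_real.
have M0 : 0 <= M := le_trans (normr_ge0 _) (TM _ x1').
by rewrite -(@ler_of_real _ k) -rnormE real_partK//; exact: TM.
Qed.

Lemma le_opnorm T x : rnorm (T x) <= opnorm T * rnorm x.
Proof.
have [x0|x0] := eqVneq (rnorm x) 0.
  by rewrite (rnorm0_eq0 x0) linear0 !rnorm0 mulr0.
have xp : 0 < rnorm x by rewrite lt_neqAle eq_sym x0 rnorm_ge0.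
have nV : real_part `|of_real k (rnorm x)^-1| = (rnorm x)^-1.
  by rewrite ger0_norm ?of_realK// -of_real0 ler_of_real invr_ge0 ltW.
rewrite -ler_pdivrMr// mulrC.
rewrite -{1}nV -rnormZ -linearZ; apply: ub_le_sup.
  exact: (opnorm_has_sup T).2.
by exists (of_real k (rnorm x)^-1 *: x) => //=; rewrite rnormZ nV mulVf.
Qed.

Lemma opnorm_le T (M : R) : 0 <= M ->
  (forall x, rnorm (T x) <= M * rnorm x) -> opnorm T <= M.
Proof.
move=> M0 TM; apply: ge_sup; first exact: (opnorm_has_sup T).1.
move=> _ [x /= x1 <-]; apply: le_trans (TM x) _.
by rewrite -[leRHS]mulr1 ler_wpM2l.
Qed.

Lemma opnorm_ge0 T : 0 <= opnorm T.
Proof.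
apply: le_trans (ub_le_sup (opnorm_has_sup T).2 _).
  exact: (@rnorm_ge0 _ _ _ (T 0)).
by exists 0 => //=; rewrite rnorm0.
Qed.

Let norm T : K := of_real k (opnorm T).

Let ler_normD T S : norm (T + S) <= norm T + norm S.
Proof.
rewrite /norm -of_realD ler_of_real; apply: opnorm_le => [|x].
  by rewrite addr_ge0// opnorm_ge0.
rewrite mulrDl (le_trans (ler_rnormD (T x) (S x)))//.
by rewrite lerD// le_opnorm.
Qed.

Let normZ_le (a : K) T : norm (a *: T) <= `|a| * norm T.
Proof.
have a0 : 0 <= real_part `|a|.
  by rewrite -(@ler_of_real _ k) real_partK ?of_real0.
rewrite /norm -[ `|a| ]real_partK// -of_realM ler_of_real.
apply: opnorm_le => [|x]; first by rewrite mulr_ge0// opnorm_ge0.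
by rewrite (rnormZ a (T x)) -mulrA ler_wpM2l// le_opnorm.
Qed.

Let norm_ge0 T : 0 <= norm T.
Proof. by rewrite -of_real0 ler_of_real opnorm_ge0. Qed.

Let normrZ (a : K) T : norm (a *: T) = `|a| * norm T.
Proof.
apply/eqP; rewrite eq_le normZ_le /=.
have [->|a0] := eqVneq a 0; first by rewrite normr0 mul0r.
rewrite -ler_pdivlMl ?normr_gt0// -normfV.
by rewrite (le_trans _ (normZ_le _ _))// scalerA mulVf// scale1r.
Qed.

Let normr0_eq0 T : norm T = 0 -> T = 0.
Proof.
move=> /(congr1 (@real_part R k)); rewrite of_realK -(@of_real0 R k) of_realK.
move=> T0; apply/val_inj/funext => x /=; apply/rnorm0_eq0/le_anti.
by rewrite rnorm_ge0 andbT (le_trans (le_opnorm T x))// T0 mul0r.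
Qed.

HB.instance Definition _ :=
  @Lmodule_isNormed.Build K L norm ler_normD normrZ normr0_eq0.

Lemma rnorm_opnorm T : rnorm T = opnorm T.
Proof. exact: of_realK. Qed.

End BoundedOperatorSpace.

Definition dual_space (R : realType) (k : scalar_kind)
    (X : normedModType (scalar_field R k)) : normedModType (scalar_field R k) :=
  bounded_op X (scalar_field R k)^o.

Section CompactOperators.
Context {R : realType} {k : scalar_kind}.
Local Notation K := (scalar_field R k).
Context {X Y : normedModType K}.
Local Notation L := (bounded_op X Y).

Definition compact_op_pred : {pred L} :=
  mem [set T : L | precompact (T @` [set x | `|x| <= 1])].

Lemma compact_op_submod_closed : submod_closed compact_op_pred.
Proof.
have hY := @norm_hausdorff K Y.
split=> [|a T S]; rewrite !inE /=.
  apply: (@precompact_subset _ _ [set 0]); first by move=> _ [x _ <-].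
  exact/compact_precompact/compact_set1.
rewrite !precompactE => cT cS.
pose f (z : Y * Y) := a *: z.1 + z.2.
have cf : continuous f.
  move=> z; apply: cvgD; last exact: cvg_snd.
  by apply: cvgZr; exact: cvg_fst.
have cA := continuous_compact (continuous_subspaceT cf) (compact_setX cT cS).
rewrite -precompactE; apply: precompact_subset (compact_precompact hY cA).
move=> _ [x x1 <-]; exists (T x, S x) => //.
by split; apply: subset_closure; exists x.
Qed.

HB.instance Definition _ := GRing.isSubmodClosed.Build K L
  compact_op_pred compact_op_submod_closed.

End CompactOperators.

Record compact_op (R : realType) (k : scalar_kind)
    (X Y : normedModType (scalar_field R k)) : Type := CompactOp {
  compact_op_val :> bounded_op X Y;
  compact_op_subproof : compact_op_val \in compact_op_pred }.

Section CompactOperatorSpace.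
Context {R : realType} {k : scalar_kind}.
Local Notation K := (scalar_field R k).
Context {X Y : normedModType K}.
Local Notation KL := (compact_op X Y).

HB.instance Definition _ := [isSub of KL for @compact_op_val R k X Y].
HB.instance Definition _ := [Choice of KL by <:].
HB.instance Definition _ := [SubChoice_isSubLmodule of KL by <:].

Let norm (T : KL) : K := `|val T|.

Let ler_normD (T S : KL) : norm (T + S) <= norm T + norm S.
Proof. exact: ler_normD. Qed.

Let normrZ (a : K) (T : KL) : norm (a *: T) = `|a| * norm T.
Proof. exact: normrZ. Qed.

Let normr0_eq0 (T : KL) : norm T = 0 -> T = 0.
Proof. by move=> /normr0_eq0 T0; apply/val_inj. Qed.

HB.instance Definition _ :=
  @Lmodule_isNormed.Build K KL norm ler_normD normrZ normr0_eq0.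

End CompactOperatorSpace.

Section Subprojective.
Context {R : realType} {k : scalar_kind}.
Local Notation K := (scalar_field R k).
Implicit Types V : normedModType K.

Definition finite_dim V (E : set V) : Prop :=
  exists (n : nat) (e : 'I_n -> V), (forall i, E (e i)) /\
    (forall x, E x -> exists c : 'I_n -> K, x = \sum_i c i *: e i).

Definition infdim_closed_subspace V (E : set V) : Prop :=
  [/\ submod_closed (mem E), closed E & ~ finite_dim E].

Definition complemented V (Z : set V) : Prop :=
  exists P : bounded_op V V, (forall x, P (P x) = P x) /\ range P = Z.

Definition subprojective V : Prop :=
  forall Y : set V, infdim_closed_subspace Y ->
  exists Z : set V, [/\ infdim_closed_subspace Z, Z `<=` Y & complemented Z].

End Subprojective.

Section UnconditionalFDD.
Context {R : realType} {k : scalar_kind}.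
Local Notation K := (scalar_field R k).
Implicit Types X : normedModType K.

Definition unconditional_FDD X (P : nat -> bounded_op X X) : Prop :=
  [/\ forall n, (forall x, P n (P n x) = P n x) /\ finite_dim (range (P n)),
      forall n m, n != m -> forall x, P n (P m x) = 0,
      exists M : R, forall (N : nat) (eps : nat -> bool),
        opnorm (\sum_(n < N) (-1) ^+ eps n *: P n) <= M &
      forall x, (fun N => \sum_(n < N) P n x) @ \oo --> x].

Definition disjointly_supported X (P : nat -> bounded_op X X)
    (m : nat) (xi : 'I_m -> X) : Prop :=
  exists S : 'I_m -> {fset nat},
    (forall i j, i != j -> [disjoint S i & S j]%fset) /\
    (forall j, range (\sum_(n <- S j) P n) (xi j)).

Definition lower_estimate X (P : nat -> bounded_op X X) (p : R) : Prop :=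
  exists2 C : R, 0 < C & forall (m : nat) (xi : 'I_m -> X),
    disjointly_supported P xi ->
    C * \sum_j rnorm (xi j) `^ p <= rnorm (\sum_j xi j) `^ p.

Definition upper_estimate X (P : nat -> bounded_op X X) (p : R) : Prop :=
  exists C : R, forall (m : nat) (xi : 'I_m -> X),
    disjointly_supported P xi ->
    rnorm (\sum_j xi j) `^ p <= C * \sum_j rnorm (xi j) `^ p.

End UnconditionalFDD.

(* Main.v *)
Require Import Defs.
From mathcomp Require Import all_boot all_order all_algebra.
From mathcomp Require Import all_classical all_reals all_analysis.
From mathcomp Require Import complex lra ring.
Import Order.TTheory GRing.Theory Num.Theory.
Import numFieldNormedType.Exports.
Local Open Scope classical_set_scope.
Local Open Scope ring_scope.
Set Implicit Arguments.
Unset Strict Implicit.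
Unset Printing Implicit Defensive.

(** Write p_n and q_n for the partial sums of the decompositions of X1 and X2.

The decomposition of X1 is shrinking: the operator norm of f (1 - p_n) tends to 0
for every functional f. Otherwise unconditionality yields a copy of l_infinity in
the dual of X1 ([fdd_shrinking]), and a dual containing such a copy is not
subprojective: no infinite-dimensional subspace of the corresponding copy of c_0
is complemented, by an uncountable almost disjoint family of infinite subsums
([linfty_dual_not_subprojective]). Therefore q_n T p_n tends to T in norm for
every compact operator T.

Let Y be a closed infinite-dimensional subspace of K(X1, X2). Since p_n and q_n
have finite rank, T p_n and q_n T are determined by finitely many evaluations
T |-> T x, with values in X2, and compositions T |-> f o T, with values in the
dual of X1.

If one of these maps is bounded below on an infinite-dimensional subspace of Y,
then that subspace inherits a complemented subspace from X2 or from the dual of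
X1 ([subprojective_pullback], which uses the completeness of K(X1, X2)).

Otherwise they are all strictly singular on Y, and on some infinite-dimensional
subspace of Y any finite number of them is small ([strictly_singular_small]).
So Y contains gliding humps T_j that are nearly block diagonal with respect to
the two decompositions. The lower p-estimate in X1 and the upper p-estimate in X2
give |sum_j a_j T_j| <= C sup_j |a_j| ([block_diagonal_bound]), and norming
functionals on the blocks, from Hahn-Banach, are coordinates that tend to 0 at
every compact operator. Hence the closed span of the T_j is the range of a
projection ([complemented_c0_sequence], [strictly_singular_complemented]). *)

(** * Real-valued norms, limits and bounded operators *)

Definition modulus (R : realType) (k : scalar_kind) (a : scalar_field R k) : R :=
  real_part `|a|.

Section Modulus.
Context {R : realType} {k : scalar_kind}.
Local Notation K := (scalar_field R k).
Implicit Types a b : K.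

Lemma modulus_ge0 a : 0 <= modulus a.
Proof. exact: (@rnorm_ge0 R k K^o). Qed.

Lemma ler_modulusD a b : modulus (a + b) <= modulus a + modulus b.
Proof. exact: (@ler_rnormD R k K^o). Qed.

Lemma modulusM a b : modulus (a * b) = modulus a * modulus b.
Proof. exact: (@rnormZ R k K^o). Qed.

Lemma modulus0 : modulus (0 : K) = 0.
Proof. exact: (@rnorm0 R k K^o). Qed.

Lemma modulus1 : modulus (1 : K) = 1.
Proof. by rewrite /modulus normr1 -of_real1 of_realK. Qed.

Lemma modulus0_eq0 a : modulus a = 0 -> a = 0.
Proof. exact: (@rnorm0_eq0 R k K^o). Qed.

Lemma modulusN a : modulus (- a) = modulus a.
Proof. by rewrite /modulus normrN. Qed.

Lemma modulus_gt0 a : a != 0 -> 0 < modulus a.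
Proof.
by move=> a0; rewrite lt_neqAle modulus_ge0 andbT eq_sym; apply: contra_neq a0 => /modulus0_eq0.
Qed.

Lemma modulusV a : modulus a^-1 = (modulus a)^-1.
Proof.
have [->|a0] := eqVneq a 0; first by rewrite invr0 modulus0 invr0.
apply: (mulfI (lt0r_neq0 (modulus_gt0 a0))).
by rewrite -modulusM !divff ?modulus1 // lt0r_neq0 // modulus_gt0.
Qed.

Lemma of_realN (t : R) : of_real k (- t) = - of_real k t.
Proof. by apply/eqP; rewrite -subr_eq0 opprK -of_realD addNr of_real0. Qed.

Lemma modulus_of_real (t : R) : modulus (of_real k t) = `|t|.
Proof.
wlog t0 : t / 0 <= t => [th|].
  have [/th//|/ltW t0] := leP 0 t.
  by rewrite -[t]opprK of_realN modulusN th ?normrN // oppr_ge0.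
by rewrite /modulus ger0_norm -?of_real0 ?ler_of_real // of_realK ger0_norm.
Qed.

Lemma rnormZm (V : normedModType K) a (x : V) :
  rnorm (a *: x) = modulus a * rnorm x.
Proof. exact: rnormZ. Qed.

End Modulus.

Section RealNorms.
Context {R : realType} {k : scalar_kind}.
Local Notation K := (scalar_field R k).
Implicit Types (V W : normedModType K).

Lemma rnormN V (x : V) : rnorm (- x) = rnorm x.
Proof. by rewrite /rnorm normrN. Qed.

Lemma rnormBC V (x y : V) : rnorm (x - y) = rnorm (y - x).
Proof. by rewrite -opprB rnormN. Qed.

Lemma rnormD_le V (x y : V) (a b : R) :
  rnorm x <= a -> rnorm y <= b -> rnorm (x + y) <= a + b.
Proof. by move=> xa yb; apply: le_trans (ler_rnormD _ _) _; apply: lerD. Qed.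

Lemma rnormB_le V (x y : V) (a b : R) :
  rnorm x <= a -> rnorm y <= b -> rnorm (x - y) <= a + b.
Proof. by move=> xa yb; apply: rnormD_le => //; rewrite rnormN. Qed.

Lemma ler_rnormB_dist V (x y : V) : rnorm x - rnorm y <= rnorm (x - y).
Proof. by rewrite lerBlDr -{1}[x](subrK y) ler_rnormD. Qed.

Lemma rnorm_triangle V (x y z : V) : rnorm (x - z) <= rnorm (x - y) + rnorm (y - z).
Proof. by rewrite -[x - z](subrKA y) ler_rnormD. Qed.

Lemma rnorm_gt0 V (x : V) : x != 0 -> 0 < rnorm x.
Proof.
by move=> a0; rewrite lt_neqAle rnorm_ge0 andbT eq_sym; apply: contra_neq a0 => /rnorm0_eq0.
Qed.

Lemma ler_rnorm_sum V (I : Type) (r : seq I) (P : pred I) (F : I -> V) :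
  rnorm (\sum_(i <- r | P i) F i) <= \sum_(i <- r | P i) rnorm (F i).
Proof.
elim/big_rec2 : _ => [|i x y _ xy]; first by rewrite rnorm0.
by rewrite rnormD_le.
Qed.

Lemma rnorm_small_eq0 V (x : V) : (forall e, 0 < e -> rnorm x < e) -> x = 0.
Proof.
move=> xe; apply/eqP/negP => /negP/rnorm_gt0 x0.
by have := xe _ x0; rewrite ltxx.
Qed.

Lemma ltr_of_real (a b : R) : (of_real k a < of_real k b) = (a < b).
Proof. by rewrite !lt_neqAle ler_of_real (can_eq (@of_realK R k)). Qed.

Lemma ball_rnorm V (x y : V) (e : K) : 0 < e ->
  ball x e y <-> rnorm (x - y) < real_part e.
Proof.
move=> e0; rewrite -ball_normE /ball_ /= rnormE.
by rewrite -[X in _ < X](real_partK (ltW e0)) ltr_of_real.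
Qed.

Lemma of_real_gt0 (e : R) : (0 < of_real k e) = (0 < e).
Proof. by rewrite -[X in X < _](of_real0 (k := k)) ltr_of_real. Qed.

Lemma real_part_gt0 (e : K) : 0 < e -> 0 < real_part e.
Proof. by move=> e0; rewrite -of_real_gt0 real_partK ?ltW. Qed.

Lemma nbhs_rnorm V (x : V) (A : set V) :
  nbhs x A <-> exists2 e : R, 0 < e & forall y, rnorm (x - y) < e -> A y.
Proof.
rewrite -nbhs_ballE; split => [[e /= e0 xA]|[e e0 xA]].
  exists (real_part e); first exact: real_part_gt0.
  by move=> y xy; apply: xA; apply/ball_rnorm.
exists (of_real k e) => /=; first by rewrite of_real_gt0.
by move=> y /ball_rnorm; rewrite of_real_gt0 of_realK => /(_ e0)/xA.
Qed.

Lemma closed_rnorm V (A : set V) : closed A <->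
  forall x, (forall e : R, 0 < e -> exists2 y, A y & rnorm (x - y) < e) -> A x.
Proof.
split=> [cA x xA|cA x xA].
  apply: cA => B /nbhs_rnorm[e e0 xB].
  by have [y Ay xy] := xA _ e0; exists y; split => //; exact: xB.
apply: cA => e e0; have [|y [Ay xy]] := xA [set y | rnorm (x - y) < e]; last by exists y.
by apply/nbhs_rnorm; exists e.
Qed.

Lemma continuous_rnorm V W (f : V -> W) : continuous f <->
  forall x (e : R), 0 < e ->
    exists2 d : R, 0 < d & forall y, rnorm (x - y) < d -> rnorm (f x - f y) < e.
Proof.
split => [cf x e e0|cf x].
  have /nbhs_rnorm[d d0 xd] : nbhs x [set y | rnorm (f x - f y) < e].
    by apply: (cf x [set z | rnorm (f x - z) < e]); apply/nbhs_rnorm; exists e.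
  by exists d.
move=> A /nbhs_rnorm[e e0 xA]; have [d d0 xd] := cf x _ e0.
by apply/nbhs_rnorm; exists d => // y /xd/xA.
Qed.

Definition norm_cvg V (u : nat -> V) (l : V) : Prop :=
  forall e : R, 0 < e -> exists N, forall n, (N <= n)%N -> rnorm (u n - l) < e.

Definition norm_cauchy V (u : nat -> V) : Prop :=
  forall e : R, 0 < e -> exists N, forall m n, (N <= m)%N -> (N <= n)%N -> rnorm (u m - u n) < e.

Definition norm_complete V : Prop :=
  forall u : nat -> V, norm_cauchy u -> exists l, norm_cvg u l.

Lemma norm_cvgP V (u : nat -> V) (l : V) : (u @ \oo --> l) <-> norm_cvg u l.
Proof.
split => [ul e e0|ul A /nbhs_rnorm[e e0 lA]].
  have [N _ lu] : \forall n \near \oo, rnorm (u n - l) < e.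
    by apply: (ul [set y | rnorm (y - l) < e]); apply/nbhs_rnorm; exists e => // y; rewrite rnormBC.
  by exists N => n /lu.
have [N uN] := ul _ e0.
by exists N => // n /= Nn; apply: lA; rewrite rnormBC uN.
Qed.

Lemma completeNormedModType_complete (V : completeNormedModType K) : norm_complete V.
Proof.
move=> u cu.
have /cauchy_cvg : cauchy (u @ \oo).
  apply: cauchy_exP => e e0; have [N uN] := cu _ (real_part_gt0 e0).
  exists (u N); exists N => // n /= Nn.
  by apply/ball_rnorm => //; apply: uN.
by move=> /norm_cvgP; exists (lim (u @ \oo)).
Qed.

Lemma norm_cvg_unique V (u : nat -> V) (l l' : V) : norm_cvg u l -> norm_cvg u l' -> l = l'.
Proof.
move=> ul ul'; apply/eqP; rewrite -subr_eq0; apply/eqP/rnorm_small_eq0 => e e0.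
have e2 : 0 < e / 2 by rewrite divr_gt0.
have [N uN] := ul _ e2; have [N' uN'] := ul' _ e2.
have /= := uN (maxn N N') (leq_maxl _ _); have /= := uN' (maxn N N') (leq_maxr _ _).
by have := rnorm_triangle l (u (maxn N N')) l'; rewrite (rnormBC l (u _)); lra.
Qed.

Lemma norm_cvg_cst V (x : V) : norm_cvg (fun=> x) x.
Proof. by move=> e e0; exists 0%N => n _; rewrite subrr rnorm0. Qed.

Lemma norm_cvg_lin V (a : K) (u v : nat -> V) (x y : V) : norm_cvg u x -> norm_cvg v y ->
  norm_cvg (fun n => a *: u n + v n) (a *: x + y).
Proof.
move=> /norm_cvgP ux /norm_cvgP vy; apply/norm_cvgP.
by apply: cvgD => //; apply: cvgZr.
Qed.

Lemma norm_cvgD V (u v : nat -> V) (x y : V) : norm_cvg u x -> norm_cvg v y ->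
  norm_cvg (fun n => u n + v n) (x + y).
Proof. by move=> /norm_cvgP ux /norm_cvgP vy; apply/norm_cvgP; apply: cvgD. Qed.

Lemma norm_cvgB V (u v : nat -> V) (x y : V) : norm_cvg u x -> norm_cvg v y ->
  norm_cvg (fun n => u n - v n) (x - y).
Proof. by move=> /norm_cvgP ux /norm_cvgP vy; apply/norm_cvgP; apply: cvgB. Qed.

Lemma norm_cvg_sum V (n : nat) (u : nat -> nat -> V) (l : nat -> V) :
  (forall i, (i < n)%N -> norm_cvg (u i) (l i)) ->
  norm_cvg (fun m => \sum_(i < n) u i m) (\sum_(i < n) l i).
Proof.
elim: n => [|n ih] ul.
  by move=> e e0; exists 0%N => m _; rewrite !big_ord0 subrr rnorm0.
suff -> : (fun m => \sum_(i < n.+1) u i m) = (fun m => \sum_(i < n) u i m + u n m).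
  by rewrite big_ord_recr /=; apply: norm_cvgD; [apply: ih => i /ltnW i_n; apply: ul|apply: ul].
by apply/funext => m; rewrite big_ord_recr.
Qed.

Lemma norm_cvgZl V (c : nat -> K) (l : K) (x : V) :
  norm_cvg (c : nat -> K^o) (l : K^o) -> norm_cvg (fun n => c n *: x) (l *: x).
Proof. by move=> /norm_cvgP cl; apply/norm_cvgP; apply: cvgZl. Qed.

Lemma natSinv_small (e : R) : 0 < e -> exists N, forall n, (N <= n)%N -> n.+1%:R^-1 < e.
Proof.
move=> e0; exists (Num.truncn e^-1) => n eN.
rewrite -[ltRHS]invrK ltf_pV2 ?posrE ?invr_gt0 // ?ltr0n //.
have /andP[_ h] := truncn_itv (ltW (etrans (invr_gt0 e) e0)).
by apply: lt_le_trans h _; rewrite ler_nat ltnS.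
Qed.

Lemma norm_cvg_le V (u : nat -> V) (l : V) (M : R) :
  norm_cvg u l -> (exists N, forall n, (N <= n)%N -> rnorm (u n) <= M) -> rnorm l <= M.
Proof.
move=> ul [N uM]; apply/ler_addgt0Pr => e e0.
have [N' uN'] := ul _ e0.
have := uN' _ (leq_maxl N' N); have := uM _ (leq_maxr N' N).
have := ler_rnormB_dist l (u (maxn N' N)); rewrite rnormBC; lra.
Qed.

Lemma closed_norm_cvg V (A : set V) (u : nat -> V) (l : V) :
  closed A -> (forall n, A (u n)) -> norm_cvg u l -> A l.
Proof.
move=> /closed_rnorm cA Au ul; apply: cA => e /ul[N uN].
by exists (u N) => //; rewrite rnormBC uN.
Qed.

Definition operator_of V W (f : V -> W) (lf : linear f)
  (bf : exists M : R, forall x, rnorm (f x) <= M * rnorm x) : bounded_op V W.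
Proof.
exists f; rewrite inE; split => //; apply/continuous_rnorm => x e e0.
case: bf => M fM.
have M0 : 0 < `|M| + 1 by rewrite ltr_pwDr.
exists (e / (`|M| + 1)); first by rewrite divr_gt0.
move=> y; rewrite ltr_pdivlMr // mulrC => xy.
have -> : f x - f y = f (x - y).
  have -> : x - y = (-1) *: y + x by rewrite scaleN1r addrC.
  by rewrite lf scaleN1r addrC.
apply: le_lt_trans xy; apply: le_trans (fM _) _.
by rewrite ler_wpM2r ?rnorm_ge0 // ler_wpDr // ler_norm.
Defined.

Lemma bounded_op_ext V W (f g : bounded_op V W) : f =1 g -> f = g.
Proof. by move=> fg; apply: val_inj; apply: funext. Qed.

Lemma operatorB V W (f : bounded_op V W) x y : f (x - y) = f x - f y.
Proof. exact: (linearB f). Qed.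

Lemma operatorD V W (f : bounded_op V W) x y : f (x + y) = f x + f y.
Proof. exact: (linearD f). Qed.

Lemma operatorZ V W (f : bounded_op V W) (a : K) x : f (a *: x) = a *: f x.
Proof. exact: (linearZ_LR f). Qed.

Lemma operator_sum V W (f : bounded_op V W) (I : Type) (r : seq I) (P : pred I) (F : I -> V) :
  f (\sum_(i <- r | P i) F i) = \sum_(i <- r | P i) f (F i).
Proof. exact: (linear_sum f). Qed.

Lemma operator0 V W (f : bounded_op V W) : f 0 = 0.
Proof. exact: (linear0 f). Qed.

Lemma sum_operatorE V W (I : Type) (r : seq I) (P : pred I) (F : I -> bounded_op V W) x :
  (\sum_(i <- r | P i) F i) x = \sum_(i <- r | P i) F i x.
Proof. by elim/big_rec2 : _ => [//|i y1 y2 _ <-]. Qed.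

Lemma norm_cvg_operator V W (f : bounded_op V W) (u : nat -> V) (l : V) :
  norm_cvg u l -> norm_cvg (fun n => f (u n)) (f l).
Proof.
move=> /norm_cvgP ul; apply/norm_cvgP.
by apply: (continuous_cvg _ (@bounded_op_continuous _ _ _ _ f l)).
Qed.

Lemma rnorm_operator_le V W (f : bounded_op V W) (M c : R) x :
  opnorm f <= M -> rnorm x <= c -> rnorm (f x) <= M * c.
Proof.
move=> fM xc; apply: le_trans (le_opnorm _ _) _.
by apply: ler_pM => //; [exact: opnorm_ge0|exact: rnorm_ge0].
Qed.

Definition op_comp V1 V2 V3 (g : bounded_op V2 V3) (f : bounded_op V1 V2) : bounded_op V1 V3.
Proof.
apply: (@operator_of _ _ (fun x => g (f x))).
- by move=> a x y; rewrite !linearP.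
- exists (opnorm g * opnorm f) => x; rewrite -mulrA.
  by apply: rnorm_operator_le => //; exact: le_opnorm.
Defined.

Lemma opnorm_comp_le V1 V2 V3 (g : bounded_op V2 V3) (f : bounded_op V1 V2) (a b : R) :
  opnorm g <= a -> opnorm f <= b -> opnorm (op_comp g f) <= a * b.
Proof.
move=> ga fb; apply: opnorm_le => [|x].
  by rewrite mulr_ge0 ?(le_trans (opnorm_ge0 _) ga) ?(le_trans (opnorm_ge0 _) fb).
rewrite -mulrA; apply: (@rnorm_operator_le _ _ g _ (b * rnorm x) (f x)) => //.
exact: rnorm_operator_le.
Qed.

End RealNorms.

(** * Finite and infinite dimension *)

Section Dimension.
Context {R : realType} {k : scalar_kind}.
Local Notation K := (scalar_field R k).
Implicit Types (V W : normedModType K).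

Definition subspace V (E : set V) : Prop :=
  E 0 /\ forall (a : K) x y, E x -> E y -> E (a *: x + y).

Lemma subspaceP V (E : set V) : submod_closed (mem E) <-> subspace E.
Proof.
split=> -[E0 Elin]; split.
- by move: E0; rewrite inE.
- by move=> a x y Ex Ey; have := Elin a x y; rewrite !inE; exact.
- by rewrite inE.
- by move=> a x y; rewrite !inE; exact: Elin.
Qed.

Lemma subspaceZ V (E : set V) (a : K) x : subspace E -> E x -> E (a *: x).
Proof. by move=> [E0 El] Ex; rewrite -[_ *: _]addr0; exact: El. Qed.

Lemma subspaceD V (E : set V) x y : subspace E -> E x -> E y -> E (x + y).
Proof. by move=> [E0 El] Ex Ey; rewrite -[x]scale1r; exact: El. Qed.

Lemma subspaceB V (E : set V) x y : subspace E -> E x -> E y -> E (x - y).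
Proof. by move=> [E0 El] Ex Ey; rewrite addrC -scaleN1r; exact: El. Qed.

Lemma subspace_sum V (E : set V) (I : Type) (r : seq I) (P : pred I) (F : I -> V) :
  subspace E -> (forall i, P i -> E (F i)) -> E (\sum_(i <- r | P i) F i).
Proof.
move=> sE EF; elim/big_rec : _ => [|i x Pi Ex]; first by case: sE.
by apply: subspaceD => //; exact: EF.
Qed.

Definition independent V (n : nat) (v : nat -> V) : Prop :=
  forall a : nat -> K, \sum_(j < n) a j *: v j = 0 -> forall j, (j < n)%N -> a j = 0.

(** The coordinates of the v_j form a matrix with more rows than columns as soon
as m < n, and a nonzero row of its kernel is a linear relation. *)
Lemma independent_le_dim V (n m : nat) (v : nat -> V) (e : 'I_m -> V) :
  (forall j : nat, exists c : 'I_m -> K, v j = \sum_i c i *: e i) ->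
  independent n v -> (n <= m)%N.
Proof.
move=> /choice[c vE] iv; rewrite leqNgt; apply/negP => mn.
pose C := \matrix_(j < n, i < m) c j i.
have kC : kermx C != 0.
  rewrite -mxrank_eq0 mxrank_ker subn_eq0 -ltnNge.
  by apply: leq_ltn_trans mn; exact: rank_leq_col.
have /rowV0Pn[w /sub_kermxP wC w0] := kC.
pose a j := if insub j is Some i then w 0 i else 0.
have aE (i : 'I_n) : a i = w 0 i by rewrite /a valK.
move/negP : w0; apply; apply/eqP/rowP => i; rewrite mxE -aE.
apply: iv => //.
under eq_bigr do rewrite aE vE scaler_sumr.
rewrite exchange_big /= big1 // => l _.
under eq_bigr do rewrite scalerA.
rewrite -scaler_suml.
have /rowP/(_ l) := wC; rewrite !mxE.
by under eq_bigr do rewrite mxE; move=> ->; rewrite scale0r.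
Qed.

Lemma independent_infdim V (E : set V) (v : nat -> V) :
  (forall j, E (v j)) -> (forall n, independent n v) -> ~ finite_dim E.
Proof.
move=> Ev iv [m [e [_ spanE]]].
have := @independent_le_dim V m.+1 m v e (fun j => spanE _ (Ev j)) (iv _).
by rewrite ltnn.
Qed.

Lemma independent_rcons V (n : nat) (v : nat -> V) (x : V) : independent n v ->
  (forall c : 'I_n -> K, x <> \sum_i c i *: v i) ->
  independent n.+1 (fun j => if (j < n)%N then v j else x).
Proof.
move=> iv xv a; rewrite big_ord_recr /= ltnn.
under eq_bigr do rewrite ltn_ord.
move=> av0.
have an0 : a n = 0.
  apply: contrapT => /eqP an0; apply: (xv (fun i => - (a i / a n))).
  under eq_bigr do rewrite scaleNr mulrC -scalerA.
  rewrite sumrN -scaler_sumr -scalerN; move/eqP : av0; rewrite addrC addr_eq0 => /eqP <-.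
  by rewrite scalerA mulVf // scale1r.
move=> j; rewrite ltnS leq_eqVlt => /predU1P[->//|]; apply: iv.
by rewrite an0 scale0r addr0 in av0.
Qed.

Lemma infdim_independent V (E : set V) (n : nat) : subspace E -> ~ finite_dim E ->
  exists2 v : nat -> V, forall j, E (v j) & independent n v.
Proof.
move=> sE nfE; elim: n => [|n [v Ev iv]].
  by exists (fun=> 0) => //; case: sE.
have [x Ex xv] : exists2 x, E x & forall c : 'I_n -> K, x <> \sum_i c i *: v i.
  apply: contrapT => nx; apply: nfE; exists n, (fun i => v i); split=> // x Ex.
  apply: contrapT => nc; apply: nx; exists x => // c xE; apply: nc.
  by exists c.
exists (fun j => if (j < n)%N then v j else x); first by move=> j; case: ifP.
exact: independent_rcons.
Qed.

Lemma finite_dim_basis V (E : set V) : subspace E -> finite_dim E ->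
  exists n (v : nat -> V), [/\ forall j, E (v j), independent n v &
    forall x, E x -> exists c : 'I_n -> K, x = \sum_i c i *: v i].
Proof.
move=> sE [m [e [_ spanE]]]; apply: contrapT => nbasis.
have grow n : exists2 v : nat -> V, forall j, E (v j) & independent n v.
  elim: n => [|n [v Ev iv]]; first by exists (fun=> 0) => //; case: sE.
  apply: contrapT => nv; apply: nbasis; exists n, v; split=> // x Ex.
  apply: contrapT => nc; apply: nv.
  exists (fun j => if (j < n)%N then v j else x); first by move=> j; case: ifP.
  by apply: independent_rcons => // c xE; apply: nc; exists c.
have [v Ev iv] := grow m.+1.
have := @independent_le_dim V m.+1 m v e (fun j => spanE _ (Ev j)) iv.
by rewrite ltnn.
Qed.

(** Passing to a larger set is not immediate: the spanning vectors of E need not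
lie in F. Arbitrarily long independent families decide. *)
Lemma infdim_subset V (F E : set V) : subspace F -> F `<=` E ->
  ~ finite_dim F -> ~ finite_dim E.
Proof.
move=> sF FE nfF [m [e [_ spanE]]].
have [v Fv iv] := infdim_independent m.+1 sF nfF.
have := @independent_le_dim V m.+1 m v e (fun j => spanE _ (FE _ (Fv j))) iv.
by rewrite ltnn.
Qed.

(** Together with one vector on which g does not vanish, a finite spanning family
of the kernel would span F. *)
Lemma infdim_ker1 V (F : set V) (g : V -> K) : subspace F -> ~ finite_dim F ->
  linear_for *%R g ->
  subspace (F `&` [set x | g x = 0]) /\ ~ finite_dim (F `&` [set x | g x = 0]).
Proof.
move=> [F0 Flin] nfF lg.
have g0 : g 0 = 0.
  by have := lg (-1) 0 0; rewrite scaler0 addr0 mulN1r addNr.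
split.
  split=> // a x y [Fx gx] [Fy gy]; split; first exact: Flin.
  by rewrite /= lg gx gy mulr0 addr0.
move=> [n [e [Fe spanE]]]; apply: nfF.
have [g0F|] := pselect (forall x, F x -> g x = 0).
  exists n, e; split=> [i|x Fx]; first by case: (Fe i).
  by apply: spanE; split => //=; apply: g0F.
move=> /existsNP[x0 /not_implyP[Fx0 /eqP gx0]].
exists n.+1, (fun i => if unlift ord0 i is Some j then e j else x0).
split=> [i|x Fx]; first by case: (unlift _ _) => // j; case: (Fe j).
have [|c cE] := spanE (- (g x / g x0) *: x0 + x).
  split; first exact: Flin.
  by rewrite /= lg mulNr divfK // addNr.
exists (fun i => if unlift ord0 i is Some j then c j else g x / g x0).
rewrite big_ord_recl unlift_none.
under eq_bigr do rewrite liftK.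
by rewrite -cE scaleNr addrA subrr add0r.
Qed.

Lemma infdim_ker V (F : set V) (n : nat) (g : nat -> V -> K) : subspace F -> ~ finite_dim F ->
  (forall i, linear_for *%R (g i)) ->
  subspace (F `&` [set x | forall i, (i < n)%N -> g i x = 0]) /\
  ~ finite_dim (F `&` [set x | forall i, (i < n)%N -> g i x = 0]).
Proof.
move=> sF nfF lg; elim: n => [|n [sFn nfFn]].
  suff -> : [set x | forall i, (i < 0)%N -> g i x = 0] = setT by rewrite setIT.
  by apply/seteqP; split.
have [sFS nFS] := infdim_ker1 sFn nfFn (lg n).
suff <- : (F `&` [set x | forall i, (i < n)%N -> g i x = 0]) `&` [set x | g n x = 0] =
   F `&` [set x | forall i, (i < n.+1)%N -> g i x = 0] by [].
rewrite -setIA; congr (_ `&` _); apply/seteqP; split => [x [xn gn] i|x xn].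
  by rewrite ltnS leq_eqVlt => /predU1P[->//|]; exact: xn.
by split => [i i_n|]; apply: xn => //; rewrite ltnS ltnW.
Qed.

Lemma infdim_unit_vector V (F : set V) : subspace F -> ~ finite_dim F ->
  exists2 x, F x & rnorm x = 1.
Proof.
move=> sF nfF.
have [v Fv iv] := infdim_independent 1 sF nfF.
have v0 : v 0%N != 0.
  apply/eqP => v0; have /= := iv (fun=> 1).
  by rewrite big_ord1 v0 scaler0 => /(_ erefl 0%N isT)/eqP; rewrite oner_eq0.
exists (of_real k (rnorm (v 0%N))^-1 *: v 0%N); first exact: subspaceZ.
by rewrite rnormZm modulus_of_real ger0_norm ?invr_ge0 ?rnorm_ge0 // mulVf // lt0r_neq0 // rnorm_gt0.
Qed.

Lemma subspace_closure V (F : set V) : subspace F -> subspace (closure F).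
Proof.
have closureP (x : V) : closure F x <-> forall e : R, 0 < e -> exists2 y, F y & rnorm (x - y) < e.
  split=> [Fx e e0|Fx B /nbhs_rnorm[e e0 eB]].
    have [|y [Fy xy]] := Fx [set y | rnorm (x - y) < e]; last by exists y.
    by apply/nbhs_rnorm; exists e.
  by have [y Fy xy] := Fx _ e0; exists y; split => //; exact: eB.
move=> [F0 Flin]; split; first exact: subset_closure.
move=> a x y /closureP Fx /closureP Fy; apply/closureP => e e0.
have a0 : 0 < modulus a + 1 by rewrite ltr_wpDl // modulus_ge0.
have [|x' Fx' xx'] := Fx (e / (modulus a + 1) / 2); first by rewrite !divr_gt0.
have [|y' Fy' yy'] := Fy (e / 2); first by rewrite divr_gt0.
exists (a *: x' + y'); first exact: Flin.
rewrite opprD addrACA -scalerBr; apply: le_lt_trans (ler_rnormD _ _) _.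
rewrite rnormZm.
have h : modulus a * rnorm (x - x') <= e / 2.
  apply: le_trans (_ : (modulus a + 1) * (e / (modulus a + 1) / 2) <= _).
    by apply: ler_pM; rewrite ?modulus_ge0 ?rnorm_ge0 ?ltW // ltr_pwDr.
  by rewrite mulrA mulrCA divff ?lt0r_neq0 // mulr1.
by rewrite [e]splitr ler_ltD.
Qed.

End Dimension.

Section ScalarField.
Context {R : realType}.

Lemma real_scalars_complete : norm_complete ((scalar_field R RealScalars)^o : normedModType _).
Proof. exact: (@completeNormedModType_complete R RealScalars R^o). Qed.

Lemma modulus_complexE (z : scalar_field R ComplexScalars) :
  modulus z = Num.sqrt ((complex.Re z) ^+ 2 + (complex.Im z) ^+ 2).
Proof. by rewrite /modulus normc_def. Qed.

Lemma Re_le_modulus (z : scalar_field R ComplexScalars) : `|complex.Re z| <= modulus z.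
Proof. by rewrite modulus_complexE -sqrtr_sqr ler_wsqrtr // lerDl sqr_ge0. Qed.

Lemma Im_le_modulus (z : scalar_field R ComplexScalars) : `|complex.Im z| <= modulus z.
Proof. by rewrite modulus_complexE -sqrtr_sqr ler_wsqrtr // lerDr sqr_ge0. Qed.

Lemma modulus_le_ReIm (z : scalar_field R ComplexScalars) :
  modulus z <= `|complex.Re z| + `|complex.Im z|.
Proof.
rewrite modulus_complexE -[leRHS]ger0_norm ?addr_ge0 // -[leRHS]sqrtr_sqr ler_wsqrtr //.
rewrite sqrrD !real_normK ?num_real // lerD2r lerDl.
by rewrite mulrn_wge0 // mulr_ge0.
Qed.

Lemma scalars_complete (k : scalar_kind) : norm_complete ((scalar_field R k)^o : normedModType _).
Proof.
case: k; first exact: real_scalars_complete.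
move=> u cu.
have cRe : @norm_cauchy R RealScalars R^o (fun n => complex.Re (u n)).
  move=> e /cu[N uN]; exists N => m n Nm Nn; apply: le_lt_trans (uN _ _ Nm Nn).
  by rewrite -raddfB; exact: Re_le_modulus.
have cIm : @norm_cauchy R RealScalars R^o (fun n => complex.Im (u n)).
  move=> e /cu[N uN]; exists N => m n Nm Nn; apply: le_lt_trans (uN _ _ Nm Nn).
  by rewrite -raddfB; exact: Im_le_modulus.
have [a ua] := real_scalars_complete cRe.
have [b ub] := real_scalars_complete cIm.
exists (a +i* b)%C => e e0.
have e2 : 0 < e / 2 by rewrite divr_gt0.
have [N uN] := ua _ e2; have [N' uN'] := ub _ e2.
exists (maxn N N') => n; rewrite geq_max => /andP[/uN Nn /uN' Nn'].
apply: le_lt_trans (modulus_le_ReIm _) _.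
rewrite [e]splitr; apply: ltrD.
  by rewrite raddfB; exact: Nn.
by rewrite raddfB; exact: Nn'.
Qed.

End ScalarField.

Section FiniteRank.
Context {R : realType} {k : scalar_kind}.
Local Notation K := (scalar_field R k).
Implicit Types (V W : normedModType K).

(** A vector outside the span of the others keeps a positive distance from it:
by induction the coordinates of an approximating sequence in that span are
Cauchy, so they converge, because the scalars are complete, and the limit would
put the vector in the span. *)
Lemma independent_coord_bound V (n : nat) (v : nat -> V) : independent n v ->
  exists2 c : R, 0 < c & forall (a : nat -> K) j, (j < n)%N ->
    c * modulus (a j) <= rnorm (\sum_(i < n) a i *: v i).
Proof.
elim: n => [|n ih] iv; first by exists 1.
have iv' : independent n v.
  move=> a a0 j jn; have := iv (fun i => if (i < n)%N then a i else 0).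
  rewrite big_ord_recr /= ltnn scale0r addr0.
  under eq_bigr do rewrite ltn_ord.
  by move=> /(_ a0 j (ltnW jn)); rewrite jn.
have [c c0 cv] := ih iv'.
have [d d0 dv] : exists2 d : R, 0 < d & forall a : nat -> K, d <= rnorm (\sum_(i < n) a i *: v i + v n).
  apply: contrapT => nd.
  have /choice[A Av] : forall m : nat, exists a : nat -> K,
      rnorm (\sum_(i < n) a i *: v i + v n) < m.+1%:R^-1.
    move=> m; apply: contrapT => na; apply: nd; exists m.+1%:R^-1; first by rewrite invr_gt0.
    by move=> a; rewrite leNgt; apply/negP => h; apply: na; exists a.
  have cauchyA j : (j < n)%N -> norm_cauchy (fun m => A m j : K^o).
    move=> jn e e0.
    have ce0 : 0 < c * e / 2 by rewrite divr_gt0 ?mulr_gt0.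
    have [N Ne] := natSinv_small ce0.
    exists N => m m' Nm Nm'.
    rewrite -(ltr_pM2l c0); apply: le_lt_trans (cv (fun i => A m i - A m' i) _ jn) _.
    under eq_bigr do rewrite scalerBl.
    rewrite sumrB.
    have diffE (x y : V) : x - y = (x + v n) - (y + v n) by rewrite opprD addrACA subrr addr0.
    rewrite diffE; apply: le_lt_trans (rnormB_le (lexx _) (lexx _)) _.
    have := lt_trans (Av m) (Ne _ Nm); have := lt_trans (Av m') (Ne _ Nm').
    set t := c * e; lra.
  have /choice[a aA] : forall j, exists l : K, (j < n)%N -> norm_cvg (fun m => A m j : K^o) (l : K^o).
    move=> j; have [jn|] := ltnP j n; last by exists 0.
    by have [l lA] := scalars_complete (cauchyA _ jn); exists l.
  have cvgA : norm_cvg (fun m => \sum_(i < n) A m i *: v i) (\sum_(i < n) a i *: v i).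
    apply: (@norm_cvg_sum _ _ _ n (fun i m => A m i *: v i) (fun i => a i *: v i)) => i i_n.
    exact/norm_cvgZl/aA.
  have cvgA' : norm_cvg (fun m => \sum_(i < n) A m i *: v i) (- v n).
    move=> e /natSinv_small[N Ne]; exists N => m Nm; rewrite opprK.
    exact: lt_trans (Av m) (Ne _ Nm).
  have avn := norm_cvg_unique cvgA cvgA'.
  have := iv (fun i => if (i < n)%N then a i else 1).
  rewrite big_ord_recr /= ltnn scale1r.
  under eq_bigr do rewrite ltn_ord.
  rewrite avn addNr => /(_ erefl n (ltnSn n)); rewrite ltnn => /eqP.
  by rewrite oner_eq0.
have dan (a : nat -> K) : d * modulus (a n) <= rnorm (\sum_(i < n.+1) a i *: v i).
  have [an0|an0] := eqVneq (a n) 0; first by rewrite an0 modulus0 mulr0 rnorm_ge0.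
  rewrite -ler_pdivlMr ?modulus_gt0 // mulrC -modulusV -rnormZm big_ord_recr /= scalerDr.
  rewrite scalerA mulVf // scale1r scaler_sumr.
  by under eq_bigr do rewrite scalerA; exact: (dv (fun i => (a n)^-1 * a i)).
have b0 : 0 < d + rnorm (v n) by rewrite ltr_pwDl // rnorm_ge0.
exists (Num.min d (c * d / (d + rnorm (v n)))).
  by rewrite lt_min d0 /= !divr_gt0 // mulr_gt0.
move=> a j; rewrite ltnS leq_eqVlt => /predU1P[->|jn].
  by apply: le_trans (dan a); rewrite ler_wpM2r ?modulus_ge0 // ge_min lexx.
apply: (@le_trans _ _ (c * d / (d + rnorm (v n)) * modulus (a j))).
  by rewrite ler_wpM2r ?modulus_ge0 // ge_min lexx orbT.
rewrite mulrAC ler_pdivrMr // mulrAC.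
have h : c * modulus (a j) <= rnorm (\sum_(i < n.+1) a i *: v i) + modulus (a n) * rnorm (v n).
  apply: le_trans (cv a _ jn) _; rewrite big_ord_recr /= -rnormZm.
  by rewrite -[X in rnorm X <= _](addrK (a n *: v n)) rnormB_le.
apply: le_trans (ler_wpM2r (ltW d0) h) _.
rewrite mulrDl mulrDr lerD2l mulrAC ler_wpM2r ?rnorm_ge0 //.
by rewrite mulrC dan.
Qed.

Lemma subspace_range V W (S : bounded_op V W) : subspace (range S).
Proof.
split; first by exists 0 => //; rewrite operator0.
by move=> a _ _ [x _ <-] [y _ <-]; exists (a *: x + y) => //; rewrite linearP.
Qed.

(** Coordinates in a basis of the range depend boundedly on S x by the previous
bound, so they are elements of the dual. *)
Lemma finite_rank_decomposition V W (S : bounded_op V W) : finite_dim (range S) ->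
  exists n (v : nat -> W) (f : nat -> dual_space V),
    forall x, S x = \sum_(i < n) (f i x : K) *: v i.
Proof.
move=> /(finite_dim_basis (subspace_range S))[n [v [_ iv spanS]]].
have [c c0 cv] := independent_coord_bound iv.
have /choice[a aS] : forall x, exists a : nat -> K,
    S x = \sum_(i < n) a i *: v i /\ forall i, (n <= i)%N -> a i = 0.
  move=> x; have [|b bS] := spanS (S x); first by exists x.
  exists (fun i => if insub i is Some j then b j else 0); split => [|i ni].
    by rewrite bS; apply: eq_bigr => i _; rewrite valK.
  by rewrite insubN // -leqNgt.
have la i : linear_for *%R (fun x => a x i).
  move=> t x y; have [ni|i_n] := leqP n i.
    by rewrite !(aS _).2 // mulr0 addr0.
  apply/eqP; rewrite -subr_eq0; apply/eqP.
  apply: (iv (fun i => a (t *: x + y) i - (t * a x i + a y i))) i_n.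
  under eq_bigr do rewrite scalerBl scalerDl -scalerA.
  rewrite sumrB big_split /= -scaler_sumr -!(aS _).1.
  by rewrite linearP subrr.
have ba i : exists M : R, forall x, rnorm (a x i : K^o) <= M * rnorm x.
  exists (opnorm S / c) => x; have [ni|i_n] := leqP n i.
    by rewrite (aS _).2 // rnorm0 !mulr_ge0 ?rnorm_ge0 ?opnorm_ge0 // invr_ge0 ltW.
  rewrite mulrAC ler_pdivlMr // mulrC; apply: le_trans (cv (a x) _ i_n) _.
  by rewrite -(aS x).1 le_opnorm.
exists n, v, (fun i => @operator_of _ _ _ K^o (fun x => a x i) (la i) (ba i)) => x.
by rewrite (aS x).1.
Qed.

End FiniteRank.

(** * Norming functionals *)

Section RealHahnBanach.
Context {R : realType} {k : scalar_kind}.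
Local Notation K := (scalar_field R k).
Variables (V : normedModType K) (x0 : V).
Local Notation "t *:r x" := (of_real k t *: x) (at level 40).

(** Graphs of partially defined real-linear functionals dominated by the norm;
single-valuedness follows from the domination. *)
Let dominated_graph (G : set (V * R)) : Prop :=
  [/\ forall t x y a b, G (x, a) -> G (y, b) -> G (t *:r x + y, t * a + b),
      forall x a, G (x, a) -> a <= rnorm x &
      forall z, G z -> G (x0, rnorm x0)].

Let rnormZr (t : R) (x : V) : rnorm (t *:r x) = `|t| * rnorm x.
Proof. by rewrite rnormZm modulus_of_real. Qed.

Let scaleN1 (x : V) : (-1) *:r x = - x.
Proof. by rewrite of_realN of_real1 scaleN1r. Qed.

Let line_dominated : dominated_graph [set z | exists t, z = (t *:r x0, t * rnorm x0)].
Proof.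
split=> [t x y a b [s [-> ->]] [s' [-> ->]]|x a [t [-> ->]]|z _].
- exists (t * s + s'); congr (_, _); last by rewrite mulrDl mulrA.
  by rewrite scalerA -of_realM -scalerDl -of_realD.
- by rewrite rnormZr ler_wpM2r ?rnorm_ge0 // ler_norm.
- by exists 1; rewrite of_real1 scale1r mul1r.
Qed.

(** The value c at y of an extension must satisfy a - |x - y| <= c <= |x + y| - a
for all (x, a) in the graph; the supremum of the left-hand sides will do. *)
Let dominated_ext (G : set (V * R)) (y : V) : dominated_graph G -> G (0, 0) ->
  exists c, dominated_graph [set z | exists x a t, G (x, a) /\ z = (x + t *:r y, a + t * c)].
Proof.
move=> [Glin Gdom Gx0] G0.
pose L := [set s | exists2 z, G z & s = z.2 - rnorm (z.1 - y)].
have Lub x a : G (x, a) -> ubound L (rnorm (x + y) - a).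
  move=> Gxa _ [[x' a'] /= Gxa' ->].
  have := Gdom _ _ (Glin 1 _ _ _ _ Gxa Gxa'); rewrite of_real1 scale1r mul1r.
  have -> : x + x' = (x + y) + (x' - y) by rewrite addrACA subrr addr0.
  by have := ler_rnormD (x + y) (x' - y); lra.
have L0 : L !=set0 by exists (0 - rnorm (0 - y)), (0, 0).
pose c := sup L; exists c.
have cge x a : G (x, a) -> a - c <= rnorm (x - y).
  move=> Gxa; suff : a - rnorm (x - y) <= c by lra.
  by apply: ub_le_sup; [exists (rnorm (x + y) - a); exact: Lub|exists (x, a)].
have cle x a : G (x, a) -> a + c <= rnorm (x + y).
  by move=> Gxa; rewrite addrC -lerBrDr; apply: ge_sup => //; exact: Lub.
have Gscale s x a : G (x, a) -> G (s *:r x, s * a).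
  by move=> Gxa; have := Glin s _ _ _ _ Gxa G0; rewrite !addr0.
split=> [s _ _ _ _ [x [a [t [Gxa [-> ->]]]]] [x' [a' [t' [Gxa' [-> ->]]]]]|
         _ _ [x [a [t [Gxa [-> ->]]]]]|z _].
- exists (s *:r x + x'), (s * a + a'), (s * t + t'); split; first exact: Glin.
  congr (_, _); last by rewrite mulrDr mulrDl mulrA addrACA.
  by rewrite scalerDr addrACA scalerA of_realD of_realM scalerDl.
- have [t0|t0|->] := ltgtP t 0; last first.
    by rewrite of_real0 scale0r mul0r !addr0; exact: Gdom.
  + have := cle _ _ (Gscale t^-1 _ _ Gxa).
    rewrite -(ler_pM2l t0) mulrDr mulVKf ?gt_eqF // => /le_trans; apply.
    rewrite -[X in X * _]gtr0_norm // -rnormZr scalerDr scalerA -of_realM divff ?gt_eqF //.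
    by rewrite of_real1 scale1r.
  + have s0 : 0 < - t by rewrite oppr_gt0.
    have := cge _ _ (Gscale (- t)^-1 _ _ Gxa).
    rewrite -(ler_pM2l s0) mulrBr mulVKf ?gt_eqF // mulNr opprK => /le_trans; apply.
    rewrite -[X in X * _]gtr0_norm // -rnormZr scalerBr scalerA -of_realM divff ?gt_eqF //.
    by rewrite of_real1 scale1r of_realN scaleNr opprK.
- exists x0, (rnorm x0), 0; split; last by rewrite of_real0 scale0r mul0r !addr0.
  exact: Gx0 G0.
Qed.

Lemma real_norming_functional : exists u : V -> R,
  [/\ forall t x y, u (t *:r x + y) = t * u x + u y,
      forall x, u x <= rnorm x & u x0 = rnorm x0].
Proof.
have [F Fdom Ftot|G [[Glin Gdom Gx0] Gmax]] := @Zorn_bigcup _ dominated_graph.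
  split=> [t x y a b [G FG Gx] [G' FG' Gy]|x a [G FG Gx]|z [G FG Gz]].
  - have [GG'|G'G] := Ftot _ _ FG FG'.
      by exists G' => //; have [h _ _] := Fdom _ FG'; apply: h => //; exact: GG'.
    by exists G => //; have [h _ _] := Fdom _ FG; apply: h => //; exact: G'G.
  - by have [_ h _] := Fdom _ FG; exact: h.
  - by exists G => //; have [_ _ h] := Fdom _ FG; exact: h Gz.
have {}Gx0 : G (x0, rnorm x0).
  have [[z /Gx0//]|/nonemptyPn Ge] := pselect (G !=set0).
  exfalso; apply: Gmax line_dominated; rewrite Ge; split; first exact: sub0set.
  by move=> /(_ (0 *:r x0, 0 * rnorm x0)); apply; exists 0.
have G0 : G (0, 0).
  by have := Glin (-1) _ _ _ _ Gx0 Gx0; rewrite scaleN1 mulN1r !addNr.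
have Gtotal y : exists a, G (y, a).
  apply: contrapT => ny.
  have [c Gc] := @dominated_ext G y (And3 Glin Gdom (fun _ _ => Gx0)) G0.
  apply: Gmax Gc; split=> [[x a] Gxa|sub].
    by exists x, a, 0; split=> //; rewrite of_real0 scale0r mul0r !addr0.
  apply: ny; exists c; apply: sub; exists 0, 0, 1; split=> //.
  by rewrite of_real1 scale1r mul1r !add0r.
have /choice[u uG] := Gtotal.
have Gfun x a : G (x, a) -> u x = a.
  move=> Gxa.
  have /Gdom := Glin (-1) _ _ _ _ Gxa (uG x).
  have /Gdom := Glin (-1) _ _ _ _ (uG x) Gxa.
  by rewrite !scaleN1 !mulN1r addNr rnorm0; lra.
exists u; split=> [t x y|x|]; last exact: Gfun.
- by apply: Gfun; apply: Glin.
- exact: Gdom.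
Qed.

End RealHahnBanach.

(** Hahn-Banach for the functional t x0 |-> t |x0|, with real or complex scalars. *)
Lemma norming_functional (R : realType) (k : scalar_kind)
    (V : normedModType (scalar_field R k)) (x0 : V) :
  exists f : dual_space V, (forall x, modulus (f x : scalar_field R k) <= rnorm x) /\
    f x0 = of_real k (rnorm x0).
Proof.
have [u [ulin udom ux0]] := real_norming_functional x0.
have uN x : u (- x) = - u x.
  have u0 : u 0 = 0.
    by have := ulin (-1) 0 0; rewrite scaler0 addr0 mulN1r addNr.
  by have := ulin (-1) x 0; rewrite of_realN of_real1 scaleN1r mulN1r u0 !addr0.
have uabs x : `|u x| <= rnorm x.
  by rewrite ler_norml udom andbT lerNl -uN -[rnorm x]rnormN udom.
case: k V x0 u ulin udom ux0 uN uabs => V x0 u ulin udom ux0 uN uabs.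
  have lu : linear (u : V -> (scalar_field R RealScalars)^o) by move=> t x y; rewrite ulin.
  have bu : exists M : R, forall x, rnorm (u x : (scalar_field R RealScalars)^o) <= M * rnorm x.
    by exists 1 => x; rewrite mul1r; exact: uabs.
  by exists (operator_of lu bu).
(* A complex functional is recovered from its real part u as u x - i u(i x). *)
pose iC : scalar_field R ComplexScalars := ('i)%C.
pose f (x : V) : (scalar_field R ComplexScalars)^o := (u x +i* - u (iC *: x))%C.
have uZ t x : u (of_real ComplexScalars t *: x) = t * u x.
  have := ulin t x 0; rewrite !addr0 => ->.
  by have := ulin (-1) 0 0; rewrite scaler0 addr0 mulN1r addNr => ->; rewrite addr0.
have uD x y : u (x + y) = u x + u y.
  by have := ulin 1 x y; rewrite of_real1 scale1r mul1r.
have lf : linear f.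
  move=> [a b] x y.
  have abE (z : V) : ((a +i* b)%C : scalar_field R ComplexScalars) *: z
       = of_real ComplexScalars a *: z + iC *: (of_real ComplexScalars b *: z).
    rewrite scalerA -scalerDl; congr (_ *: _); apply/eqP; rewrite eq_complex /= /iC.
    by apply/andP; split; apply/eqP => /=; simpc.
  have iiE (z : V) : iC *: (iC *: z) = - z.
    rewrite scalerA; have -> : iC * iC = -1; last by rewrite scaleN1r.
    by rewrite -expr2; exact: sqr_i.
  have iCE (t : R) (z : V) : iC *: (of_real ComplexScalars t *: z) = of_real ComplexScalars t *: (iC *: z).
    by rewrite !scalerA mulrC.
  have re : u ((a +i* b)%C *: x + y) = a * u x + b * u (iC *: x) + u y.
    by rewrite uD (abE x) uD iCE !uZ.
  have im : u (iC *: ((a +i* b)%C *: x + y)) = a * u (iC *: x) - b * u x + u (iC *: y).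
    by rewrite scalerDr uD (abE x) scalerDr uD iCE uZ iiE uN uZ.
  rewrite /f re im; apply/eqP; rewrite eq_complex /=; apply/andP; split; apply/eqP; ring.
have fabs x : modulus (f x) <= rnorm x.
  have [f0|f0] := eqVneq (f x) 0; first by rewrite f0 modulus0 rnorm_ge0.
  (* Rotating x makes f x real, and then f x = u x. *)
  pose th : scalar_field R ComplexScalars := of_real _ (modulus (f x)) / f x.
  have fth : f (th *: x) = of_real _ (modulus (f x)).
    have := lf th x 0; rewrite !addr0.
    have -> : f 0 = 0 by have := lf (-1) 0 0; rewrite scaler0 addr0 scaleN1r addNr.
    by rewrite addr0 => ->; rewrite /th /GRing.scale /= divfK.
  have : u (th *: x) = modulus (f x) by have /(congr1 (@complex.Re R)) := fth.
  move=> <-; apply: le_trans (udom _) _; rewrite rnormZm modulusM modulusV.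
  by rewrite modulus_of_real ger0_norm ?modulus_ge0 // divff ?mul1r // lt0r_neq0 // modulus_gt0.
have bf : exists M : R, forall x, rnorm (f x) <= M * rnorm x.
  by exists 1 => x; rewrite mul1r; exact: fabs.
exists (operator_of lf bf); split => //.
have := fabs x0; rewrite modulus_complexE /= ux0 => h.
have : (- u (iC *: x0)) ^+ 2 <= 0.
  have := ler_pM (sqrtr_ge0 _) (sqrtr_ge0 _) h h.
  by rewrite -!expr2 sqr_sqrtr ?addr_ge0 ?sqr_ge0 //; lra.
move=> im2; have im0 : u (iC *: x0) = 0.
  by apply/eqP; rewrite -oppr_eq0 -sqrf_eq0 eq_le sqr_ge0 andbT.
by rewrite /= /f ux0 im0 oppr0.
Qed.

(** * Completeness of the space of compact operators *)

Section TotallyBounded.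
Context {R : realType} {k : scalar_kind}.
Local Notation K := (scalar_field R k).

Definition totally_bounded (V : normedModType K) (A : set V) : Prop :=
  forall e : R, 0 < e -> exists s : seq V,
    forall x, A x -> exists2 y, y \in s & rnorm (y - x) < e.

Lemma precompact_totally_bounded (V : normedModType K) (A : set V) :
  precompact A -> totally_bounded A.
Proof.
rewrite precompactE compact_cover => cA e e0.
have eK : 0 < of_real k e by rewrite of_real_gt0.
have [|x _|D _ AD] := cA V setT (fun y => (ball y (of_real k e))^°).
- by move=> y _; exact: open_interior.
- by exists x => //; exact: nbhsx_ballx.
exists (finmap.enum_fset D) => x /subset_closure/AD[y /= yD /interior_subset yx].
by exists y => //; move/(ball_rnorm _ _ eK) : yx; rewrite of_realK.
Qed.

(** An ultrafilter containing a totally bounded set contains one of finitely many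
small balls, so it is Cauchy. *)
Lemma totally_bounded_precompact (V : completeNormedModType K) (A : set V) :
  totally_bounded A -> precompact A.
Proof.
move=> tA; rewrite precompactE compact_ultra => F UF FA.
have cauchyF : cauchy F.
  apply: cauchy_exP => e eK; have e0 := real_part_gt0 eK.
  have [|s As] := tA (real_part e / 2); first by rewrite divr_gt0.
  have sF : F [set x | exists2 y, y \in s & ball y e x].
    apply: filterS FA => x clAx.
    have [|z [Az xz]] := clAx [set z | rnorm (x - z) < real_part e / 2].
      by apply/nbhs_rnorm; exists (real_part e / 2) => //; rewrite divr_gt0.
    have [y ys yz] := As _ Az; exists y => //; apply/ball_rnorm => //.
    by have := rnorm_triangle y z x; rewrite (rnormBC z x); move: xz => /=; lra.
  elim: s sF {As} => [|y s ih] sF.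
    by have [x [y]] := filter_ex sF; rewrite in_nil.
  have [yF|yF] := in_ultra_setVsetC (ball y e) UF; first by exists y.
  apply: ih; apply: filterS (filterI sF yF) => x [[z + zx] nyx].
  by rewrite inE => /predU1P[zy|zs]; [rewrite zy in zx|exists z].
have /cauchy_cvg Fl := cauchyF.
exists (lim F); split => //.
apply: (@closed_closure _ A) => B /Fl FB; have [x [Ax Bx]] := filter_ex (filterI FA FB).
by exists x.
Qed.

End TotallyBounded.

Section CompactComplete.
Context {R : realType} {k : scalar_kind}.
Local Notation K := (scalar_field R k).

Lemma rnorm_compact_op (X Y : normedModType K) (T : compact_op X Y) :
  rnorm T = opnorm (T : bounded_op X Y).
Proof. exact: rnorm_opnorm. Qed.

Lemma bounded_op_complete (X Y : normedModType K) :
  norm_complete Y -> norm_complete (bounded_op X Y).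
Proof.
move=> cY u cu.
have uB m n x : rnorm (u m x - u n x) <= rnorm (u m - u n) * rnorm x.
  by rewrite rnorm_opnorm; exact: (le_opnorm (u m - u n) x).
have cux x : norm_cauchy (fun n => u n x).
  move=> e e0; have x0 : 0 < rnorm x + 1 by rewrite ltr_wpDl // rnorm_ge0.
  have [|N uN] := cu (e / (rnorm x + 1)); first by rewrite divr_gt0.
  exists N => m n Nm Nn; apply: le_lt_trans (uB _ _ _) _.
  apply: (@le_lt_trans _ _ (rnorm (u m - u n) * (rnorm x + 1))).
    by rewrite ler_wpM2l ?rnorm_ge0 // lerDl.
  by rewrite -ltr_pdivlMr // uN.
have /choice[T uT] : forall x, exists l, norm_cvg (fun n => u n x) l.
  by move=> x; exact: cY.
have linT : linear T.
  move=> a x y; apply: norm_cvg_unique (uT _) _.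
  suff -> : (fun n => u n (a *: x + y)) = (fun n => a *: u n x + u n y).
    exact: norm_cvg_lin.
  by apply/funext => n; rewrite linearP.
have close (e : R) : 0 < e -> exists N, forall n, (N <= n)%N ->
    forall x, rnorm (u n x - T x) <= e * rnorm x.
  move=> /cu[N uN]; exists N => n Nn x.
  apply: (@norm_cvg_le _ _ _ (fun m => u n x - u m x)).
    exact: norm_cvgB (@norm_cvg_cst _ _ _ (u n x)) (uT x).
  exists N => m Nm; apply: le_trans (uB _ _ _) _.
  by rewrite ler_wpM2r ?rnorm_ge0 // ltW // uN.
have bT : exists M : R, forall x, rnorm (T x) <= M * rnorm x.
  have [N uN] := close _ ltr01; exists (opnorm (u N) + 1) => x.
  rewrite -[T x](subKr (u N x)) mulrDl; apply: rnormB_le; first exact: le_opnorm.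
  exact: uN.
exists (operator_of linT bT) => e e0.
have [|N uN] := close (e / 2); first by rewrite divr_gt0.
exists N => n Nn; rewrite rnorm_opnorm.
apply: (@le_lt_trans _ _ (e / 2)); last by rewrite ltr_pdivrMr // ltr_pMr // ltr1n.
apply: opnorm_le => [|x]; first by rewrite divr_ge0 ?ltW.
exact: uN.
Qed.

(** Completeness holds for all bounded operators; a norm limit of compact ones
maps the unit ball to a totally bounded set. *)
Lemma compact_op_complete (X : normedModType K) (Y : completeNormedModType K) :
  norm_complete (compact_op X Y).
Proof.
move=> u cu.
have [T uT] := bounded_op_complete (@completeNormedModType_complete R k Y)
  (cu : norm_cauchy (fun n => u n : bounded_op X Y)).
have cT : T \in compact_op_pred.
  rewrite inE /=; apply: totally_bounded_precompact => e e0.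
  have e2 : 0 < e / 2 by rewrite divr_gt0.
  have [N uN] := uT _ e2.
  have := compact_op_subproof (u N); rewrite inE => /precompact_totally_bounded.
  move=> /(_ _ e2)[s us]; exists s => _ [x x1 <-].
  have [|y ys yx] := us (u N x); first by exists x.
  exists y => //.
  have := rnorm_triangle y (u N x) (T x).
  have x1' : rnorm x <= 1.
    by move: x1 => /=; rewrite rnormE -of_real1 ler_of_real.
  have : rnorm (u N x - T x) <= rnorm ((u N : bounded_op X Y) - T) * 1.
    by rewrite rnorm_opnorm; exact: (@rnorm_operator_le _ _ _ _ ((u N : bounded_op X Y) - T)).
  have := uN N (leqnn N); lra.
exists (CompactOp cT) => e /uT[N uN].
by exists N => n /uN.
Qed.

End CompactComplete.

(** * Complemented subspaces from operators that are bounded below *)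

Section Transfer.
Context {R : realType} {k : scalar_kind}.
Local Notation K := (scalar_field R k).
Variables (V W : normedModType K).

Lemma infdim_closed_subspaceP (U : normedModType K) (E : set U) :
  infdim_closed_subspace E <-> [/\ subspace E, closed E & ~ finite_dim E].
Proof. by split=> -[sE cE nfE]; split=> //; apply/subspaceP. Qed.

(** Phi is still bounded below on the closure E of F, hence an isomorphism of E
onto a closed subspace of W, as V is complete. A projection Pi of W onto some Z'
inside Phi E pulls back to the projection v |-> (Phi on E)^-1 (Pi (Phi v)). *)
Lemma subprojective_pullback (Phi : bounded_op V W) (Y F : set V) (c : R) :
  norm_complete V -> subprojective W -> closed Y ->
  subspace F -> F `<=` Y -> ~ finite_dim F ->
  0 < c -> (forall y, F y -> c * rnorm y <= rnorm (Phi y)) ->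
  exists Z : set V, [/\ infdim_closed_subspace Z, Z `<=` Y & complemented Z].
Proof.
move=> cV spW clY sF FY nfF c0 cF.
pose E := closure F.
have EY : E `<=` Y by rewrite (closure_id Y).1 //; exact: closure_subset.
have sE : subspace E := subspace_closure sF.
have clE : closed E := @closed_closure _ F.
have nfE : ~ finite_dim E := infdim_subset sF (@subset_closure _ F) nfF.
have cE y : E y -> c * rnorm y <= rnorm (Phi y).
  move=> Ey; apply/ler_addgt0Pr => e e0.
  have b0 : 0 < c + opnorm Phi by rewrite ltr_wpDr // opnorm_ge0.
  have [|z [Fz yz]] := Ey [set z | rnorm (y - z) < e / (c + opnorm Phi)].
    by apply/nbhs_rnorm; exists (e / (c + opnorm Phi)) => //; rewrite divr_gt0.
  move: yz => /=; rewrite ltr_pdivlMr // mulrDr => yz.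
  have h1 : c * rnorm y <= c * rnorm z + c * rnorm (y - z).
    by rewrite -mulrDr ler_pM2l // -{1}[y](subrK z) addrC rnormD_le.
  have h2 : rnorm (Phi z) <= rnorm (Phi y) + opnorm Phi * rnorm (y - z).
    rewrite -{1}[z](subKr y) operatorB rnormB_le //; exact: le_opnorm.
  by have := cF z Fz; move: yz; rewrite ![rnorm (y - z) * _]mulrC; lra.
have injE x y : E x -> E y -> Phi x = Phi y -> x = y.
  move=> Ex Ey xy; apply/eqP; rewrite -subr_eq0; apply/eqP/rnorm0_eq0/le_anti.
  rewrite rnorm_ge0 andbT -(ler_pM2l c0) mulr0.
  by have := cE _ (subspaceB sE Ex Ey); rewrite operatorB xy subrr rnorm0.
have sPE : subspace (Phi @` E).
  split; first by exists 0; [case: sE|rewrite operator0].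
  move=> a _ _ [x Ex <-] [y Ey <-]; exists (a *: x + y); last by rewrite linearP.
  by case: sE => _; apply.
have clPE : closed (Phi @` E).
  apply/closed_rnorm => w wE.
  have /choice[y yE] : forall n : nat, exists y, E y /\ rnorm (w - Phi y) < n.+1%:R^-1.
    move=> n; have [|_ [y Ey <-] wy] := wE n.+1%:R^-1; first by rewrite invr_gt0.
    by exists y.
  have Phi_y : norm_cvg (fun n => Phi (y n)) w.
    move=> e /natSinv_small[N Ne]; exists N => n Nn.
    by rewrite rnormBC; exact: lt_trans (yE n).2 (Ne _ Nn).
  have cy : norm_cauchy y.
    move=> e e0; have [|N wN] := Phi_y (c * e / 2); first by rewrite divr_gt0 // mulr_gt0.
    exists N => m n Nm Nn; rewrite -(ltr_pM2l c0).
    apply: le_lt_trans (cE _ (subspaceB sE (yE m).1 (yE n).1)) _; rewrite operatorB.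
    have := rnorm_triangle (Phi (y m)) w (Phi (y n)); rewrite (rnormBC w).
    by have := wN _ Nm; have := wN _ Nn; set t := c * e; lra.
  have [l yl] := cV _ cy; exists l.
    by apply: closed_norm_cvg yl => // n; exact: (yE n).1.
  exact: norm_cvg_unique (norm_cvg_operator Phi yl) Phi_y.
have nfPE : ~ finite_dim (Phi @` E).
  move=> [n [w [Ew spanE]]]; apply: nfE.
  have /choice[v vE] : forall i, exists v, E v /\ Phi v = w i by move=> i; have [v] := Ew i; exists v.
  exists n, v; split=> [i|x Ex]; first exact: (vE i).1.
  have [|a xa] := spanE (Phi x); first by exists x.
  exists a; apply: injE => //.
    apply: subspace_sum => // i _; apply: subspaceZ (sE) (vE i).1.
  rewrite xa operator_sum; apply: eq_bigr => i _.
  by rewrite operatorZ (vE i).2.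
have [Z' [/infdim_closed_subspaceP[sZ' clZ' nfZ'] Z'E [Pi [PiPi PiZ']]]] :=
  spW _ ((infdim_closed_subspaceP _).2 (And3 sPE clPE nfPE)).
have /choice[Q QE] : forall v, exists y, E y /\ Phi y = Pi (Phi v).
  move=> v; have : Z' (Pi (Phi v)) by rewrite -PiZ'; exists (Phi v).
  by move=> /Z'E[y]; exists y.
have linQ (a : K) (x y : V) : Q (a *: x + y) = a *: Q x + Q y.
  apply: injE; first exact: (QE _).1.
    by case: (sE) => _ Elin; apply: Elin; [exact: (QE x).1|exact: (QE y).1].
  by rewrite (QE (a *: x + y)).2 !linearP /= (QE x).2 (QE y).2.
have bQ : exists M : R, forall v, rnorm (Q v) <= M * rnorm v.
  exists (opnorm Pi * opnorm Phi / c) => v; rewrite mulrAC ler_pdivlMr // mulrC.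
  apply: le_trans (cE _ (QE v).1) _; rewrite (QE v).2 -mulrA.
  by apply: rnorm_operator_le => //; exact: le_opnorm.
have QQ v : Q (Q v) = Q v.
  by apply: injE; rewrite ?(QE _).2 ?PiPi //; exact: (QE _).1.
have fixQ y : E y -> Z' (Phi y) -> Q y = y.
  move=> Ey; rewrite -PiZ' => -[w _ wy]; apply: injE => //; first exact: (QE _).1.
  by rewrite (QE y).2 -wy PiPi.
have ZE : E `&` (Phi @^-1` Z') = range Q.
  apply/seteqP; split=> [y [Ey Zy]|_ [v _ <-]]; first by exists y => //; exact: fixQ.
  split; first exact: (QE v).1.
  by rewrite /= (QE v).2 -PiZ'; exists (Phi v).
exists (E `&` (Phi @^-1` Z')); split.
- apply/infdim_closed_subspaceP; split.
  + split; first by split; [case: sE|rewrite /= operator0; case: sZ'].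
    move=> a x y [Ex Zx] [Ey Zy]; split; first by case: sE => _; apply.
    by rewrite /= linearP; case: sZ' => _; apply.
  + apply: closedI => //; apply: preimage_closed => // x _.
    exact: bounded_op_continuous.
  + move=> [n [e [eE spanE]]]; apply: nfZ'; exists n, (fun i => Phi (e i)).
    split=> [i|w Zw]; first by case: (eE i).
    have [y Ey yw] := Z'E _ Zw.
    have [|a ya] := spanE y; first by split; rewrite //= yw.
    exists a; rewrite -yw ya operator_sum.
    by apply: eq_bigr => i _; rewrite operatorZ.
- by move=> y [Ey _]; exact: EY.
- by exists (operator_of (linQ : linear Q) bQ); split.
Qed.

End Transfer.

(** * Gliding humps and strictly singular seminorms *)

Section GlidingHump.
Context {R : realType} {k : scalar_kind}.
Local Notation K := (scalar_field R k).
Implicit Types (V W : normedModType K).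

(** Dependent choice for gliding humps: the j-th vector lives between the stages
m_j and m_(j+1), and its properties mention no earlier vector. *)
Lemma gliding_choice (T : Type) (P : nat -> nat -> nat -> T -> Prop) :
  (forall j m, exists m' t, (m < m')%N /\ P j m m' t) ->
  exists (m : nat -> nat) (t : nat -> T),
    forall j, (m j < m j.+1)%N /\ P j (m j) (m j.+1) (t j).
Proof.
move=> step.
have /choice[f fP] : forall jm : nat * nat, exists mt : nat * T,
    (jm.2 < mt.1)%N /\ P jm.1 jm.2 mt.1 mt.2.
  by move=> [j m]; have [m' [t ?]] := step j m; exists (m', t).
pose m := fix m j := if j is i.+1 then (f (i, m i)).1 else 0%N.
by exists m, (fun j => (f (j, m j)).2) => j; exact: (fP (j, m j)).
Qed.

Lemma sum_half_powers (n : nat) : \sum_(j < n) (2^-1 : R) ^+ j.+1 = 1 - 2^-1 ^+ n.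
Proof.
elim: n => [|n ih]; first by rewrite big_ord0 expr0 subrr.
by rewrite big_ord_recr /= ih exprS; set t := _ ^+ n; lra.
Qed.

Lemma sum_half_powers_le1 (n : nat) : \sum_(j < n) (2^-1 : R) ^+ j.+1 <= 1.
Proof. by rewrite sum_half_powers gerBl exprn_ge0. Qed.

Definition seminorm V (N : V -> R) : Prop :=
  (forall x y, N (x + y) <= N x + N y) /\ forall (a : K) x, N (a *: x) = modulus a * N x.

Lemma seminorm0 V (N : V -> R) : seminorm N -> N 0 = 0.
Proof. by move=> [_ NZ]; rewrite -(scale0r 0) NZ modulus0 mul0r. Qed.

Lemma seminormN V (N : V -> R) x : seminorm N -> N (- x) = N x.
Proof. by move=> [_ NZ]; rewrite -scaleN1r NZ modulusN modulus1 mul1r. Qed.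

Lemma seminorm_ge0 V (N : V -> R) x : seminorm N -> 0 <= N x.
Proof.
move=> sN; have := sN.1 x (- x); rewrite subrr seminorm0 // seminormN //.
by rewrite -mulr2n pmulrn_lge0.
Qed.

Lemma seminorm_sum V (N : V -> R) (I : Type) (r : seq I) (P : pred I) (F : I -> V) :
  seminorm N -> N (\sum_(i <- r | P i) F i) <= \sum_(i <- r | P i) N (F i).
Proof.
move=> sN; elim/big_rec2 : _ => [|i x y _ xy]; first by rewrite seminorm0.
by apply: le_trans (sN.1 _ _) _; rewrite lerD2l.
Qed.

Lemma seminorm_rnorm V : seminorm (@rnorm R k V).
Proof. by split; [exact: ler_rnormD|exact: rnormZm]. Qed.

Lemma seminorm_comp V W (N : W -> R) (f : V -> W) :
  linear f -> seminorm N -> seminorm (fun x => N (f x)).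
Proof.
move=> lf [ND NZ].
have f0 : f 0 = 0 by have := lf (-1) 0 0; rewrite scaler0 addr0 scaleN1r addNr.
split=> [x y|a x]; first by have := lf 1 x y; rewrite !scale1r => ->.
by have := lf a x 0; rewrite f0 !addr0 => ->.
Qed.

Definition finite_span V (t : nat -> V) : set V :=
  [set y | exists n (a : nat -> K), y = \sum_(j < n) a j *: t j].

Lemma sum_pad V (t : nat -> V) (n n' : nat) (a : nat -> K) : (n <= n')%N ->
  \sum_(j < n) a j *: t j = \sum_(j < n') (if (j < n)%N then a j else 0) *: t j.
Proof.
move=> nn'; rewrite (big_ord_widen n' (fun j => a j *: t j)) // big_mkcond.
by apply: eq_bigr => j _; case: ifP => // _; rewrite scale0r.
Qed.

Lemma subspace_finite_span V (t : nat -> V) : subspace (finite_span t).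
Proof.
split; first by exists 0%N, (fun=> 0); rewrite big_ord0.
move=> c _ _ [n [a ->]] [n' [a' ->]].
rewrite (sum_pad t a (leq_maxl n n')) (sum_pad t a' (leq_maxr n n')).
exists (maxn n n'), (fun j => c * (if (j < n)%N then a j else 0) + (if (j < n')%N then a' j else 0)).
rewrite scaler_sumr -big_split /=; apply: eq_bigr => j _.
by rewrite scalerDl -scalerA.
Qed.

(** An exhausting sequence of seminorms of finite rank stands for a bounded
approximation of the identity by finite rank operators S_m, with M_m (v) the
norm of S_m v. *)
Definition approximating_seminorms V (M : nat -> V -> R) (C : R) : Prop :=
  [/\ forall m, seminorm (M m) /\ (forall v, M m v <= C * rnorm v),
      forall v, rnorm v = 1 -> exists N, forall m, (N <= m)%N -> 2^-1 <= M m v,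
      forall m m' v, (m <= m')%N -> M m' v = 0 -> M m v = 0 &
      forall m, exists n (g : nat -> V -> K), (forall i, linear_for *%R (g i)) /\
        forall v, (forall i, (i < n)%N -> g i v = 0) -> M m v = 0].

Section StrictlySingular.
Variables (V : normedModType K) (M : nat -> V -> R) (C : R).
Hypothesis approxM : approximating_seminorms M C.

Lemma infdim_null (F : set V) (m : nat) : subspace F -> ~ finite_dim F ->
  exists F' : set V, [/\ subspace F', ~ finite_dim F', F' `<=` F & forall y, F' y -> M m y = 0].
Proof.
move=> sF nfF; have [_ _ _ /(_ m)[n [g [lg gM]]]] := approxM.
have [sF' nfF'] := infdim_ker n sF nfF lg.
by eexists; split; [exact: sF'|exact: nfF'|move=> y []|move=> y [_ /gM]].
Qed.

(** The coefficients of a gliding hump sequence are controlled by constants that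
depend on C only and not on the sequence: the i-th coefficient is seen by
M_(m_(i+1)), which kills all later vectors. *)
Lemma gliding_coefficient_bound (m : nat -> nat) (t : nat -> V) (n : nat) (a : nat -> K) :
  (forall j, (m j < m j.+1)%N) -> (forall j, rnorm (t j) = 1) ->
  (forall j, M (m j) (t j) = 0) -> (forall j, 2^-1 <= M (m j.+1) (t j)) ->
  forall i, (i < n)%N ->
    modulus (a i) <= (1 + 2 * C) ^+ i.+1 * rnorm (\sum_(j < n) a j *: t j).
Proof.
move=> minc t1 Mt0 Mt2; have [sM _ monM _] := approxM.
set y := \sum_(j < n) _.
have C0 : 0 <= C.
  have := (sM (m 1%N)).2 (t 0%N); rewrite t1 mulr1; apply: le_trans.
  by apply: le_trans (Mt2 0%N); rewrite invr_ge0.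
have mmono : {homo m : i j / (i <= j)%N}.
  by apply: homo_leq => // [x y' z|i]; [exact: leq_trans|exact: ltnW].
suff main i : (i <= n)%N -> rnorm y + \sum_(l < i) modulus (a l) <= (1 + 2 * C) ^+ i * rnorm y.
  move=> i i_n; apply: le_trans (main _ i_n); rewrite big_ord_recr /= addrA lerDr.
  by rewrite addr_ge0 ?rnorm_ge0 // sumr_ge0 // => l _; exact: modulus_ge0.
elim: i => [|i ih] i_n; first by rewrite big_ord0 addr0 expr0 mul1r.
have {}ih := ih (ltnW i_n).
have yE : y = \sum_(j < i) a j *: t j + (a i *: t i + \sum_(i.+1 <= j < n) a j *: t j).
  transitivity (\sum_(0 <= j < n) a j *: t j); first by rewrite big_mkord.
  rewrite (big_cat_nat (leq0n i) (ltnW i_n)) big_mkord /=.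
  by congr (_ + _); exact: big_ltn.
have tail0 : M (m i.+1) (\sum_(i.+1 <= j < n) a j *: t j) = 0.
  apply/le_anti; rewrite seminorm_ge0 ?andbT; last exact: (sM _).1.
  apply: le_trans (seminorm_sum _ _ _ (sM _).1) _.
  rewrite big_nat big1 // => j /andP[ij _].
  rewrite (sM _).1.2 (@monM _ (m j)) ?mulr0 //; exact: mmono.
have ai : modulus (a i) <= 2 * C * (rnorm y + \sum_(l < i) modulus (a l)).
  have h1 : modulus (a i) * 2^-1 <= M (m i.+1) (a i *: t i).
    by rewrite (sM _).1.2 ler_wpM2l ?modulus_ge0.
  have h2 : M (m i.+1) (a i *: t i) <= C * (rnorm y + \sum_(l < i) modulus (a l)).
    have -> : a i *: t i = (y - \sum_(j < i) a j *: t j) - \sum_(i.+1 <= j < n) a j *: t j.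
      by rewrite yE [X in X - _]addrC addKr addrK.
    apply: le_trans ((sM _).1.1 _ _) _.
    rewrite seminormN ?tail0 ?addr0; last exact: (sM _).1.
    apply: le_trans ((sM _).2 _) _; rewrite ler_wpM2l //.
    apply: rnormB_le => //; apply: le_trans (ler_rnorm_sum _ _ _) _.
    by apply: ler_sum => l _; rewrite rnormZm t1 mulr1.
  by rewrite -mulrA; move: h1 h2; set u := C * _; lra.
rewrite big_ord_recr /= addrA exprS -mulrA.
move: ai ih; set s := rnorm y + _; set u := _ * rnorm y => ai ih.
apply: (@le_trans _ _ ((1 + 2 * C) * s)); first by rewrite mulrDl mul1r lerD2l.
by rewrite ler_wpM2l // addr_ge0 // mulr_ge0.
Qed.

(** Build a gliding hump sequence in F along which N decreases fast. As the
coefficients of a vector in its span are bounded by constants known in advance,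
the speed can be chosen so that N is uniformly small on the whole span. *)
Lemma strictly_singular_small (F : set V) (N : V -> R) (e : R) :
  subspace F -> ~ finite_dim F -> seminorm N -> 0 < e ->
  (forall (F' : set V) (c : R), subspace F' -> ~ finite_dim F' -> F' `<=` F -> 0 < c ->
    exists2 y, F' y & N y < c * rnorm y) ->
  exists F' : set V, [/\ subspace F', ~ finite_dim F', F' `<=` F &
    forall y, F' y -> N y <= e * rnorm y].
Proof.
move=> sF nfF sN e0 ssN; have [sM M1 _ _] := approxM.
have [|C0] := ltP (1 + 2 * C) 1.
  rewrite gtrDl => C0; exfalso; have [v _ v1] := infdim_unit_vector sF nfF.
  have := (sM 0%N).2 v; rewrite v1 mulr1 leNgt => /negP; apply.
  by apply: (@lt_le_trans _ _ 0); [move: C0; lra|exact: seminorm_ge0 (sM 0%N).1].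
pose D := 1 + 2 * C; have D0 : 0 < D by apply: lt_le_trans C0.
(* D ^+ j.+1 cancels the coefficient bound, and the powers of 1/2 sum to 1. *)
pose d j := e * (2^-1 / D) ^+ j.+1.
have d0 j : 0 < d j by rewrite mulr_gt0 // exprn_gt0 // divr_gt0.
have [j m|m [t mt]] := @gliding_choice V (fun j m m' t =>
    [/\ F t, rnorm t = 1, M m t = 0, N t <= d j & 2^-1 <= M m' t]).
  have [F' [sF' nfF' F'F F'M]] := infdim_null m sF nfF.
  have [y F'y Ny] := ssN _ _ sF' nfF' F'F (d0 j).
  have y0 : 0 < rnorm y.
    rewrite -(pmulr_rgt0 _ (d0 j)); apply: le_lt_trans Ny; exact: seminorm_ge0.
  pose c := of_real k (rnorm y)^-1.
  have mc : modulus c = (rnorm y)^-1 by rewrite modulus_of_real ger0_norm // invr_ge0 ltW.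
  have cy1 : rnorm (c *: y) = 1 by rewrite rnormZm mc mulVf // gt_eqF.
  have [N0 N0M] := M1 _ cy1.
  exists (maxn m.+1 N0), (c *: y); split; first exact: leq_maxl.
  split => //; last exact/N0M/leq_maxr.
  - by apply: F'F; exact: subspaceZ.
  - by rewrite (sM _).1.2 F'M // mulr0.
  - by rewrite sN.2 mc mulrC ler_pdivrMr // ltW.
have minc j : (m j < m j.+1)%N by case: (mt j).
have tE j : [/\ F (t j), rnorm (t j) = 1, M (m j) (t j) = 0, N (t j) <= d j & 2^-1 <= M (m j.+1) (t j)].
  by case: (mt j).
have bound n a := @gliding_coefficient_bound m t n a minc
  (fun j => let: And5 _ h _ _ _ := tE j in h) (fun j => let: And5 _ _ h _ _ := tE j in h)
  (fun j => let: And5 _ _ _ _ h := tE j in h).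
exists (finite_span t); split.
- exact: subspace_finite_span.
- apply: (independent_infdim (v := t)) => [j|n a ay0 j jn].
    exists j.+1, (fun i => (i == j)%:R); rewrite big_ord_recr /= eqxx scale1r big1 ?add0r // => i _.
    by rewrite (ltn_eqF (ltn_ord i)) scale0r.
  apply: modulus0_eq0; apply/le_anti; rewrite modulus_ge0 andbT.
  by apply: le_trans (bound _ _ _ jn) _; rewrite ay0 rnorm0 mulr0.
- move=> _ [n [a ->]]; apply: subspace_sum => // j _; apply: subspaceZ => //.
  by case: (tE j).
- move=> _ [n [a ->]]; set y := \sum_(j < n) _.
  apply: le_trans (seminorm_sum _ _ _ sN) _.
  apply: (@le_trans _ _ (\sum_(j < n) 2^-1 ^+ j.+1 * (e * rnorm y))); last first.
    rewrite -mulr_suml -[leRHS]mul1r ler_wpM2r ?sum_half_powers_le1 //.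
    by rewrite mulr_ge0 ?rnorm_ge0 // ltW.
  apply: ler_sum => j _; rewrite sN.2.
  have [_ _ _ Nt _] := tE j.
  apply: le_trans (ler_pM (modulus_ge0 _) (seminorm_ge0 _ sN) (bound _ a j (ltn_ord j)) Nt) _.
  have Dj : D ^+ j.+1 != 0 by rewrite expf_neq0 // gt_eqF.
  rewrite -/y -/D /d exprMn (exprVn D).
  move: (D ^+ j.+1) Dj (2^-1 ^+ j.+1) (rnorm y) => x x0 h r.
  by rewrite le_eqVlt; apply/orP; left; apply/eqP; field.
Qed.

End StrictlySingular.
End GlidingHump.

(** * Complemented copies of c_0 *)

Lemma strong_recursion (T : Type) (x0 : T) (F : nat -> (nat -> T) -> T) :
  (forall n u v, (forall i, (i < n)%N -> u i = v i) -> F n u = F n v) ->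
  exists u : nat -> T, forall n, u n = F n u.
Proof.
move=> extF.
pose us := fix us n : nat -> T :=
  if n is m.+1 then fun i => if (i < m)%N then us m i else F m (us m) else fun=> x0.
have usE n i : (i < n)%N -> us n i = us i.+1 i.
  elim: n => // n ih; rewrite ltnS leq_eqVlt => /predU1P[->//|i_n].
  by rewrite -ih //= i_n.
exists (fun n => us n.+1 n) => n; rewrite [LHS]/= ltnn.
by apply: extF => i; exact: usE.
Qed.

Section CZeroProjection.
Context {R : realType} {k : scalar_kind}.
Local Notation K := (scalar_field R k).
Variable V : normedModType K.

(** The triangular correction g_j = Phi_j - sum_(i < j) Phi_j(t_i) g_i makes the
functionals biorthogonal to the t_j. The coefficients Phi_j(t_i) are summably
small, so the g_j stay bounded by 2 D and still tend to 0 pointwise. By the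
upper c_0 estimate the series v |-> sum_j g_j(v) t_j then converges, and its sum
is a bounded projection onto the closed span of the t_j. *)
Lemma complemented_c0_sequence (Y : set V) (t : nat -> V) (Phi : nat -> dual_space V) (A D : R) :
  norm_complete V -> closed Y -> subspace Y -> (forall j, Y (t j)) ->
  (forall j v, modulus (Phi j v : K) <= D * rnorm v) ->
  (forall v, norm_cvg (fun j => Phi j v) 0) ->
  (forall j, Phi j (t j) = (1 : K)) ->
  (forall i j, (i < j)%N -> Phi i (t j) = 0) ->
  (forall i j, (i < j)%N -> modulus (Phi j (t i) : K) <= 2^-1 ^+ i.+2) ->
  (forall n (a : nat -> K) B, 0 <= B -> (forall j, modulus (a j) <= B) ->
    rnorm (\sum_(j < n) a j *: t j) <= A * B) ->
  exists Z : set V, [/\ infdim_closed_subspace Z, Z `<=` Y & complemented Z].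
Proof.
move=> cV clY sY Yt PhiD Phi0 Phid PhiU PhiL tA.
have [g gE] : exists g : nat -> V -> K,
    forall j, g j = fun v => (Phi j v : K) - \sum_(i < j) (Phi j (t i) : K) * g i v.
  apply: (@strong_recursion _ (fun=> 0)
    (fun j g v => (Phi j v : K) - \sum_(i < j) (Phi j (t i) : K) * g i v)).
  move=> n u v uv; apply/funext => x; congr (_ - _); apply: eq_bigr => i _.
  by rewrite uv.
have gv j v : g j v = (Phi j v : K) - \sum_(i < j) (Phi j (t i) : K) * g i v by rewrite gE.
have lg j : linear_for *%R (g j).
  have [n] := ubnP j; elim: n j => // n ih j; rewrite ltnS => jn a x y.
  rewrite !gv linearP /= mulrBr mulr_sumr addrACA -opprD -big_split /=; congr (_ - _).
  apply: eq_bigr => i _; rewrite ih ?(leq_trans (ltn_ord i)) //.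
  by rewrite mulrDr mulrCA.
have D0 (v : V) : 0 <= D * rnorm v by exact: (le_trans (modulus_ge0 (Phi 0%N v : K)) (PhiD 0%N v)).
have sumh n : \sum_(i < n) (2^-1 : R) ^+ i.+2 <= 2^-1.
  under eq_bigr do rewrite exprS.
  by rewrite -mulr_sumr ler_piMr ?sum_half_powers_le1.
have bg j (v : V) : modulus (g j v) <= 2 * D * rnorm v.
  have [n] := ubnP j; elim: n j => // n ih j; rewrite ltnS => jn.
  rewrite gv; apply: le_trans (ler_modulusD _ _) _; rewrite modulusN.
  have h : modulus (\sum_(i < j) (Phi j (t i) : K) * g i v) <= D * rnorm v.
    apply: le_trans (@ler_rnorm_sum _ _ K^o _ _ _ _) _.
    apply: (@le_trans _ _ (\sum_(i < j) 2^-1 ^+ i.+2 * (2 * D * rnorm v))).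
      apply: ler_sum => i _; rewrite [X in X <= _]modulusM.
      apply: ler_pM; rewrite ?modulus_ge0 //; first exact: PhiL.
      by apply: ih; exact: leq_trans (ltn_ord i) jn.
    rewrite -mulr_suml; apply: (@le_trans _ _ (2^-1 * (2 * D * rnorm v))).
      by rewrite ler_wpM2r ?sumh // -mulrA mulr_ge0.
    by rewrite -mulrA mulKf.
  by apply: le_trans (lerD (PhiD _ _) h) _; rewrite -mulrA; lra.
have gt j i : g j (t i) = (i == j)%:R.
  have [n] := ubnP j; elim: n j i => // n ih j i; rewrite ltnS => jn.
  have sumE : \sum_(l < j) (Phi j (t l) : K) * g l (t i) =
      \sum_(l < j) (if i == l then (Phi j (t l) : K) else 0).
    apply: eq_bigr => l _; rewrite ih ?(leq_trans (ltn_ord l)) //.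
    by case: eqP => _; rewrite ?mulr1 ?mulr0.
  rewrite gv sumE; have [ij|ji|->] := ltngtP i j.
  - rewrite (bigD1 (Ordinal ij)) //= eqxx big1 ?addr0 ?subrr // => l li.
    by case: eqP => // il; move/eqP : li; case; apply: val_inj.
  - rewrite PhiU // big1 ?subr0 // => l _.
    by rewrite gtn_eqF // (ltn_trans (ltn_ord l)).
  - rewrite Phid big1 ?subr0 // => l _.
    by rewrite gtn_eqF.
have gcvg0 (v : V) (e : R) : 0 < e -> exists N, forall j, (N <= j)%N -> modulus (g j v) <= e.
  move=> e0; pose b := 2 * D * rnorm v.
  have b0 : 0 <= b by rewrite /b -mulrA mulr_ge0.
  have e2 : 0 < e / 2 / (b + 1) by rewrite !divr_gt0 // ltr_wpDl.
  have [I hI] := natSinv_small e2.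
  (* Up to a small tail, g_j v is Phi_j w for the fixed vector w. *)
  pose w := v - \sum_(i < I) g i v *: t i.
  have [|N wN] := Phi0 w (e / 2); first by rewrite divr_gt0.
  exists (maxn N I) => j; rewrite geq_max => /andP[Nj Ij].
  have -> : g j v = (Phi j w : K) - \sum_(I <= i < j) (Phi j (t i) : K) * g i v.
    rewrite gv /w operatorB operator_sum.
    have -> : \sum_(i < j) (Phi j (t i) : K) * g i v
        = \sum_(i < I) (Phi j (t i) : K) * g i v + \sum_(I <= i < j) (Phi j (t i) : K) * g i v.
      transitivity (\sum_(0 <= i < j) (Phi j (t i) : K) * g i v); first by rewrite big_mkord.
      by rewrite (big_cat_nat (leq0n I) Ij) big_mkord.
    rewrite opprD addrA; congr (_ - _ - _); apply: eq_bigr => i _.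
    by rewrite operatorZ mulrC.
  apply: le_trans (ler_modulusD _ _) _; rewrite modulusN [e]splitr; apply: lerD.
    by have := wN j Nj; rewrite subr0 => /ltW.
  apply: le_trans (@ler_rnorm_sum _ _ K^o _ _ _ _) _.
  have half_lt n : (2^-1 : R) ^+ n <= n.+1%:R^-1.
    by rewrite exprVn lef_pV2 ?posrE ?exprn_gt0 // -natrX ler_nat ltn_expl.
  apply: (@le_trans _ _ (\sum_(I <= i < j) 2^-1 ^+ i.+1 * b)).
    rewrite big_nat [X in _ <= X]big_nat; apply: ler_sum => i /andP[_ ij].
    rewrite [X in X <= _]modulusM; apply: ler_pM; rewrite ?modulus_ge0 //.
    by apply: le_trans (PhiL _ _ ij) _; rewrite exprS ler_piMl ?exprn_ge0 // invf_le1 // ler1n.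
  rewrite -mulr_suml.
  have -> : \sum_(I <= i < j) (2^-1 : R) ^+ i.+1 = 2^-1 ^+ I - 2^-1 ^+ j.
    have := sum_half_powers (R := R) j; have := sum_half_powers (R := R) I.
    rewrite -(big_mkord predT (fun i => 2^-1 ^+ i.+1)) -(big_mkord predT (fun i => 2^-1 ^+ i.+1)).
    by rewrite [in X in _ -> X -> _](big_cat_nat (leq0n I) Ij) /=; lra.
  apply: (@le_trans _ _ (2^-1 ^+ I * (b + 1))).
    apply: ler_pM; rewrite ?lerDl // ?gerBl ?exprn_ge0 // subr_ge0.
    by rewrite ler_wiXn2l ?invr_ge0 // invf_le1 // ler1n.
  rewrite -ler_pdivlMr ?ltr_wpDl //.
  by apply: le_trans (half_lt I) _; exact/ltW/hI.
pose s v n := \sum_(j < n) g j v *: t j.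
have window v (e : R) N : 0 <= e -> (forall j, (N <= j)%N -> modulus (g j v) <= e) ->
    forall n, (N <= n)%N -> rnorm (s v n - s v N) <= A * e.
  move=> e0 ge n Nn.
  have -> : s v n - s v N = \sum_(j < n) (if (j < N)%N then 0 else g j v) *: t j.
    rewrite /s (sum_pad t (fun j => g j v) Nn) -sumrB; apply: eq_bigr => j _.
    by rewrite -scalerBl; case: ifP => _; rewrite ?subrr ?subr0.
  apply: (tA n (fun j => if (j < N)%N then 0 else g j v)) => // j; case: ltnP => // jN; last exact: ge.
  by rewrite modulus0.
have A0 : 0 <= A.
  have := tA 0%N (fun=> 0) 1 ler01; rewrite big_ord0 rnorm0 mulr1; apply => j.
  by rewrite modulus0 ler01.
have cs v : norm_cauchy (s v).
  move=> e e0; have e2 : 0 < e / 2 / (A + 1) / 2 by rewrite !divr_gt0 // ltr_wpDl.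
  have [N gN] := gcvg0 v _ e2; exists N => m n Nm Nn.
  have h : A * (e / 2 / (A + 1) / 2) < e / 2.
    have A1 : 0 < A + 1 by rewrite ltr_wpDl.
    apply: (@le_lt_trans _ _ ((A + 1) * (e / 2 / (A + 1) / 2))).
      by rewrite ler_wpM2r ?ltW // ltrDl.
    have -> : (A + 1) * (e / 2 / (A + 1) / 2) = e / 4 by field; rewrite gt_eqF.
    by lra.
  have := window v _ N (ltW e2) gN m Nm; have := window v _ N (ltW e2) gN n Nn.
  have := rnorm_triangle (s v m) (s v N) (s v n); rewrite (rnormBC (s v N)).
  by move: h; lra.
have /choice[Q QE] : forall v, exists l, norm_cvg (s v) l by move=> v; exact: cV.
have linQ (a : K) (x y : V) : Q (a *: x + y) = a *: Q x + Q y.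
  apply: norm_cvg_unique (QE _) _.
  suff -> : s (a *: x + y) = (fun n => a *: s x n + s y n) by exact: norm_cvg_lin.
  apply/funext => n; rewrite /s scaler_sumr -big_split /=; apply: eq_bigr => j _.
  by rewrite lg scalerDl scalerA.
have bQ : exists M : R, forall v, rnorm (Q v) <= M * rnorm v.
  exists (A * (2 * D)) => v; apply: norm_cvg_le (QE v) _; exists 0%N => n _.
  rewrite -mulrA; apply: (tA n (fun j => g j v)) => [|j]; last exact: bg.
  by rewrite -mulrA mulr_ge0.
pose G j : dual_space V := @operator_of _ _ V K^o (g j) (lg j) (ex_intro _ (2 * D) (bg j)).
have gsum j n (a : nat -> K) : (j < n)%N -> g j (\sum_(i < n) a i *: t i) = a j.
  have -> : g j (\sum_(i < n) a i *: t i) = \sum_(i < n) a i * (i == j :> nat)%:R.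
    elim: n => [|n ih]; last by rewrite !big_ord_recr /= addrC lg ih gt addrC.
    by rewrite !big_ord0; have := lg j (-1) 0 0; rewrite scaler0 addr0 mulN1r addNr.
  move=> jn; rewrite (bigD1 (Ordinal jn)) //= eqxx mulr1 big1 ?addr0 // => i ij.
  case: eqP => ij'; last by rewrite mulr0.
  by move/eqP : ij; case; apply: val_inj.
have gQ j v : g j (Q v) = g j v.
  have h := norm_cvg_operator (G j) (QE v).
  apply: (@norm_cvg_unique _ _ K^o _ _ _ h) => e e0; exists j.+1 => n jn.
  suff -> : G j (s v n) = g j v by rewrite subrr rnorm0.
  exact: (gsum j n (fun i => g i v) jn).
have QQ v : Q (Q v) = Q v.
  apply: norm_cvg_unique (QE _) _; suff -> : s (Q v) = s v by [].
  by apply/funext => n; apply: eq_bigr => j _; rewrite gQ.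
have Qt i : Q (t i) = t i.
  apply: norm_cvg_unique (QE _) _ => e e0; exists i.+1 => n i_n.
  rewrite /s (bigD1 (Ordinal i_n)) //= big1 ?addr0 => [|j ji].
    by rewrite gt eqxx scale1r subrr rnorm0.
  rewrite gt; case: eqP => ij'; last by rewrite scale0r.
  by move/eqP : ji; case; apply: val_inj.
pose Pi := operator_of (linQ : linear Q) bQ.
exists (range Q); split; last by exists Pi; split.
- apply/infdim_closed_subspaceP; split.
  + exact: (subspace_range Pi).
  + apply/closed_rnorm => x xQ; exists x => //.
    apply/eqP; rewrite -subr_eq0; apply/eqP/rnorm_small_eq0 => e e0.
    have b0 : 0 < opnorm Pi + 1 by rewrite ltr_wpDl // opnorm_ge0.
    have [|_ [v _ <-] xv] := xQ (e / (opnorm Pi + 1)); first by rewrite divr_gt0.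
    have h1 : rnorm (Q x - Q v) <= opnorm Pi * rnorm (x - Q v).
      have -> : Q x - Q v = Pi (x - Q v) by rewrite (operatorB Pi) /= QQ.
      exact: le_opnorm.
    have := rnorm_triangle (Q x) (Q v) x; rewrite (rnormBC (Q v)).
    move: xv; rewrite ltr_pdivlMr // mulrDr mulr1 [_ * opnorm _]mulrC; lra.
  + apply: (independent_infdim (v := t)) => [j|n a ay0 j jn]; first by exists (t j).
    by rewrite -(gsum j n a jn) ay0; exact: (operator0 (G j)).
- move=> _ [v _ <-]; apply: closed_norm_cvg (QE v) => // n.
  by apply: subspace_sum => // j _; exact: subspaceZ.
Qed.

End CZeroProjection.

(** * A dual space with a copy of l_infinity is not subprojective *)

Section AlmostDisjoint.

(** The initial segments of al, coded by integers: a branch of the binary tree. *)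
Definition branch (al : nat -> bool) (j : nat) : bool :=
  `[< exists n, j = choice.pickle (mkseq al n) >].

Lemma branch_infinite al n : exists2 j, (n <= j)%N & branch al j.
Proof.
pose f i := choice.pickle (mkseq al i).
have injf : injective f.
  by move=> i i' /(pcan_inj (@choice.pickleK _))/(congr1 size); rewrite !size_mkseq.
have brf i : branch al (f i) by apply/asboolP; exists i.
apply: contrapT => nbig.
have f_n i : (f i < n)%N.
  by rewrite ltnNge; apply/negP => nfi; apply: nbig; exists (f i).
have : injective (fun i : 'I_n.+1 => Ordinal (f_n i)).
  by move=> i i' /(congr1 val)/= /injf ii'; exact: val_inj.
by move=> /leq_card; rewrite !card_ord ltnn.
Qed.

Lemma branch_almost_disjoint al be : al <> be ->
  exists N, forall j, (N <= j)%N -> branch al j -> branch be j -> False.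
Proof.
move=> albe; have [i abi] : exists i, al i <> be i.
  by apply: contrapT => nab; apply: albe; apply/funext => i; apply: contrapT => h; apply: nab; exists i.
exists (\max_(n < i.+1) choice.pickle (mkseq al n)).+1 => j Nj brA brB.
suff : (j <= \max_(n < i.+1) choice.pickle (mkseq al n))%N by rewrite leqNgt Nj.
have /asboolP[n jA] := brA; have /asboolP[n' jB] := brB.
have sAB : mkseq al n = mkseq be n'.
  by apply: (pcan_inj (@choice.pickleK _)); rewrite -jA -jB.
have nn' : n = n' by have := congr1 size sAB; rewrite !size_mkseq.
have ni : (n < i.+1)%N.
  rewrite ltnS leqNgt; apply/negP => i_n; apply: abi.
  by rewrite -(nth_mkseq false al i_n) sAB nth_mkseq // -nn'.
rewrite jA; exact: (leq_bigmax (F := fun n : 'I_i.+1 => choice.pickle (mkseq al n)) (Ordinal ni)).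
Qed.

Lemma bool_sequences_uncountable : ~ countable [set: nat -> bool].
Proof.
move=> /countable_injP[f finj].
pose d n := ~~ `[< exists al, f al = n /\ al n >].
suff : d (f d) <-> ~ d (f d) by tauto.
split=> [|ndf].
  rewrite {1}/d => /asboolPn nex df; apply: nex; by exists d.
apply/asboolPn => -[al [fal]]; have -> : al = d by apply: finj; rewrite ?inE.
exact: ndf.
Qed.

Context {R : realType} {k : scalar_kind}.
Local Notation K := (scalar_field R k).

Definition bounded_sequence (c : nat -> K) : Prop := exists B : R, forall j, modulus (c j) <= B.

Definition indicator (A : nat -> bool) (j : nat) : K := (A j)%:R.

Lemma modulus_indicator A j : modulus (indicator A j) <= 1.
Proof. by rewrite /indicator; case: (A j); rewrite ?modulus1 // modulus0. Qed.

Lemma exists_phase (z : K) : exists2 th : K, modulus th <= 1 & th * z = of_real k (modulus z).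
Proof.
have [->|z0] := eqVneq z 0; first by exists 0; rewrite ?modulus0 ?mul0r ?of_real0.
exists (of_real k (modulus z) / z); last by rewrite divfK.
rewrite modulusM modulusV modulus_of_real ger0_norm ?modulus_ge0 //.
by rewrite divff // gt_eqF // modulus_gt0.
Qed.

(** Two branches meet in a finite set, so a functional which kills finitely
supported sequences sees their indicators as disjoint. Being bounded, it exceeds
a given positive number on finitely many of them only. Hence each psi l is
nonzero on countably many branches, and uncountably many branches exist. *)
Lemma almost_disjoint_annihilation (psi : nat -> (nat -> K) -> K) (D : nat -> R) :
  (forall l (a : K) c c', bounded_sequence c -> bounded_sequence c' ->
     psi l (fun j => a * c j + c' j) = a * psi l c + psi l c') ->
  (forall l n c, (forall j, (n <= j)%N -> c j = 0) -> psi l c = 0) ->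
  (forall l c, (forall j, modulus (c j) <= 1) -> modulus (psi l c) <= D l) ->
  exists A : nat -> bool, (forall n, exists2 j, (n <= j)%N & A j) /\
    forall l, psi l (indicator A) = 0.
Proof.
move=> psilin psifin psibd.
have fin l m : finite_set [set al | m.+1%:R^-1 < modulus (psi l (indicator (branch al)))].
  apply: contrapT => /infiniteP/pcard_leP/unsquash al.
  have alinj : injective al by move=> i j; apply: inj; rewrite inE.
  have alS i : m.+1%:R^-1 < modulus (psi l (indicator (branch (al i)))).
    by have := @funS _ _ _ _ al i I.
  have /choice[th thP] : forall i, exists th : K, modulus th <= 1 /\
      th * psi l (indicator (branch (al i))) = of_real k (modulus (psi l (indicator (branch (al i))))).
    by move=> i; have [th] := exists_phase (psi l (indicator (branch (al i)))); exists th.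
  pose w n j := \sum_(i < n) th i * indicator (branch (al i)) j.
  have bind al' : bounded_sequence (indicator (branch al')).
    by exists 1 => j; exact: modulus_indicator.
  have bw n : bounded_sequence (w n).
    exists n%:R => j; apply: le_trans (@ler_rnorm_sum _ _ K^o _ _ _ _) _.
    rewrite -[X in _ <= X%:R]card_ord -sumr_const; apply: ler_sum => i _.
    rewrite [X in X <= _]modulusM mulr_ile1 ?modulus_ge0 //; first exact: (thP i).1.
    exact: modulus_indicator.
  have psiw n : psi l (w n) = of_real k (\sum_(i < n) modulus (psi l (indicator (branch (al i))))).
    elim: n => [|n ih].
      rewrite big_ord0 of_real0; apply: (@psifin _ 0%N) => j _.
      by rewrite /w big_ord0.
    rewrite big_ord_recr /= of_realD -ih -(thP n).2 addrC -psilin //; congr (psi l _).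
    by apply/funext => j; rewrite /w big_ord_recr /= addrC.
  have /choice[Nf NfP] : forall ij : nat * nat, exists N, ij.1 <> ij.2 ->
      forall j, (N <= j)%N -> branch (al ij.1) j -> branch (al ij.2) j -> False.
    move=> [i i'] /=; have [->|ii'] := eqVneq i i'; first by exists 0%N.
    have [|N NP] := @branch_almost_disjoint (al i) (al i').
      by move=> /alinj/eqP; rewrite (negbTE ii').
    by exists N => _; exact: NP.
  have small n : n%:R * m.+1%:R^-1 <= D l.
    pose N := \max_(i < n) \max_(i' < n) Nf (i : nat, i' : nat).
    have NfN (i i' : 'I_n) : (Nf (i : nat, i' : nat) <= N)%N.
      apply: leq_trans (leq_bigmax (F := fun i : 'I_n => \max_(i' < n) Nf (i : nat, i' : nat)) i).
      exact: (leq_bigmax (F := fun i' : 'I_n => Nf (i : nat, i' : nat)) i').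
    (* Beyond N the first n branches are disjoint, so that the tail of w n is
       bounded by 1. *)
    pose hd j := if (j < N)%N then - w n j else 0.
    pose tl j := if (j < N)%N then 0 else w n j.
    have tlE : tl = (fun j => 1 * w n j + hd j).
      by apply/funext => j; rewrite /tl /hd mul1r; case: ifP; rewrite ?subrr ?addr0.
    have bhd : bounded_sequence hd.
      have [B wB] := bw n; exists B => j; rewrite /hd; case: ifP => _; rewrite ?modulusN //.
      by rewrite modulus0; apply: le_trans (wB j); exact: modulus_ge0.
    have -> : n%:R * m.+1%:R^-1 = \sum_(i < n) m.+1%:R^-1 :> R.
      by rewrite sumr_const card_ord mulr_natl.
    apply: (@le_trans _ _ (modulus (psi l tl))); last first.
      apply: psibd => j; rewrite /tl; case: ltnP => jN; first by rewrite modulus0.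
      have [[i /= ij]|none] := pselect (exists i : 'I_n, branch (al i) j).
        rewrite /w (bigD1 i) //= big1 ?addr0 => [|i' i'i].
          rewrite modulusM mulr_ile1 ?modulus_ge0 ?modulus_indicator //; exact: (thP i).1.
        rewrite /indicator; case: (boolP (branch (al i') j)) => [i'j|_]; last by rewrite mulr0.
        exfalso; apply: (NfP (i' : nat, i : nat) _ j) => //=.
          by move=> /val_inj/eqP; rewrite (negbTE i'i).
        exact: leq_trans (NfN _ _) jN.
      rewrite /w big1 ?modulus0 // => i _; rewrite /indicator.
      by case: (boolP (branch (al i) j)) => [ij|_]; rewrite ?mulr0 //; exfalso; apply: none; exists i.
    rewrite tlE psilin // (psifin _ N hd) ?addr0 ?mul1r; last first.
      by move=> j jN; rewrite /hd ltnNge jN.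
    rewrite psiw modulus_of_real ger0_norm; last by apply: sumr_ge0 => i _; exact: modulus_ge0.
    by apply: ler_sum => i _; exact/ltW/alS.
  have [n nD] : exists n : nat, D l * m.+1%:R < n%:R.
    by exists (Num.truncn (D l * m.+1%:R)).+1; rewrite truncnS_gt.
  have := small n; rewrite -ler_pdivlMr ?invr_gt0 // invrK leNgt.
  by rewrite nD.
have [al alP] : exists al, forall l, psi l (indicator (branch al)) = 0.
  apply: contrapT => nal; apply: bool_sequences_uncountable.
  have sub : [set: nat -> bool] `<=`
      \bigcup_(lm in [set: nat * nat]) [set al | lm.2.+1%:R^-1 < modulus (psi lm.1 (indicator (branch al)))].
    move=> al _; apply: contrapT => nin; apply: nal; exists al => l.
    apply: modulus0_eq0; apply: contrapT => /eqP p0.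
    have : 0 < modulus (psi l (indicator (branch al))) by rewrite lt_neqAle eq_sym p0 modulus_ge0.
    move=> /natSinv_small[m mP]; apply: nin; exists (l, m) => //=.
    exact: mP (leqnn m).
  apply: sub_countable (subset_card_le sub) _.
  by apply: bigcup_countable => // -[l m] _; apply: finite_set_countable; exact: fin.
by exists (branch al); split => // n; have [j nj brj] := branch_infinite al n; exists j.
Qed.

End AlmostDisjoint.

Section CZeroMax.
Context {R : realType}.

Lemma null_sequence_max (b : nat -> R) (i1 : nat) :
  (forall e, 0 < e -> exists N, forall n, (N <= n)%N -> b n < e) -> 0 < b i1 ->
  exists2 i0, 0 < b i0 & forall i, b i <= b i0.
Proof.
move=> b0 bi1; have [N Nb] := b0 _ bi1.
have i1N : (i1 < N)%N by rewrite ltnNge; apply/negP => /Nb; rewrite ltxx.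
have [i0 _ i0max] := @arg_maxP _ _ _ (Ordinal i1N) predT (fun i : 'I_N => b i) isT.
have i10 := i0max (Ordinal i1N) isT; exists (i0 : nat); first exact: lt_le_trans i10.
move=> i; have [Ni|iN] := leqP N i; last exact: (i0max (Ordinal iN)).
exact: le_trans (ltW (Nb _ Ni)) i10.
Qed.

Lemma bounded_series_tail (b : nat -> R) (L : R) : (forall j, 0 <= b j) ->
  (forall n, \sum_(j < n) b j <= L) ->
  forall e, 0 < e -> exists N, forall n, (N <= n)%N -> \sum_(N <= j < n) b j < e.
Proof.
move=> b0 bL e e0.
pose S := [set s | exists n, s = \sum_(j < n) b j].
have [|_ [N ->] NS] := @sup_adherent _ S e e0.
  by split; [exists (\sum_(j < 0) b j), 0%N|exists L => _ [n ->]].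
exists N => n Nn.
have : \sum_(j < n) b j <= sup S.
  by apply: ub_le_sup; [exists L => _ [m ->]|exists n].
have -> : \sum_(j < n) b j = \sum_(j < N) b j + \sum_(N <= j < n) b j.
  transitivity (\sum_(0 <= j < n) b j); first by rewrite big_mkord.
  by rewrite (big_cat_nat (leq0n N) Nn) big_mkord.
lra.
Qed.

End CZeroMax.

Lemma neq_Ordinal n i (i_n : (i < n)%N) (j : 'I_n) :
  j != Ordinal i_n -> ((j : nat) == i) = false.
Proof. by rewrite -val_eqE /= => /negbTE. Qed.

Lemma sum_ord_split (V : nmodType) (F : nat -> V) (N n : nat) : (N <= n)%N ->
  \sum_(j < n) F j = \sum_(j < N) F j + \sum_(N <= j < n) F j.
Proof.
move=> Nn; transitivity (\sum_(0 <= j < n) F j); first by rewrite big_mkord.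
by rewrite (big_cat_nat (leq0n N) Nn) big_mkord.
Qed.

Section LInfty.
Context {R : realType} {k : scalar_kind}.
Local Notation K := (scalar_field R k).
Variables (X : normedModType K) (phi : nat -> dual_space X) (u : nat -> X) (L B : R).
Hypothesis phiu : forall i j, phi i (u j) = (i == j)%:R.
Hypothesis phiL : forall n x, \sum_(j < n) modulus (phi j x : K) <= L * rnorm x.
Hypothesis uB : forall j, rnorm (u j) <= B.

Let L_ge0 (x : X) : 0 <= L * rnorm x.
Proof. by apply: le_trans (phiL 0 x); rewrite big_ord0. Qed.

Lemma dual_sumE n (a : nat -> K) (f : nat -> dual_space X) x :
  (\sum_(j < n) a j *: f j) x = \sum_(j < n) a j * (f j x : K).
Proof.
elim: n => [|n ih]; first by rewrite !big_ord0.
by rewrite !big_ord_recr /= -ih.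
Qed.

(** The image f of the bounded sequence a in a copy of l_infinity inside the dual:
the series sum_j a_j phi_j converges to f pointwise, not in norm. *)
Definition weak_sum (a : nat -> K) (f : dual_space X) : Prop :=
  forall x, norm_cvg (fun n => \sum_(j < n) a j *: (phi j x : K^o)) (f x).

Lemma weak_sum_coord a f i : weak_sum a f -> f (u i) = a i.
Proof.
move=> af; apply: norm_cvg_unique (af (u i)) _ => e e0; exists i.+1 => n i_n.
rewrite (bigD1 (Ordinal i_n)) //= phiu eqxx big1 ?addr0 => [|j ji].
  have -> : a i *: (1%:R : K^o) = a i by exact: mulr1.
  by rewrite subrr rnorm0.
by rewrite phiu (neq_Ordinal ji) scaler0.
Qed.

Lemma weak_sum_unique a f g : weak_sum a f -> weak_sum a g -> f = g.
Proof. by move=> af ag; apply: bounded_op_ext => x; apply: norm_cvg_unique (af x) (ag x). Qed.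

Lemma weak_sum_lin (c : K) a b f g : weak_sum a f -> weak_sum b g ->
  weak_sum (fun j => c * a j + b j) (c *: f + g).
Proof.
move=> af bg x.
suff -> : (fun n => \sum_(j < n) (c * a j + b j) *: (phi j x : K^o)) =
  (fun n => c *: \sum_(j < n) a j *: (phi j x : K^o) + \sum_(j < n) b j *: (phi j x : K^o)).
  exact: norm_cvg_lin.
apply/funext => n; rewrite scaler_sumr -big_split /=; apply: eq_bigr => j _.
by rewrite scalerDl scalerA.
Qed.

Lemma weak_sum_bound a f A : 0 <= A -> (forall j, modulus (a j) <= A) -> weak_sum a f ->
  forall x, modulus (f x : K) <= A * L * rnorm x.
Proof.
move=> A0 aA af x; apply: norm_cvg_le (af x) _; exists 0%N => n _.
apply: le_trans (ler_rnorm_sum _ _ _) _.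
rewrite -mulrA; apply: le_trans (ler_wpM2l A0 (phiL n x)).
rewrite mulr_sumr; apply: ler_sum => j _.
by rewrite rnormZm ler_wpM2r ?rnorm_ge0.
Qed.

Lemma weak_sum_exists a : bounded_sequence a -> exists f, weak_sum a f.
Proof.
move=> [A0 aA0]; pose A := Num.max 0 A0.
have A_ge0 : 0 <= A by rewrite le_max lexx.
have aA j : modulus (a j) <= A by apply: le_trans (aA0 j) _; rewrite le_max lexx orbT.
have term x j : rnorm (a j *: (phi j x : K^o)) <= A * modulus (phi j x : K).
  by rewrite rnormZm ler_wpM2r ?rnorm_ge0.
have ca x : norm_cauchy (fun n => \sum_(j < n) a j *: (phi j x : K^o)).
  move=> e e0.
  have tb j : 0 <= A * modulus (phi j x : K) by rewrite mulr_ge0 // modulus_ge0.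
  have ts n : \sum_(j < n) A * modulus (phi j x : K) <= A * (L * rnorm x).
    by rewrite -mulr_sumr ler_wpM2l.
  have e2 : 0 < e / 2 by rewrite divr_gt0.
  have [N eN] := bounded_series_tail tb ts e2.
  exists N => m n Nm Nn.
  have close l : (N <= l)%N ->
      rnorm (\sum_(j < l) a j *: (phi j x : K^o) - \sum_(j < N) a j *: (phi j x : K^o)) < e / 2.
    move=> Nl.
    have -> : \sum_(j < l) a j *: (phi j x : K^o) - \sum_(j < N) a j *: (phi j x : K^o) =
        \sum_(N <= j < l) a j *: (phi j x : K^o).
      by rewrite (sum_ord_split (fun j => a j *: (phi j x : K^o)) Nl) addrC addKr.
    apply: le_lt_trans (eN _ Nl); apply: le_trans (ler_rnorm_sum _ _ _) _.
    by apply: ler_sum => j _; exact: term.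
  have := close _ Nm; have := close _ Nn.
  set s := \sum_(j < N) _; set sm := \sum_(j < m) _; set sn := \sum_(j < n) _.
  by have := rnorm_triangle sm s sn; rewrite (rnormBC s); lra.
have /choice[f fP] : forall x, exists l : K^o, norm_cvg (fun n => \sum_(j < n) a j *: (phi j x : K^o)) l.
  by move=> x; exact: scalars_complete (ca x).
have lf (c : K) (x y : X) : f (c *: x + y) = c *: f x + f y.
  apply: norm_cvg_unique (fP _) _.
  suff -> : (fun n => \sum_(j < n) a j *: (phi j (c *: x + y) : K^o)) =
     (fun n => c *: \sum_(j < n) a j *: (phi j x : K^o) + \sum_(j < n) a j *: (phi j y : K^o)).
    exact: norm_cvg_lin.
  apply/funext => n; rewrite scaler_sumr -big_split /=; apply: eq_bigr => j _.
  by rewrite operatorD operatorZ scalerDr !scalerA mulrC.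
have bf : exists M : R, forall x, rnorm (f x) <= M * rnorm x.
  exists (A * L) => x; apply: norm_cvg_le (fP x) _; exists 0%N => n _.
  apply: le_trans (ler_rnorm_sum _ _ _) _.
  rewrite -mulrA; apply: le_trans (ler_wpM2l A_ge0 (phiL n x)).
  by rewrite mulr_sumr; apply: ler_sum => j _; exact: term.
by exists (@operator_of _ _ X K^o f lf bf) => x; exact: fP.
Qed.

(** The image of c_0 under a |-> sum_j a_j phi_j. *)
Let Y : set (dual_space X) :=
  [set f : dual_space X | weak_sum (fun j => f (u j)) f /\ norm_cvg (fun j => f (u j)) 0].

Let B_ge0 : 0 <= B.
Proof. exact: le_trans (rnorm_ge0 _) (uB 0). Qed.

Let Y_subspace : subspace Y.
Proof.
split.
  split=> [x|]; last exact: norm_cvg_cst.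
  move=> e e0; exists 0%N => n _; rewrite big1 => [|j _]; last by rewrite scale0r.
  by rewrite subrr rnorm0.
move=> c f g [fs f0] [gs g0]; split; first exact: weak_sum_lin.
by have := norm_cvg_lin c f0 g0; rewrite scaler0 addr0.
Qed.

Let eval_close (f g : dual_space X) (x : X) : rnorm (f x - g x) <= rnorm (f - g) * rnorm x.
Proof. by rewrite rnorm_opnorm; exact: (le_opnorm (f - g) x). Qed.

Let Y_closed : closed Y.
Proof.
apply/closed_rnorm => f fY; split; last first.
  move=> e e0; have b0 : 0 < B + 1 by rewrite ltr_wpDl.
  have [|g [_ g0] fg] := fY (e / 2 / (B + 1)); first by rewrite !divr_gt0.
  have [|N gN] := g0 (e / 2); first by rewrite divr_gt0.
  exists N => n /gN; rewrite !subr0 => gn.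
  have h : rnorm (f (u n) - g (u n)) <= e / 2.
    apply: le_trans (eval_close _ _ _) _; apply: (@le_trans _ _ (e / 2 / (B + 1) * (B + 1))).
      apply: ler_pM; rewrite ?rnorm_ge0 //; first exact: ltW.
      by apply: le_trans (uB n) _; rewrite lerDl.
    by rewrite divfK // gt_eqF.
  by have := rnormD_le h (ltW gn); have := ler_rnormD (f (u n) - g (u n)) (g (u n)); rewrite subrK; lra.
move=> x e e0.
pose c := rnorm x + B * (L * rnorm x) + 1.
have c0 : 0 < c by rewrite ltr_wpDl // addr_ge0 ?rnorm_ge0 // mulr_ge0.
have [|g [gs _] fg] := fY (e / 2 / c); first by rewrite !divr_gt0.
have [|N gN] := gs x (e / 2); first by rewrite divr_gt0.
exists N => n /gN gn.
pose F := \sum_(j < n) (f (u j) : K) *: (phi j x : K^o).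
pose G := \sum_(j < n) (g (u j) : K) *: (phi j x : K^o).
have FG : rnorm (F - G) <= rnorm (f - g) * (B * (L * rnorm x)).
  rewrite /F /G -sumrB; apply: le_trans (ler_rnorm_sum _ _ _) _.
  apply: (@le_trans _ _ (\sum_(j < n) rnorm (f - g) * B * modulus (phi j x : K))).
    apply: ler_sum => j _; rewrite -scalerBl rnormZm ler_wpM2r ?rnorm_ge0 //.
    by apply: le_trans (eval_close _ _ _) _; rewrite ler_wpM2l ?rnorm_ge0.
  by rewrite -mulr_sumr -mulrA ler_wpM2l ?rnorm_ge0 // ler_wpM2l.
have fgx : rnorm (g x - f x) <= rnorm (f - g) * rnorm x by rewrite rnormBC.
have fgc : rnorm (f - g) * c < e / 2 by rewrite -ltr_pdivlMr.
have := rnorm_triangle F G (f x); have := rnorm_triangle G (g x) (f x).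
have := rnorm_ge0 (f - g).
move: fgc gn FG fgx; rewrite -/F -/G /c !mulrDr mulr1; lra.
Qed.

Let phi_Y j : Y (phi j).
Proof.
split=> [x e e0|e e0]; exists j.+1 => n jn.
  rewrite (bigD1 (Ordinal jn)) //= phiu eqxx scale1r big1 ?addr0 ?subrr ?rnorm0 // => i ij.
  by rewrite phiu eq_sym (neq_Ordinal ij) scale0r.
by rewrite phiu ltn_eqF // subr0 rnorm0.
Qed.

Let Y_infdim : ~ finite_dim Y.
Proof.
apply: (independent_infdim (v := phi)) => // n a ay0 j jn.
have := congr1 (fun f : dual_space X => f (u j)) ay0.
rewrite /= dual_sumE (bigD1 (Ordinal jn)) //= big1 ?addr0 => [|i ij].
  by rewrite phiu eqxx mulr1.
by rewrite phiu (neq_Ordinal ij) mulr0.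
Qed.

(** Suppose that Pi projects the dual onto a subspace Z of the copy Y of c_0, and
take a gliding hump sequence z_j in Z. The operator 1 - Pi kills finite sums of
the z_j, so by almost disjointness its coordinates all vanish at the weak sum of
the z_j over some infinite set A. The coordinates of that sum then agree with
those of an element of Z, and tend to 0; but the peaks of the z_j prevent it. *)
Lemma linfty_dual_not_subprojective : ~ subprojective (dual_space X).
Proof.
move=> spX.
have [Z [/infdim_closed_subspaceP[sZ clZ nfZ] ZY [Pi [PiPi PiZ]]]] :=
  spX _ ((infdim_closed_subspaceP _).2 (And3 Y_subspace Y_closed Y_infdim)).
have fixZ z : Z z -> Pi z = z by rewrite -PiZ => -[w _ <-]; rewrite PiPi.
have [j m|m [z zP]] := @gliding_choice (dual_space X) (fun j m m' z =>
   [/\ Z z, forall i, (i < m)%N -> z (u i) = 0, forall i, modulus (z (u i) : K) <= 1,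
     forall i, (m' <= i)%N -> modulus (z (u i) : K) <= 2^-1 ^+ j.+2 &
     exists i, [/\ (m <= i)%N, (i < m')%N & modulus (z (u i) : K) = 1]]).
  have leval i : linear_for *%R (fun f : dual_space X => f (u i) : K) by [].
  have [sF nfF] := infdim_ker m sZ nfZ leval.
  have [z [Zz zm] z1] := infdim_unit_vector sF nfF.
  have [zs z0] := ZY _ Zz.
  have zm0 i : (i < m)%N -> modulus (z (u i) : K) = 0 by move=> /zm ->; exact: modulus0.
  have [i1 zi1] : exists i, 0 < modulus (z (u i) : K).
    apply: contrapT => nz.
    suff z00 : z = 0 by move: z1; rewrite z00 rnorm0 => /esym/eqP; rewrite oner_eq0.
    apply: weak_sum_unique zs _ => x e e0; exists 0%N => n _.
    rewrite big1 ?subrr ?rnorm0 // => j' _.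
    have -> : z (u j') = 0; last by rewrite scale0r.
    apply: modulus0_eq0; apply: contrapT => /eqP h; apply: nz; exists j'.
    by rewrite lt_neqAle eq_sym h modulus_ge0.
  have b0 e : 0 < e -> exists N, forall n, (N <= n)%N -> modulus (z (u n) : K) < e.
    by move=> e0; have [N zN] := z0 _ e0; exists N => n /zN; rewrite subr0.
  have [i0 bi0 i0max] := null_sequence_max b0 zi1.
  pose c := of_real k (modulus (z (u i0) : K))^-1.
  have mc : modulus c = (modulus (z (u i0) : K))^-1.
    by rewrite modulus_of_real ger0_norm // invr_ge0 ltW.
  have cz i : modulus ((c *: z) (u i) : K) = (modulus (z (u i0) : K))^-1 * modulus (z (u i) : K).
    by rewrite -mc -modulusM.
  have [|N zN] := z0 (modulus (z (u i0) : K) * 2^-1 ^+ j.+2).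
    by rewrite mulr_gt0 // exprn_gt0.
  exists (maxn (maxn m.+1 i0.+1) N), (c *: z).
  split; first by rewrite !leq_max leqnn.
  split.
  - exact: subspaceZ.
  - by move=> i i_m; apply: modulus0_eq0; rewrite cz (zm0 i) // mulr0.
  - by move=> i; rewrite cz mulrC ler_pdivrMr // mul1r.
  - move=> i; rewrite geq_max => /andP[_ /zN]; rewrite subr0 => /ltW h.
    by rewrite cz mulrC ler_pdivrMr // mulrC.
  - exists i0; rewrite cz mulVf ?gt_eqF //; split => //; last by rewrite !leq_max leqnn orbT.
    rewrite leqNgt; apply/negP => i0m; by move: bi0; rewrite zm0 // ltxx.
have minc j : (m j < m j.+1)%N by case: (zP j).
have mmono : {homo m : i j / (i <= j)%N}.
  by apply: homo_leq => // [x y x'|i]; [exact: leq_trans|exact: ltnW].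
have m_ge j : (j <= m j)%N by elim: j => // j /leq_ltn_trans; apply.
have [Zz z0 z1 zsmall zpeak] : [/\ forall j, Z (z j),
    forall j i, (i < m j)%N -> z j (u i) = 0, forall j i, modulus (z j (u i) : K) <= 1,
    forall j i, (m j.+1 <= i)%N -> modulus (z j (u i) : K) <= 2^-1 ^+ j.+2 &
    forall j, exists i, [/\ (m j <= i)%N, (i < m j.+1)%N & modulus (z j (u i) : K) = 1]].
  by split=> j; case: (zP j) => _ [].
(* Before its peak, z_n only meets the small tails of its predecessors, so that
   at least half of the peak survives in any sum. *)
have early n i : (m n <= i)%N -> \sum_(j < n) modulus (z j (u i) : K) <= 2^-1.
  move=> mn; apply: (@le_trans _ _ (\sum_(j < n) 2^-1 ^+ j.+2)).
    by apply: ler_sum => j _; apply: zsmall; apply: leq_trans mn; exact: mmono.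
  under eq_bigr do rewrite exprS.
  by rewrite -mulr_sumr ler_piMr ?sum_half_powers_le1.
have all2 n i : \sum_(j < n) modulus (z j (u i) : K) <= 2.
  elim: n => [|n ih]; first by rewrite big_ord0.
  rewrite big_ord_recr /=; have [mi|im] := leqP (m n) i.
    by have := early _ _ mi; have := z1 n i; lra.
  by rewrite z0 // modulus0 addr0.
pose a (c : nat -> K) i : K := \sum_(j < i.+1) c j * z j (u i).
have aE c n i : (i < n)%N -> a c i = \sum_(j < n) c j * z j (u i).
  move=> i_n; rewrite (sum_ord_split (fun j => c j * z j (u i)) i_n).
  rewrite [X in _ = _ + X]big_nat [X in _ = _ + X]big1 ?addr0 // => j /andP[ij _].
  by rewrite z0 ?mulr0 //; exact: leq_trans (m_ge j).
have a_bound c C i : 0 <= C -> (forall j, modulus (c j) <= C) -> modulus (a c i) <= C * 2.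
  move=> C0 cC; apply: le_trans (@ler_rnorm_sum _ _ K^o _ _ _ _) _.
  apply: le_trans (ler_wpM2l C0 (all2 i.+1 i)); rewrite mulr_sumr.
  by apply: ler_sum => j _; rewrite [X in X <= _]modulusM ler_wpM2r ?modulus_ge0.
have /choice[E EP] : forall c, exists f, bounded_sequence c -> weak_sum (a c) f.
  move=> c; have [[C cC]|nb] := pselect (bounded_sequence c); last by exists 0.
  have [|f fP] := @weak_sum_exists (a c); last by exists f.
  exists (C * 2) => i; apply: a_bound => //.
  exact: le_trans (modulus_ge0 _) (cC 0%N).
pose psi l c : K := E c (u l) - Pi (E c) (u l).
have [|||A [Ainf Apsi]] := @almost_disjoint_annihilation R k psi (fun=> (1 + opnorm Pi) * (2 * `|L|) * B).
- move=> l t c c' bc bc'.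
  have bcc : bounded_sequence (fun j => t * c j + c' j).
    case: bc => C cC; case: bc' => C' cC'; exists (modulus t * C + C') => j.
    apply: le_trans (ler_modulusD _ _) _; apply: lerD => //.
    by rewrite modulusM ler_wpM2l ?modulus_ge0.
  have Elin : E (fun j => t * c j + c' j) = t *: E c + E c'.
    apply: weak_sum_unique (EP _ bcc) _.
    suff -> : a (fun j => t * c j + c' j) = (fun i => t * a c i + a c' i).
      by apply: weak_sum_lin; exact: EP.
    apply/funext => i; rewrite /a mulr_sumr -big_split /=; apply: eq_bigr => j _.
    by rewrite mulrDl mulrA.
  transitivity ((t * (E c (u l) : K) + E c' (u l)) - (t * (Pi (E c) (u l) : K) + Pi (E c') (u l))).
    by rewrite /psi Elin linearP.
  by rewrite /psi mulrBr opprD addrACA.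
- move=> l n c c0; rewrite /psi.
  have bc : bounded_sequence c.
    exists (\sum_(j < n) modulus (c j)) => j; have [nj|jn] := leqP n j.
      by rewrite c0 // modulus0 sumr_ge0 // => i _; exact: modulus_ge0.
    rewrite (bigD1 (Ordinal jn)) //= lerDl sumr_ge0 // => i _; exact: modulus_ge0.
  suff Ecz : E c = \sum_(j < n) c j *: z j.
    rewrite fixZ ?subrr // Ecz; apply: subspace_sum => // j _.
    exact: subspaceZ.
  have [_ sc] : Y (\sum_(j < n) c j *: z j).
    by apply: subspace_sum Y_subspace _ => j _; apply: subspaceZ Y_subspace _; exact: ZY.
  have [ws _] : Y (\sum_(j < n) c j *: z j).
    by apply: subspace_sum Y_subspace _ => j _; apply: subspaceZ Y_subspace _; exact: ZY.
  apply: weak_sum_unique (EP _ bc) _; suff <- : (fun i => (\sum_(j < n) c j *: z j) (u i) : K) = a c by [].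
  apply/funext => i; rewrite dual_sumE.
  rewrite (@aE c (maxn n i.+1)); last exact: leq_maxr.
  rewrite [RHS](bigID (fun j : 'I_(maxn n i.+1) => (j < n)%N)) /= [X in _ = _ + X]big1 ?addr0; last first.
    by move=> j; rewrite -leqNgt => nj; rewrite c0 // mul0r.
  by rewrite (big_ord_widen (maxn n i.+1) (fun j => c j * (z j (u i) : K))) ?leq_maxl.
- move=> l c c1.
  have bc : bounded_sequence c by exists 1.
  have Ec : opnorm (E c) <= 2 * `|L|.
    apply: opnorm_le => [|x]; first by rewrite mulr_ge0.
    apply: le_trans (@weak_sum_bound _ _ 2 _ _ (EP _ bc) x) _ => //.
      by move=> i; have := @a_bound c 1 i ler01 c1; rewrite mul1r.
    by rewrite ler_wpM2r ?rnorm_ge0 // ler_wpM2l // ler_norm.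
  rewrite /psi; apply: le_trans (@rnormB_le _ _ K^o _ _ _ _ (lexx _) (lexx _)) _.
  rewrite mulrDl mul1r mulrDl; apply: lerD.
    exact: (@rnorm_operator_le _ _ _ _ (E c)).
  apply: (@rnorm_operator_le _ _ _ _ (Pi (E c))) => //.
  by rewrite -rnorm_opnorm; apply: rnorm_operator_le => //; rewrite rnorm_opnorm.
have bA : bounded_sequence (indicator A : nat -> K) by exists 1 => j; exact: modulus_indicator.
have [_ A0] : Y (Pi (E (indicator A))) by apply: ZY; rewrite -PiZ; exists (E (indicator A)).
have [|N AN] := A0 (2^-1); first by rewrite invr_gt0.
have [j Nj Aj] := Ainf N; have [i [mi im zi]] := zpeak j.
have Ni : (N <= i)%N by apply: leq_trans Nj _; apply: leq_trans (m_ge j) mi.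
have := AN _ Ni; rewrite subr0.
have -> : Pi (E (indicator A)) (u i) = a (indicator A) i.
  have := Apsi i; rewrite /psi => /eqP; rewrite subr_eq0 => /eqP <-.
  exact: weak_sum_coord (EP _ bA).
have ji : (j <= i)%N := leq_trans (m_ge j) mi.
have -> : a (indicator A) i = \sum_(l < j) indicator A l * z l (u i) + z j (u i).
  have tail0 l : (j < l)%N -> z l (u i) = 0.
    by move=> jl; apply: z0; apply: leq_trans im _; exact: mmono.
  rewrite /a (sum_ord_split (fun j => indicator A j * z j (u i)) (leqW ji)).
  rewrite (big_ltn (ji : (j < i.+1)%N)).
  rewrite {2}/indicator Aj mul1r [X in _ + (_ + X)]big_nat [X in _ + (_ + X)]big1 ?addr0 // => l /andP[jl _].
  by rewrite tail0 ?mulr0.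
have h : modulus (\sum_(l < j) indicator A l * z l (u i)) <= 2^-1.
  apply: le_trans (early j i mi); apply: le_trans (@ler_rnorm_sum _ _ K^o _ _ _ _) _.
  apply: ler_sum => l _; rewrite [X in X <= _]modulusM ler_piMl ?modulus_ge0 //.
  exact: modulus_indicator.
set s := \sum_(l < j) _ in h *.
have := ler_modulusD (s + z j (u i)) (- s); rewrite addrAC subrr add0r zi modulusN.
rewrite -[rnorm _]/(modulus (s + z j (u i) : K)); lra.
Qed.

End LInfty.

(** * Finite-dimensional decompositions *)

Section FDD.
Context {R : realType} {k : scalar_kind}.
Local Notation K := (scalar_field R k).

Definition finite_rank_form (V W : normedModType K) (S : V -> W) : Prop :=
  exists n (v : nat -> W) (f : nat -> dual_space V),
    forall x, S x = \sum_(i < n) (f i x : K) *: v i.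

Lemma finite_rank_formD (V W : normedModType K) (S T : V -> W) :
  finite_rank_form S -> finite_rank_form T -> finite_rank_form (fun x => S x + T x).
Proof.
move=> [n [v [f SE]]] [m [w [g TE]]].
exists (n + m)%N, (fun i => if (i < n)%N then v i else w (i - n)%N),
  (fun i => if (i < n)%N then f i else g (i - n)%N) => x.
rewrite big_split_ord /= SE TE; congr (_ + _); apply: eq_bigr => i _.
  by rewrite ltn_ord.
by rewrite ltnNge leq_addr /= addKn.
Qed.

Section PartialSums.
Variables (X : normedModType K) (P : nat -> bounded_op X X).
Hypothesis fddP : unconditional_FDD P.

Definition partial_sum (n : nat) : bounded_op X X := \sum_(i < n) P i.

Lemma partial_sumE n x : partial_sum n x = \sum_(i < n) P i x.
Proof. exact: sum_operatorE. Qed.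

Lemma component_partial_sum i n x :
  P i (partial_sum n x) = if (i < n)%N then P i x else 0.
Proof.
have [PP PQ _ _] := fddP.
rewrite partial_sumE operator_sum; case: ltnP => [i_n|ni].
  rewrite (bigD1 (Ordinal i_n)) //= (PP i).1 big1 ?addr0 // => j ji.
  by rewrite PQ // eq_sym (neq_Ordinal ji).
by rewrite big1 // => j _; rewrite PQ // gtn_eqF // (leq_trans (ltn_ord j)).
Qed.

Lemma partial_sum_comp_le m n x : (m <= n)%N ->
  partial_sum m (partial_sum n x) = partial_sum m x.
Proof.
move=> mn; rewrite !(partial_sumE m); apply: eq_bigr => i _.
by rewrite component_partial_sum (leq_trans (ltn_ord i)).
Qed.

Lemma partial_sum_comp_ge m n x : (n <= m)%N ->
  partial_sum m (partial_sum n x) = partial_sum n x.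
Proof.
move=> nm; rewrite (partial_sumE m) [RHS]partial_sumE.
rewrite (big_ord_widen m (fun i => P i x)) // [RHS]big_mkcond.
by apply: eq_bigr => i _; rewrite component_partial_sum.
Qed.

Lemma partial_sum_cvg x : norm_cvg (fun n => partial_sum n x) x.
Proof.
have [_ _ _ /(_ x)/norm_cvgP] := fddP.
suff -> : (fun N : nat => \sum_(n < N) P n x) = (fun n => partial_sum n x) by [].
by apply/funext => n; rewrite partial_sumE.
Qed.

Lemma partial_sum_bounded : exists2 M : R, 1 <= M & forall n, opnorm (partial_sum n) <= M.
Proof.
have [_ _ [M PM] _] := fddP; exists (Num.max 1 M); first by rewrite le_max lexx.
move=> n; rewrite le_max; apply/orP; right.
suff -> : partial_sum n = \sum_(i < n) (-1) ^+ false *: P i by exact: PM n (fun=> false).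
by rewrite /partial_sum; apply: eq_bigr => i _; rewrite expr0 scale1r.
Qed.

Lemma finite_rank_partial_sum n : finite_rank_form (partial_sum n).
Proof.
have [PP _ _ _] := fddP; elim: n => [|n ih].
  by exists 0%N, (fun=> 0), (fun=> 0) => x; rewrite partial_sumE !big_ord0.
suff -> : bounded_op_fun (partial_sum n.+1) = fun x => partial_sum n x + P n x.
  by apply: finite_rank_formD ih _; apply: finite_rank_decomposition (PP n).2.
by apply/funext => x; rewrite !partial_sumE big_ord_recr.
Qed.

Lemma real_partD (a b : K) : real_part (a + b) = real_part a + real_part b.
Proof. by case: k a b => //= a b; rewrite raddfD. Qed.

Lemma real_part_sum n (F : nat -> K) :
  real_part (\sum_(i < n) F i) = \sum_(i < n) real_part (F i).
Proof.
elim: n => [|n ih]; last by rewrite !big_ord_recr /= real_partD ih.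
by rewrite !big_ord0 -(of_real0 (k := k)) of_realK.
Qed.

Lemma real_partN (a : K) : real_part (- a) = - real_part a.
Proof. by case: k a => //= a; rewrite raddfN. Qed.

Lemma real_part_le_modulus (a : K) : `|real_part a| <= modulus a.
Proof. by case: k a => // a; exact: Re_le_modulus. Qed.

Lemma modulus_le_real_parts : exists2 ka : K, modulus ka <= 1 &
  forall z : K, modulus z <= `|real_part z| + `|real_part (ka * z)|.
Proof.
case: (k).
  by exists 0 => [|z]; [rewrite modulus0|rewrite /modulus /= lerDl].
exists (- ('i)%C : scalar_field R ComplexScalars) => [|z].
  by rewrite modulusN modulus_complexE /= expr0n expr1n add0r sqrtr1.
apply: le_trans (modulus_le_ReIm z) _; rewrite lerD2l.
suff -> : real_part (- ('i)%C * z : scalar_field R ComplexScalars) = complex.Im z by [].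
by case: z => a b /=; ring.
Qed.

(** For real parts, choose the signs of the decomposition so that all terms of
f (sum_i +- P_i x) become nonnegative; the imaginary parts are the real parts of
the terms of another vector. *)
Lemma fdd_abs_summable (f : dual_space X) :
  exists L : R, forall n x, \sum_(i < n) modulus (f (P i x) : K) <= L * rnorm x.
Proof.
have [_ _ [M PM] _] := fddP.
have M0 : 0 <= M by apply: le_trans (opnorm_ge0 _) (PM 0%N (fun=> false)).
have real_bound n x : \sum_(i < n) `|real_part (f (P i x) : K)| <= opnorm f * (M * rnorm x).
  pose eps i := (real_part (f (P i x) : K) < 0).
  have -> : \sum_(i < n) `|real_part (f (P i x) : K)|
      = real_part (f ((\sum_(i < n) (-1) ^+ eps i *: P i) x) : K).
    rewrite sum_operatorE operator_sum (real_part_sum n (fun i => f (((-1) ^+ eps i *: P i) x) : K)).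
    apply: eq_bigr => i _; rewrite /eps; case: ltP => h.
      by rewrite ltr0_norm // expr1 -real_partN scaleN1r -[LHS]/(real_part (- f (P i x) : K)) -(linearN f).
    by rewrite ger0_norm // expr0 scale1r.
  apply: le_trans (ler_norm _) _; apply: le_trans (real_part_le_modulus _) _.
  apply: (@rnorm_operator_le _ _ _ _ f) => //.
  exact: (@rnorm_operator_le _ _ _ _ (\sum_(i < n) (-1) ^+ eps i *: P i)).
have [ka ka1 kaP] := modulus_le_real_parts.
exists (2 * (opnorm f * M)) => n x.
apply: (@le_trans _ _ (\sum_(i < n)
    (`|real_part (f (P i x) : K)| + `|real_part (f (P i (ka *: x)) : K)|))).
  apply: ler_sum => i _; rewrite !operatorZ; exact: kaP.
rewrite big_split /= -!mulrA mulrDl mul1r; apply: lerD (real_bound n x) _.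
apply: le_trans (real_bound n _) _; rewrite rnormZm !ler_wpM2l ?opnorm_ge0 //.
by rewrite ler_piMl ?rnorm_ge0.
Qed.

(** If the tails of f do not tend to 0 in norm, there are bounded blocks u_j with
f u_j = 1. Unconditionality makes the series of the restrictions of f to these
blocks absolutely convergent at every vector, so that its subsums with bounded
coefficients give a copy of l_infinity in the dual. *)
Lemma fdd_shrinking : subprojective (dual_space X) ->
  forall (f : dual_space X) (e : R), 0 < e -> exists N, forall n, (N <= n)%N ->
    forall x, modulus (f (x - partial_sum n x) : K) <= e * rnorm x.
Proof.
move=> spX f e e0; apply: contrapT => nshrink.
have [M M1 pM] := partial_sum_bounded.
have M0 : 0 < M by apply: lt_le_trans M1.
have bad N : exists n x, (N <= n)%N /\ e * rnorm x < modulus (f (x - partial_sum n x) : K).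
  apply: contrapT => nbad; apply: nshrink; exists N => n Nn x.
  by rewrite leNgt; apply/negP => h; apply: nbad; exists n, x.
pose B := 2 * M / e.
have [j m|m [u uP]] := @gliding_choice X (fun j m m' u =>
    [/\ partial_sum m u = 0, partial_sum m' u = u, f u = 1 & rnorm u <= B]).
  have [n [x [mn fx]]] := bad m.
  pose w := x - partial_sum n x.
  have pw : norm_cvg (fun l => f (partial_sum l w)) (f w).
    exact/norm_cvg_operator/partial_sum_cvg.
  have [|N pN] := pw (modulus (f w : K) - e * rnorm x); first by rewrite subr_gt0.
  pose l := maxn N n.+1; pose v := partial_sum l w.
  have fv : e * rnorm x < modulus (f v : K).
    have := pN l (leq_maxl _ _); have := ler_rnormB_dist (f w) (f v).
    rewrite rnormBC -/v -[rnorm (f w)]/(modulus (f w : K)) -[rnorm (f v)]/(modulus (f v : K)); lra.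
  have nl : (n <= l)%N by rewrite leq_max leqnSn orbT.
  have vE : v = partial_sum l x - partial_sum n x.
    by rewrite /v /w operatorB partial_sum_comp_ge.
  have fv0 : 0 < modulus (f v : K).
    by apply: le_lt_trans fv; rewrite mulr_ge0 ?rnorm_ge0 // ltW.
  have fvn0 : (f v : K) != 0.
    by apply: contraTneq fv0 => h; rewrite h -[modulus _]/(rnorm (0 : K^o)) rnorm0 ltxx.
  exists l, ((f v : K)^-1 *: v); split; first by rewrite leq_max ltnS mn orbT.
  split.
  - by rewrite operatorZ vE [partial_sum m _]operatorB !partial_sum_comp_le ?(leq_trans mn) // subrr scaler0.
  - by rewrite operatorZ /v partial_sum_comp_le.
  - by rewrite operatorZ; exact: mulVf.
  - rewrite rnormZm modulusV mulrC ler_pdivrMr // /B.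
    apply: (@le_trans _ _ (2 * M * rnorm x)).
      rewrite vE mulrDl mul1r mulrDl.
      by apply: rnormB_le; apply: rnorm_operator_le.
    rewrite -[2 * M / e * _]mulrA ler_wpM2l ?mulr_ge0 ?(ltW M0) //.
    by rewrite [leRHS]mulrC ler_pdivlMr // mulrC ltW.
have minc j : (m j < m j.+1)%N by case: (uP j).
have mmono : {homo m : i j / (i <= j)%N}.
  by apply: homo_leq => // [x y x'|i]; [exact: leq_trans|exact: ltnW].
have [um um' fu uB] : [/\ forall j, partial_sum (m j) (u j) = 0,
    forall j, partial_sum (m j.+1) (u j) = u j, forall j, f (u j) = 1 & forall j, rnorm (u j) <= B].
  by split=> j; case: (uP j) => _ [].
pose phi j : dual_space X := op_comp f (partial_sum (m j.+1) - partial_sum (m j)).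
have phiE j x : phi j x = f (partial_sum (m j.+1) x - partial_sum (m j) x) by [].
have [L fL] := fdd_abs_summable f.
apply: (@linfty_dual_not_subprojective R k X phi u L B) => //.
- move=> i j; rewrite phiE; have [ij|ji|->] := ltngtP i j.
  + have z n : (n <= m j)%N -> partial_sum n (u j) = 0.
      by move=> nm; rewrite -(partial_sum_comp_le _ nm) um operator0.
    by rewrite !z ?subrr ?operator0 //; apply: mmono => //; exact: ltnW.
  + have z n : (m j.+1 <= n)%N -> partial_sum n (u j) = u j.
      by move=> nm; rewrite -[in LHS](um' j) partial_sum_comp_ge.
    by rewrite !z ?subrr ?operator0 //; apply: mmono => //; exact: ltnW.
  + by rewrite um um' subr0 fu.
- move=> n x; apply: le_trans (fL (m n) x).
  elim: n => [|n ih]; first by rewrite big_ord0 sumr_ge0 // => i _; exact: modulus_ge0.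
  rewrite big_ord_recr /= (sum_ord_split (fun i => modulus (f (P i x) : K)) (ltnW (minc n))).
  apply: lerD ih _; rewrite [X in modulus X <= _]phiE !partial_sumE.
  rewrite (sum_ord_split (fun i => P i x) (ltnW (minc n))) addrAC subrr add0r operator_sum.
  exact: (@ler_rnorm_sum _ _ K^o).
Qed.

End PartialSums.
End FDD.

(** * Block-diagonal sums of operators and the p-estimates *)

Section BlockDiagonal.
Context {R : realType} {k : scalar_kind}.
Local Notation K := (scalar_field R k).

Definition block (X : normedModType K) (P : nat -> bounded_op X X) (m m' : nat) : bounded_op X X :=
  partial_sum P m' - partial_sum P m.

Lemma blockE (X : normedModType K) (P : nat -> bounded_op X X) (m m' : nat) (x : X) :
  block P m m' x = partial_sum P m' x - partial_sum P m x.
Proof. by []. Qed.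

Lemma interval_disjointly_supported (X : normedModType K) (P : nat -> bounded_op X X)
    (m : nat -> nat) (n : nat) (x : nat -> X) : (forall j, (m j < m j.+1)%N) ->
  disjointly_supported P (fun j : 'I_n => block P (m j) (m j.+1) (x j)).
Proof.
move=> minc.
have mmono : {homo m : i j / (i <= j)%N}.
  by apply: homo_leq => // [a b c|i]; [exact: leq_trans|exact: ltnW].
pose S (j : 'I_n) := finmap.seq_fset tt (index_iota (m j) (m j.+1)).
exists S; split=> [i j ij|j].
  apply/finmap.fdisjointP => l; rewrite !finmap.seq_fsetE !mem_index_iota => /andP[il li].
  apply/negP => /andP[jl lj].
  have [ltij|ltji|/val_inj/eqP] := ltngtP i j; last by rewrite (negbTE ij).
  - by have := leq_trans li (leq_trans (mmono _ _ ltij) jl); rewrite ltnn.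
  - by have := leq_trans lj (leq_trans (mmono _ _ ltji) il); rewrite ltnn.
exists (x j) => //; rewrite blockE !partial_sumE sum_operatorE.
rewrite (sum_ord_split (fun i => P i (x j)) (ltnW (minc j))) addrAC subrr add0r.
apply: perm_big; apply: uniq_perm; [exact: finmap.fset_uniq|exact: iota_uniq|].
exact: finmap.seq_fsetE.
Qed.

Lemma powR_le_root (a b p : R) : 0 < p -> 0 <= a -> 0 <= b -> a `^ p <= b `^ p -> a <= b.
Proof.
move=> p0 a0 b0 ab; rewrite leNgt; apply/negP => ba.
by move: ab; rewrite leNgt gt0_ltr_powR // in_itv /= andbT.
Qed.

(** The upper estimate in X2 and the lower estimate in X1 combine to
|sum_j a_j S_j x|^p <= C2 sum_j |a_j S_j x|^p <= C2 (B D)^p sum_j |r_j x|^p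
<= (C2 / C1) (B D)^p |sum_j r_j x|^p, with r_j the block projections. *)
Lemma block_diagonal_bound (X1 X2 : normedModType K) (P : nat -> bounded_op X1 X1)
    (Q : nat -> bounded_op X2 X2) (p : R) (m : nat -> nat) (S : nat -> X1 -> X2) (D : R) :
  1 <= p -> unconditional_FDD P -> lower_estimate P p -> upper_estimate Q p ->
  (forall j, (m j < m j.+1)%N) -> 0 <= D ->
  (forall j x, exists y, S j x = block Q (m j) (m j.+1) y) ->
  (forall j x, rnorm (S j x) <= D * rnorm (block P (m j) (m j.+1) x)) ->
  exists2 A : R, 0 <= A & forall n (a : nat -> K) B x, 0 <= B -> (forall j, modulus (a j) <= B) ->
    rnorm (\sum_(j < n) a j *: S j x) <= A * B * rnorm x.
Proof.
move=> p1 fddP [C1 C10 lowP] [C2 upQ] minc D0 Sran SD.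
have p0 : 0 < p by apply: lt_le_trans p1.
have [M M1 pM] := partial_sum_bounded fddP.
have M0 : 0 <= M by apply: le_trans M1.
pose C := Num.max C2 0 / C1.
have C0 : 0 <= C by rewrite divr_ge0 ?le_max ?lexx ?orbT // ltW.
exists (C `^ p^-1 * D * (2 * M)).
  by rewrite !mulr_ge0 // powR_ge0.
move=> n a B x B0 aB.
apply: (@powR_le_root _ _ p p0); first exact: rnorm_ge0.
  by rewrite !mulr_ge0 ?powR_ge0 ?rnorm_ge0.
have /choice[y yS] : forall j, exists y, S j x = block Q (m j) (m j.+1) y by move=> j; exact: Sran.
have upper : rnorm (\sum_(j < n) a j *: S j x) `^ p <= C2 * \sum_(j < n) rnorm (a j *: S j x) `^ p.
  have := upQ n _ (interval_disjointly_supported Q n (fun j => a j *: y j) minc).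
  have yE (j : 'I_n) : block Q (m j) (m j.+1) (a j *: y j) = a j *: S j x.
    by rewrite operatorZ yS.
  by under eq_bigr do rewrite yE; under [in X in _ <= X -> _]eq_bigr do rewrite yE.
have lower : C1 * \sum_(j < n) rnorm (block P (m j) (m j.+1) x) `^ p <= (2 * M * rnorm x) `^ p.
  apply: le_trans (lowP n _ (interval_disjointly_supported P n (fun=> x) minc)) _.
  apply: ge0_ler_powR; rewrite ?nnegrE ?rnorm_ge0 ?mulr_ge0 ?rnorm_ge0 ?(ltW p0) //.
  have tele l : \sum_(j < l) block P (m j) (m j.+1) x = block P (m 0) (m l) x.
    elim: l => [|l ih]; first by rewrite big_ord0 blockE subrr.
    by rewrite big_ord_recr /= ih !blockE addrC subrKA.
  by rewrite (tele n) blockE mulrDl mul1r mulrDl rnormB_le // rnorm_operator_le.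
have termwise : \sum_(j < n) rnorm (a j *: S j x) `^ p
    <= (B * D) `^ p * \sum_(j < n) rnorm (block P (m j) (m j.+1) x) `^ p.
  rewrite mulr_sumr; apply: ler_sum => j _.
  rewrite -powRM ?rnorm_ge0 ?mulr_ge0 //.
  apply: ge0_ler_powR; rewrite ?nnegrE ?rnorm_ge0 ?mulr_ge0 ?rnorm_ge0 ?(ltW p0) //.
  rewrite rnormZm -mulrA; apply: ler_pM; rewrite ?modulus_ge0 ?rnorm_ge0 //.
apply: le_trans upper _.
have sum0 : 0 <= \sum_(j < n) rnorm (a j *: S j x) `^ p by apply: sumr_ge0 => j _; exact: powR_ge0.
apply: (@le_trans _ _ (Num.max C2 0 * \sum_(j < n) rnorm (a j *: S j x) `^ p)).
  by rewrite ler_wpM2r // le_max lexx.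
apply: (@le_trans _ _ (Num.max C2 0 * ((B * D) `^ p * ((2 * M * rnorm x) `^ p / C1)))).
  rewrite ler_wpM2l ?le_max ?lexx ?orbT //; apply: le_trans termwise _.
  by rewrite ler_wpM2l ?powR_ge0 // ler_pdivlMr // mulrC.
have -> : C `^ p^-1 * D * (2 * M) * B * rnorm x = C `^ p^-1 * ((B * D) * (2 * M * rnorm x)) by ring.
have -> : (C `^ p^-1 * (B * D * (2 * M * rnorm x))) `^ p
    = C * ((B * D) `^ p * (2 * M * rnorm x) `^ p).
  rewrite powRM ?powR_ge0 ?mulr_ge0 ?rnorm_ge0 // -powRrM mulVf ?gt_eqF // powRr1 //.
  have BD0 : 0 <= B * D by exact: mulr_ge0.
  have Mx0 : 0 <= 2 * M * rnorm x by rewrite mulr_ge0 ?rnorm_ge0 // mulr_ge0.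
  by rewrite (powRM _ BD0 Mx0).
by rewrite /C le_eqVlt; apply/orP; left; apply/eqP; ring.
Qed.

End BlockDiagonal.

(** * Approximation of compact operators by finite rank compressions *)

Section CompactApproximation.
Context {R : realType} {k : scalar_kind}.
Local Notation K := (scalar_field R k).
Variables (X1 : normedModType K) (X2 : normedModType K).
Variables (P : nat -> bounded_op X1 X1) (Q : nat -> bounded_op X2 X2).
Hypotheses (fddP : unconditional_FDD P) (fddQ : unconditional_FDD Q).
Local Notation p_ := (partial_sum P).
Local Notation q_ := (partial_sum Q).

Lemma homogeneous_bound (V W : normedModType K) (f : V -> W) (M : R) :
  (forall (a : K) x, f (a *: x) = a *: f x) ->
  (forall x, rnorm x = 1 -> rnorm (f x) <= M) -> forall x, rnorm (f x) <= M * rnorm x.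
Proof.
move=> fZ f1 x; have [->|x0] := eqVneq x 0.
  by rewrite -[X in f X](scale0r 0) fZ scale0r !rnorm0 mulr0.
have x1 : 0 < rnorm x := rnorm_gt0 x0.
have mc : modulus (of_real k (rnorm x)^-1) = (rnorm x)^-1.
  by rewrite modulus_of_real ger0_norm // invr_ge0 ltW.
have := f1 (of_real k (rnorm x)^-1 *: x).
by rewrite fZ !rnormZm mc mulVf ?gt_eqF // mulrC ler_pdivrMr //; apply.
Qed.

(** The q_n are uniformly bounded and converge pointwise, hence uniformly on the
totally bounded image of the unit ball. *)
Lemma compact_left_approx (T : compact_op X1 X2) (e : R) : 0 < e ->
  exists N, forall n, (N <= n)%N -> forall x, rnorm (T x - q_ n (T x)) <= e * rnorm x.
Proof.
move=> e0; have [M M1 qM] := partial_sum_bounded fddQ.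
have M0 : 0 < M by apply: lt_le_trans M1.
pose d := e / 2 / (1 + M).
have d0 : 0 < d by rewrite !divr_gt0 // addr_gt0.
have := compact_op_subproof T; rewrite inE => /precompact_totally_bounded/(_ _ d0)[s sT].
have [N NP] : exists N, forall n, (N <= n)%N -> forall y, y \in s -> rnorm (y - q_ n y) < e / 2.
  elim: s {sT} => [|y s [N NP]]; first by exists 0%N => n _ y; rewrite in_nil.
  have [|N' N'P] := partial_sum_cvg fddQ y (e := e / 2); first by rewrite divr_gt0.
  exists (maxn N N') => n; rewrite geq_max => /andP[Nn N'n] z; rewrite inE => /predU1P[->|zs].
    by rewrite rnormBC N'P.
  exact: NP.
exists N => n Nn; apply: homogeneous_bound => [a x|x x1].
  by rewrite !operatorZ scalerBr.
have [|y ys yT] := sT (T x); first by exists x => //=; rewrite rnormE x1 of_real1.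
have -> : T x - q_ n (T x) = (y - q_ n y) + ((T x - y) - q_ n (T x - y)).
  by rewrite operatorB opprB addrA [(y - _) + _]addrC !subrKA.
rewrite [e]splitr; apply: rnormD_le; first exact/ltW/NP.
apply: (@le_trans _ _ (d + M * d)).
  apply: rnormB_le; first by rewrite rnormBC ltW.
  by apply: rnorm_operator_le => //; rewrite rnormBC ltW.
by rewrite -{1}[d]mul1r -mulrDl /d mulrC divfK // gt_eqF // addr_gt0.
Qed.

Hypothesis shrinkP : forall (f : dual_space X1) (e : R), 0 < e -> exists N, forall n, (N <= n)%N ->
    forall x, modulus (f (x - p_ n x) : K) <= e * rnorm x.

(** Up to a small error T has finite rank, and then only finitely many functionals
of X1 have to be approximated; this needs the decomposition to be shrinking. *)
Lemma compact_right_approx (T : compact_op X1 X2) (e : R) : 0 < e ->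
  exists N, forall n, (N <= n)%N -> forall x, rnorm (T x - T (p_ n x)) <= e * rnorm x.
Proof.
move=> e0; have [M M1 pM] := partial_sum_bounded fddP.
have M0 : 0 < M by apply: lt_le_trans M1.
have [|N0 /(_ N0 (leqnn _)) TN0] := @compact_left_approx T (e / 2 / (1 + M)).
  by rewrite !divr_gt0 // addr_gt0.
have [l [v [f qE]]] := finite_rank_partial_sum fddQ N0.
have [N NP] : exists N, forall n, (N <= n)%N -> forall x,
    rnorm (q_ N0 (T (x - p_ n x))) <= e / 2 * rnorm x.
  pose d := e / 2 / (\sum_(i < l) rnorm (v i) + 1).
  have s0 : 0 < \sum_(i < l) rnorm (v i) + 1.
    by rewrite ltr_wpDl // sumr_ge0 // => i _; exact: rnorm_ge0.
  have d0 : 0 < d by rewrite !divr_gt0.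
  have [N NP] : exists N, forall n, (N <= n)%N -> forall i, (i < l)%N -> forall x,
      modulus (f i (T (x - p_ n x)) : K) <= d * rnorm x.
    elim: (l) => [|l' [N NP]]; first by exists 0%N.
    have [N' N'P] := shrinkP (op_comp (f l') T) d0.
    exists (maxn N N') => n; rewrite geq_max => /andP[Nn N'n] i.
    by rewrite ltnS leq_eqVlt => /predU1P[->|i_l] x; [exact: N'P|exact: NP].
  exists N => n Nn x; rewrite qE; apply: le_trans (ler_rnorm_sum _ _ _) _.
  apply: (@le_trans _ _ (\sum_(i < l) d * rnorm x * rnorm (v i))).
    by apply: ler_sum => i _; rewrite rnormZm ler_wpM2r ?rnorm_ge0 // NP.
  rewrite -mulr_sumr mulrAC ler_wpM2r ?rnorm_ge0 //.
  apply: (@le_trans _ _ (d * (\sum_(i < l) rnorm (v i) + 1))).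
    by rewrite ler_wpM2l ?lerDl // ltW.
  by rewrite divfK // gt_eqF.
exists N => n Nn x; rewrite -operatorB -[T _](subrK (q_ N0 (T (x - p_ n x)))) [e]splitr mulrDl.
apply: rnormD_le; last exact: NP.
apply: le_trans (TN0 _) _.
apply: (@le_trans _ _ (e / 2 / (1 + M) * ((1 + M) * rnorm x))); last first.
  by rewrite mulrA divfK // gt_eqF // addr_gt0.
rewrite ler_wpM2l //; first by rewrite !divr_ge0 ?addr_ge0 ?(ltW e0) ?(ltW M0).
by rewrite mulrDl mul1r; apply: rnormB_le => //; apply: rnorm_operator_le.
Qed.

Lemma compact_approx (T : compact_op X1 X2) (e : R) : 0 < e ->
  exists N, forall n, (N <= n)%N -> forall x, rnorm (T x - q_ n (T (p_ n x))) <= e * rnorm x.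
Proof.
move=> e0; have [M M1 pM] := partial_sum_bounded fddP.
have M0 : 0 < M by apply: lt_le_trans M1.
have [|N NP] := @compact_right_approx T (e / 2); first by rewrite divr_gt0.
have [|N' N'P] := @compact_left_approx T (e / 2 / M); first by rewrite !divr_gt0.
exists (maxn N N') => n; rewrite geq_max => /andP[Nn N'n] x.
rewrite -[T x](subrK (T (p_ n x))) -addrA [e]splitr mulrDl.
apply: rnormD_le; first exact: NP.
apply: le_trans (N'P _ N'n _) _.
apply: (@le_trans _ _ (e / 2 / M * (M * rnorm x))); last by rewrite mulrA divfK // gt_eqF.
rewrite ler_wpM2l //; last exact: rnorm_operator_le.
by rewrite !divr_ge0 ?(ltW e0) ?(ltW M0).
Qed.

Definition compression_norm (n : nat) (T : compact_op X1 X2) : R :=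
  opnorm (op_comp (q_ n) (op_comp T (p_ n))).

Lemma rnorm_le_compact (T : compact_op X1 X2) x : rnorm (T x) <= rnorm T * rnorm x.
Proof. by rewrite rnorm_compact_op; exact: le_opnorm. Qed.

Lemma compression_norm_eq0 n (T : compact_op X1 X2) :
  compression_norm n T = 0 <-> forall x, q_ n (T (p_ n x)) = 0.
Proof.
split=> [T0 x|T0].
  apply/rnorm0_eq0/le_anti; rewrite rnorm_ge0 andbT.
  have := le_opnorm (op_comp (q_ n) (op_comp T (p_ n))) x.
  by rewrite -/(compression_norm n T) T0 mul0r.
apply/le_anti; rewrite opnorm_ge0 andbT; apply: opnorm_le => // x.
by rewrite /= T0 rnorm0 mul0r.
Qed.

Lemma compression_approximating :
  exists C : R, approximating_seminorms compression_norm C.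
Proof.
have [MP MP1 pM] := partial_sum_bounded fddP.
have [MQ MQ1 qM] := partial_sum_bounded fddQ.
exists (MQ * MP); split.
- move=> n; split.
    have lin (c : K) (S T : compact_op X1 X2) :
        op_comp (q_ n) (op_comp (c *: S + T) (p_ n)) =
        c *: op_comp (q_ n) (op_comp S (p_ n)) + op_comp (q_ n) (op_comp T (p_ n)).
      apply: bounded_op_ext => x.
      transitivity (q_ n (c *: S (p_ n x) + T (p_ n x))); first by [].
      by rewrite operatorD operatorZ.
    have := @seminorm_comp R k (compact_op X1 X2) (bounded_op X1 X2) (@rnorm R k _)
      (fun T => op_comp (q_ n) (op_comp T (p_ n))) lin (@seminorm_rnorm R k _).
    by move=> [h1 h2]; split=> [S T|a T]; rewrite /compression_norm -!rnorm_opnorm; [exact: h1|exact: h2].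
  move=> T; rewrite /compression_norm rnorm_compact_op [X in _ <= X]mulrAC -mulrA.
  by apply: opnorm_comp_le => //; apply: opnorm_comp_le.
- move=> T T1; have [|N NP] := @compact_approx T (2^-1); first by rewrite invr_gt0.
  exists N => n Nn; rewrite leNgt; apply/negP => Tn.
  have : opnorm (T : bounded_op X1 X2) <= 2^-1 + compression_norm n T.
    apply: opnorm_le => [|x].
      by rewrite addr_ge0 ?opnorm_ge0 ?invr_ge0.
    rewrite mulrDl -[T x](subrK (q_ n (T (p_ n x)))); apply: rnormD_le; first exact: NP.
    exact: (le_opnorm (op_comp (q_ n) (op_comp T (p_ n)))).
  by rewrite -rnorm_compact_op T1; lra.
- move=> m m' T mm' /compression_norm_eq0 T0; apply/compression_norm_eq0 => x.
  rewrite -(partial_sum_comp_le fddQ _ mm') -(partial_sum_comp_ge fddP x mm') T0.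
  exact: operator0.
- move=> n.
  have [a [v [f pE]]] := finite_rank_partial_sum fddP n.
  have [b [w [g qE]]] := finite_rank_partial_sum fddQ n.
  exists (a * b)%N, (fun l (T : compact_op X1 X2) => (g (l %% b)%N (T (v (l %/ b)%N)) : K)).
  have lin l (c : K) (S T : compact_op X1 X2) : (g (l %% b)%N ((c *: S + T) (v (l %/ b)%N)) : K) =
      c * g (l %% b)%N (S (v (l %/ b)%N)) + g (l %% b)%N (T (v (l %/ b)%N)).
    transitivity (g (l %% b)%N (c *: S (v (l %/ b)%N) + T (v (l %/ b)%N)) : K); first by [].
    by rewrite operatorD operatorZ.
  split=> [l|T gT]; first exact: lin.
  apply/compression_norm_eq0 => x; rewrite qE big1 // => j _.
  rewrite pE operator_sum operator_sum big1 ?scale0r // => i _.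
  rewrite !operatorZ.
  have b0 : (0 < b)%N by apply: leq_ltn_trans (ltn_ord j).
  have := gT (i * b + j)%N; rewrite divnMDl // divn_small // addn0 modnMDl modn_small // => ->.
    by rewrite scaler0.
  apply: (@leq_trans (i.+1 * b)); last by rewrite leq_mul2r ltn_ord orbT.
  by rewrite mulSn addnC ltn_add2r.
Qed.

End CompactApproximation.

(** * Subspaces of the space of compact operators *)

Section CompactSubspaces.
Context {R : realType} {k : scalar_kind}.
Local Notation K := (scalar_field R k).

Lemma compact_op_linE (X1 X2 : normedModType K) (c : K) (S T : compact_op X1 X2) x :
  (c *: S + T) x = c *: S x + T x.
Proof. by []. Qed.

Lemma compact_sumE (X1 X2 : normedModType K) n (a : nat -> K) (T : nat -> compact_op X1 X2) x :
  (\sum_(j < n) a j *: T j) x = \sum_(j < n) a j *: T j x.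
Proof.
elim: n => [|n ih]; first by rewrite !big_ord0.
by rewrite !big_ord_recr /= -ih.
Qed.

Definition evaluation (X1 X2 : normedModType K) (x : X1) : bounded_op (compact_op X1 X2) X2.
Proof.
apply: (@operator_of _ _ (compact_op X1 X2) X2 (fun T => T x)).
- by move=> c S T; exact: compact_op_linE.
- by exists (rnorm x) => T; rewrite mulrC; exact: rnorm_le_compact.
Defined.

Lemma op_comp_compact_linear (X1 X2 : normedModType K) (f : dual_space X2) (c : K)
    (S T : compact_op X1 X2) :
  (op_comp f (c *: S + T) : dual_space X1) = c *: (op_comp f S : dual_space X1) + op_comp f T.
Proof.
apply: bounded_op_ext => x; transitivity (f (c *: S x + T x)); first by [].
by rewrite operatorD operatorZ.
Qed.

Definition composition (X1 X2 : normedModType K) (f : dual_space X2) :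
  bounded_op (compact_op X1 X2) (dual_space X1).
Proof.
apply: (@operator_of _ _ (compact_op X1 X2) (dual_space X1) (fun T => op_comp f T)).
- by move=> c S T; exact: op_comp_compact_linear.
- by exists (opnorm f) => T; rewrite rnorm_opnorm rnorm_compact_op; exact: opnorm_comp_le.
Defined.

Lemma rnorm_composition (X1 X2 : normedModType K) (f : dual_space X2) (T : compact_op X1 X2) x :
  modulus (f (T x) : K) <= rnorm (composition X1 f T) * rnorm x.
Proof. by rewrite rnorm_opnorm; exact: (le_opnorm (op_comp f T)). Qed.

Lemma strictly_singular_family (V : normedModType K) (M : nat -> V -> R) (C : R) (F : set V)
    (n : nat) (N : nat -> V -> R) (e : R) :
  approximating_seminorms M C -> subspace F -> ~ finite_dim F -> 0 < e ->
  (forall i, seminorm (N i)) ->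
  (forall i (F' : set V) (c : R), subspace F' -> ~ finite_dim F' -> F' `<=` F -> 0 < c ->
    exists2 y, F' y & N i y < c * rnorm y) ->
  exists F' : set V, [/\ subspace F', ~ finite_dim F', F' `<=` F &
    forall i y, (i < n)%N -> F' y -> N i y <= e * rnorm y].
Proof.
move=> aM sF nfF e0 sN ssN; elim: n => [|n [F' [sF' nfF' F'F F'N]]]; first by exists F; split.
have [|F'' [sF'' nfF'' F''F' F''N]] := strictly_singular_small aM sF' nfF' (sN n) e0.
  by move=> G c sG nfG GF' c0; apply: ssN => // y /GF'/F'F.
exists F''; split=> // [y /F''F'/F'F //|i y].
rewrite ltnS leq_eqVlt => /predU1P[->|i_n] F''y; first exact: F''N.
by apply: F'N => //; exact: F''F'.
Qed.

Lemma three_quarters_norm_attained (X1 X2 : normedModType K) (T : compact_op X1 X2) :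
  rnorm T = 1 -> exists2 x, rnorm x = 1 & 3 / 4 < rnorm (T x).
Proof.
move=> T1; apply: contrapT => nx.
have : opnorm (T : bounded_op X1 X2) <= 3 / 4.
  apply: opnorm_le => [|x]; first by rewrite divr_ge0.
  apply: homogeneous_bound => [a y|y y1]; first exact: operatorZ.
  by rewrite leNgt; apply/negP => h; apply: nx; exists y.
by rewrite -rnorm_compact_op T1; lra.
Qed.

Section Dichotomy.
Variables (X1 X2 : completeNormedModType K) (p : R).
Variables (P : nat -> bounded_op X1 X1) (Q : nat -> bounded_op X2 X2).
Hypotheses (p1 : 1 <= p) (fddP : unconditional_FDD P) (fddQ : unconditional_FDD Q).
Hypotheses (lowP : lower_estimate P p) (upQ : upper_estimate Q p).
Hypotheses (spX1 : subprojective (dual_space X1)).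
Local Notation p_ := (partial_sum P).
Local Notation q_ := (partial_sum Q).
Local Notation V := (compact_op X1 X2).

Variable Y : set V.
Hypotheses (sY : subspace Y) (clY : closed Y) (nfY : ~ finite_dim Y).
Hypothesis ss_eval : forall x (F : set V) (c : R),
  subspace F -> ~ finite_dim F -> F `<=` Y -> 0 < c ->
  exists2 T, F T & rnorm (evaluation X2 x T) < c * rnorm T.
Hypothesis ss_comp : forall f (F : set V) (c : R),
  subspace F -> ~ finite_dim F -> F `<=` Y -> 0 < c ->
  exists2 T, F T & rnorm (composition X1 f T) < c * rnorm T.

(** Since p_m and q_m have finite rank, T p_m and q_m T are controlled by
finitely many evaluations and compositions. *)
Lemma small_compressions (m : nat) (e : R) : 0 < e ->
  exists T : V, [/\ Y T, rnorm T = 1, forall x, q_ m (T (p_ m x)) = 0,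
    forall x, rnorm (T (p_ m x)) <= e * rnorm x & forall x, rnorm (q_ m (T x)) <= e * rnorm x].
Proof.
move=> e0; have shrinkP := fdd_shrinking fddP spX1.
have [C aM] := compression_approximating fddP fddQ shrinkP.
have [a [v [f pE]]] := finite_rank_partial_sum fddP m.
have [b [w [g qE]]] := finite_rank_partial_sum fddQ m.
pose sf := \sum_(i < a) opnorm (f i) + 1; pose sw := \sum_(i < b) rnorm (w i) + 1.
have sf0 : 0 < sf by rewrite ltr_wpDl // sumr_ge0 // => i _; exact: opnorm_ge0.
have sw0 : 0 < sw by rewrite ltr_wpDl // sumr_ge0 // => i _; exact: rnorm_ge0.
have [] := @strictly_singular_family V _ C Y a (fun i T => rnorm (evaluation X2 (v i) T)) (e / sf) aM sY nfY.
- by rewrite divr_gt0.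
- move=> i; apply: seminorm_comp (@seminorm_rnorm R k X2); exact: bounded_op_linear.
- by move=> i; exact: ss_eval.
move=> F [sF nfF FY Fv].
have [] := @strictly_singular_family V _ C F b (fun i T => rnorm (composition X1 (g i) T)) (e / sw) aM sF nfF.
- by rewrite divr_gt0.
- move=> i; apply: seminorm_comp (@seminorm_rnorm R k (dual_space X1)); exact: bounded_op_linear.
- by move=> i G c sG nfG GF c0; apply: ss_comp => // T /GF/FY.
move=> F' [sF' nfF' F'F F'g].
have [G [sG nfG GF' GM]] := infdim_null aM m sF' nfF'.
have [T GT T1] := infdim_unit_vector sG nfG.
exists T; split => //.
- exact/FY/F'F/GF'.
- exact/compression_norm_eq0/GM.
- move=> x; rewrite pE operator_sum; apply: le_trans (ler_rnorm_sum _ _ _) _.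
  apply: (@le_trans _ _ (\sum_(i < a) opnorm (f i) * rnorm x * (e / sf))).
    apply: ler_sum => i _; rewrite operatorZ rnormZm.
    apply: ler_pM; rewrite ?modulus_ge0 ?rnorm_ge0 //; first exact: (le_opnorm (f i)).
    by have := Fv i T (ltn_ord i) (F'F _ (GF' _ GT)); rewrite T1 mulr1.
  rewrite -!mulr_suml mulrAC ler_wpM2r ?rnorm_ge0 // mulrC.
  apply: (@le_trans _ _ (e / sf * sf)); last by rewrite divfK // gt_eqF.
  by rewrite ler_wpM2l ?divr_ge0 ?(ltW e0) ?(ltW sf0) // lerDl.
- move=> x; rewrite qE; apply: le_trans (ler_rnorm_sum _ _ _) _.
  apply: (@le_trans _ _ (\sum_(i < b) e / sw * rnorm x * rnorm (w i))).
    apply: ler_sum => i _; rewrite rnormZm ler_wpM2r ?rnorm_ge0 //.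
    apply: le_trans (rnorm_composition _ _ _) _; rewrite ler_wpM2r ?rnorm_ge0 //.
    by have := F'g i T (ltn_ord i) (GF' _ GT); rewrite T1 mulr1.
  rewrite -mulr_sumr mulrAC ler_wpM2r ?rnorm_ge0 //.
  apply: (@le_trans _ _ (e / sw * sw)); last by rewrite divfK // gt_eqF.
  by rewrite ler_wpM2l ?divr_ge0 ?(ltW e0) ?(ltW sw0) // lerDl.
Qed.

(** Gliding humps T_j in Y are small perturbations of blocks S_j = s_j T_j r_j,
where r_j and s_j are the block projections of the two decompositions, and by
the p-estimates the S_j satisfy an upper c_0 estimate. A functional y_j norming
S_j x_j gives the coordinate U |-> y_j (s_j U r_j x_j) / |S_j x_j|, which tends
to 0 at every compact U because s_j U does, and vanishes at all later T's. *)
Lemma strictly_singular_complemented :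
  exists Z : set V, [/\ infdim_closed_subspace Z, Z `<=` Y & complemented Z].
Proof.
have shrinkP := fdd_shrinking fddP spX1.
have [MP MP1 pMP] := partial_sum_bounded fddP.
have [MQ MQ1 qMQ] := partial_sum_bounded fddQ.
pose M := Num.max MP MQ.
have M1 : 1 <= M by rewrite le_max MP1.
have pM n : opnorm (p_ n) <= M by rewrite le_max pMP.
have qM n : opnorm (q_ n) <= M by rewrite le_max qMQ orbT.
have M0 : 0 < M by apply: lt_le_trans M1.
(* 8 M^2 will bound the coordinate functionals, so that those of index j > i are
   at most 2^-(i+2) at T_i. *)
pose d j := (2^-1 : R) ^+ j.+2 / (8 * M ^+ 2).
have M20 : 0 < 8 * M ^+ 2 by rewrite mulr_gt0 // exprn_gt0.
have d0 j : 0 < d j by rewrite divr_gt0 // exprn_gt0.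
have d8 j : 8 * M ^+ 2 * d j = 2^-1 ^+ j.+2.
  by rewrite /d mulrC divfK // gt_eqF.
have d3 j : 3 * M * d j <= 2^-1 ^+ j.+2.
  rewrite -d8 ler_wpM2r ?(ltW (d0 j)) // expr2 mulrA ler_pM ?mulr_ge0 ?(ltW M0) //.
  by have := M1; lra.
have [j m|m [T TP]] := @gliding_choice V (fun j m m' T =>
    [/\ [/\ Y T, rnorm T = 1 & forall x, q_ m (T (p_ m x)) = 0],
      forall x, rnorm (T (p_ m x)) <= d j * rnorm x,
      forall x, rnorm (q_ m (T x)) <= d j * rnorm x &
      forall x, rnorm (T x - q_ m' (T (p_ m' x))) <= d j * rnorm x]).
  have [T [YT T1 T0 Tp qT]] := small_compressions m (d0 j).
  have [N NT] := compact_approx fddP fddQ shrinkP T (d0 j).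
  exists (maxn m.+1 N), T; split; first exact: leq_maxl.
  by split=> // x; apply: NT; exact: leq_maxr.
have minc j : (m j < m j.+1)%N by case: (TP j).
have mmono : {homo m : i j / (i <= j)%N}.
  by apply: homo_leq => // [x y x'|i]; [exact: leq_trans|exact: ltnW].
have m_ge j : (j <= m j)%N by elim: j => // j /leq_ltn_trans; apply.
have [YT T1 T0 Tp qT] : [/\ forall j, Y (T j), forall j, rnorm (T j) = 1,
    forall j x, q_ (m j) (T j (p_ (m j) x)) = 0,
    forall j x, rnorm (T j (p_ (m j) x)) <= d j * rnorm x &
    forall j x, rnorm (q_ (m j) (T j x)) <= d j * rnorm x].
  by split=> j; case: (TP j) => _ [[]].
have Tapprox j x : rnorm (T j x - q_ (m j.+1) (T j (p_ (m j.+1) x))) <= d j * rnorm x.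
  by case: (TP j) => _ [].
pose r j := block P (m j) (m j.+1); pose s j := block Q (m j) (m j.+1).
have rM j x : rnorm (r j x) <= 2 * M * rnorm x.
  by rewrite blockE mulrDl mul1r mulrDl rnormB_le // rnorm_operator_le.
have sM j y : rnorm (s j y) <= 2 * M * rnorm y.
  by rewrite blockE mulrDl mul1r mulrDl rnormB_le // rnorm_operator_le.
pose S j x := s j (T j (r j x)).
have TS j x : rnorm (T j x - S j x) <= 3 * M * d j * rnorm x.
  pose q'Tp := q_ (m j.+1) (T j (p_ (m j) x)); pose qTp' := q_ (m j) (T j (p_ (m j.+1) x)).
  have -> : T j x - S j x = (T j x - q_ (m j.+1) (T j (p_ (m j.+1) x))) + (q'Tp + qTp').
    have alg (t u v w : X2) : t - (u - v - w) = (t - u) + (v + w).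
      by rewrite !opprB (addrA w) addrCA [RHS]addrC (addrC w v).
    by rewrite /S /s /r !blockE !operatorB T0 subr0 alg.
  apply: (@le_trans _ _ (d j * rnorm x + (M * (d j * rnorm x) + d j * (M * rnorm x)))).
    apply: rnormD_le => //; apply: rnormD_le; first exact: rnorm_operator_le.
    apply: le_trans (qT _ _) _; rewrite ler_wpM2l ?(ltW (d0 j)) //.
    exact: rnorm_operator_le.
  have := mulr_ge0 (ltW (d0 j)) (rnorm_ge0 x); set t := d j * rnorm x => t0.
  have -> : d j * (M * rnorm x) = M * t by rewrite /t mulrCA.
  rewrite -mulrA -/t; have := ler_wpM2r t0 M1; rewrite mul1r -mulrA; lra.
have /choice[xy xyP] : forall j, exists xy : X1 * dual_space X2,
    [/\ rnorm xy.1 = 1, 2^-1 <= rnorm (S j xy.1),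
      forall y, modulus (xy.2 y : K) <= rnorm y & xy.2 (S j xy.1) = of_real k (rnorm (S j xy.1))].
  move=> j; have [x x1 Tx] := three_quarters_norm_attained (T1 j).
  have [f [f1 fS]] := norming_functional (S j x).
  exists (x, f); split => //=.
  have := TS j x; rewrite x1 mulr1 => h.
  have h2 : (2^-1 : R) ^+ j.+2 <= 4^-1.
    have -> : 4^-1 = (2^-1 : R) ^+ 2 by rewrite expr2; field.
    by rewrite ler_wiXn2l ?invr_ge0 // invf_le1 // ler1n.
  have := d3 j; have := ler_rnormB_dist (T j x) (S j x); lra.
pose x j := (xy j).1; pose y j := (xy j).2.
have [x1 S2 yle yS] : [/\ forall j, rnorm (x j) = 1, forall j, 2^-1 <= rnorm (S j (x j)),
    forall j z, modulus (y j z : K) <= rnorm z & forall j, y j (S j (x j)) = of_real k (rnorm (S j (x j)))].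
  by split=> j; case: (xyP j).
pose phi j (U : V) : K := of_real k (rnorm (S j (x j)))^-1 * y j (s j (U (r j (x j)))).
have Sgt0 j : 0 < rnorm (S j (x j)) by apply: lt_le_trans (S2 j).
have phi_le j U : modulus (phi j U) <= 2 * rnorm (s j (U (r j (x j)))).
  rewrite /phi modulusM modulus_of_real ger0_norm ?invr_ge0 ?(ltW (Sgt0 j)) //.
  apply: ler_pM; rewrite ?modulus_ge0 ?invr_ge0 ?(ltW (Sgt0 j)) //.
  by rewrite -[leRHS]invrK lef_pV2 ?posrE ?invr_gt0.
have lphi j (c : K) (U U' : V) : phi j (c *: U + U') = c * phi j U + phi j U'.
  rewrite /phi compact_op_linE (operatorD (s j)) (operatorZ (s j)) (operatorD (y j)) (operatorZ (y j)).
  by rewrite mulrDr; congr (_ + _); rewrite mulrCA.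
have bphi j U : modulus (phi j U) <= 8 * M ^+ 2 * rnorm U.
  apply: le_trans (phi_le j U) _.
  have -> : 8 * M ^+ 2 * rnorm U = 2 * (2 * M * (rnorm U * (2 * M))) by ring.
  rewrite ler_wpM2l //; apply: le_trans (sM _ _) _.
  rewrite ler_wpM2l ?mulr_ge0 ?(ltW M0) //; apply: le_trans (rnorm_le_compact _ _) _.
  by rewrite ler_wpM2l ?rnorm_ge0 //; have := rM j (x j); rewrite x1 mulr1.
have p_r i j z : (i < j)%N -> p_ (m i.+1) (r j z) = 0.
  move=> /mmono mij; have mij' := leq_trans mij (ltnW (minc j)).
  by rewrite blockE operatorB !partial_sum_comp_le ?subrr.
have r_p i j z : (i < j)%N -> p_ (m j) (r i z) = r i z.
  move=> /mmono mij; have mij' := leq_trans (ltnW (minc i)) mij.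
  by rewrite blockE operatorB !partial_sum_comp_ge.
have s_q i j z : (i < j)%N -> s i (q_ (m j) z) = s i z.
  move=> /mmono mij; have mij' := leq_trans (ltnW (minc i)) mij.
  by rewrite !blockE !partial_sum_comp_le.
have [|||A A0 SA] := @block_diagonal_bound R k X1 X2 P Q p m S (2 * M) p1 fddP lowP upQ minc.
- by rewrite mulr_ge0 // ltW.
- by move=> j z; exists (T j (r j z)).
- move=> j z; apply: le_trans (sM _ _) _; rewrite ler_wpM2l ?mulr_ge0 ?(ltW M0) //.
  by apply: le_trans (rnorm_le_compact _ _) _; rewrite T1 mul1r.
pose Phi j : dual_space V := @operator_of _ _ V K^o (phi j) (lphi j) (ex_intro _ (8 * M ^+ 2) (bphi j)).
apply: (@complemented_c0_sequence R k V Y T Phi (A + 1) (8 * M ^+ 2)) => //.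
- exact: compact_op_complete.
- move=> U e e0.
  have [|N NU] := compact_left_approx fddQ U (e := e / (16 * M)); first by rewrite divr_gt0 // mulr_gt0.
  exists N => j Nj; rewrite subr0; apply: le_lt_trans (phi_le j U) _.
  have mN : (N <= m j)%N := leq_trans Nj (m_ge j).
  have -> : s j (U (r j (x j))) = (U (r j (x j)) - q_ (m j) (U (r j (x j))))
      - (U (r j (x j)) - q_ (m j.+1) (U (r j (x j)))).
    by rewrite blockE opprB [RHS]addrC subrKA.
  set z := r j (x j).
  have zM : rnorm z <= 2 * M by have := rM j (x j); rewrite x1 mulr1.
  have h1 := NU _ mN z; have h2 := NU _ (leq_trans mN (ltnW (minc j))) z.
  have h3 : e / (16 * M) * rnorm z <= e / 8.
    apply: (@le_trans _ _ (e / (16 * M) * (2 * M))).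
      by rewrite ler_wpM2l // divr_ge0 ?mulr_ge0 ?(ltW e0) ?(ltW M0).
    by rewrite le_eqVlt; apply/orP; left; apply/eqP; field; rewrite gt_eqF.
  have := rnormB_le (le_trans h1 h3) (le_trans h2 h3); lra.
- move=> j; rewrite /= /phi -/(S j (x j)) yS -of_realM mulVf ?gt_eqF //.
  exact: of_real1.
- move=> i j ij; rewrite /= /phi.
  have -> : s i (T j (r i (x i))) = 0.
    by rewrite -(r_p i j _ ij) -(s_q i j _ ij) T0 operator0.
  by rewrite operator0 mulr0.
- move=> i j ij; apply: le_trans (phi_le _ _) _.
  set z := r j (x j).
  have zM : rnorm z <= 2 * M by have := rM j (x j); rewrite x1 mulr1.
  have Tz : rnorm (T i z) <= d i * (2 * M).
    have := Tapprox i z; rewrite {2}/z p_r // !operator0 subr0 => h.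
    by apply: le_trans h _; rewrite ler_wpM2l ?(ltW (d0 i)).
  rewrite -d8; apply: (@le_trans _ _ (2 * (2 * M * (d i * (2 * M))))).
    by rewrite ler_wpM2l //; apply: le_trans (sM _ _) _; rewrite ler_wpM2l ?mulr_ge0 ?(ltW M0).
  by rewrite le_eqVlt; apply/orP; left; apply/eqP; ring.
- move=> n a B B0 aB; rewrite rnorm_compact_op.
  apply: opnorm_le => [|z]; first by rewrite mulr_ge0 // addr_ge0.
  rewrite compact_sumE.
  have -> : \sum_(j < n) a j *: T j z = \sum_(j < n) a j *: S j z + \sum_(j < n) a j *: (T j z - S j z).
    rewrite -big_split /=; apply: eq_bigr => j _.
    by rewrite -scalerDr addrC subrK.
  rewrite !mulrDl mul1r; apply: rnormD_le; first exact: SA.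
  apply: le_trans (ler_rnorm_sum _ _ _) _.
  apply: (@le_trans _ _ (\sum_(j < n) 2^-1 ^+ j.+1 * (B * rnorm z))); last first.
    rewrite -mulr_suml -[leRHS]mul1r ler_wpM2r ?sum_half_powers_le1 //.
    by rewrite mulr_ge0 ?rnorm_ge0.
  apply: ler_sum => j _; rewrite rnormZm mulrCA; apply: ler_pM; rewrite ?modulus_ge0 ?rnorm_ge0 //.
  apply: le_trans (TS j z) _; rewrite ler_wpM2r ?rnorm_ge0 //.
  by apply: le_trans (d3 j) _; rewrite exprS ler_piMl ?exprn_ge0 // invf_le1 // ler1n.
Qed.

End Dichotomy.
End CompactSubspaces.

Theorem corollary3p4 (R : realType) (k : scalar_kind)
  (X1 X2 : completeNormedModType (scalar_field R k)) (p : R)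
  (P : nat -> bounded_op X1 X1) (Q : nat -> bounded_op X2 X2) :
  1 <= p ->
  ~ finite_dim [set: X1] -> ~ finite_dim [set: X2] ->
  unconditional_FDD P -> unconditional_FDD Q ->
  lower_estimate P p -> upper_estimate Q p ->
  subprojective (dual_space X1) -> subprojective X2 ->
  subprojective (compact_op X1 X2).
Proof.
move=> p1 _ _ fddP fddQ lowP upQ spX1 spX2 Y /infdim_closed_subspaceP[sY clY nfY].
have complete := @compact_op_complete R k X1 X2.
have [[x [F [c [sF nfF FY [c0 Fx]]]]]|neval] := pselect (exists x (F : set (compact_op X1 X2)) (c : R),
    [/\ subspace F, ~ finite_dim F, F `<=` Y &
      0 < c /\ forall T, F T -> c * rnorm T <= rnorm (evaluation X2 x T)]).
  exact: subprojective_pullback complete spX2 clY sF FY nfF c0 Fx.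
have [[f [F [c [sF nfF FY [c0 Ff]]]]]|ncomp] := pselect (exists f (F : set (compact_op X1 X2)) (c : R),
    [/\ subspace F, ~ finite_dim F, F `<=` Y &
      0 < c /\ forall T, F T -> c * rnorm T <= rnorm (composition X1 f T)]).
  exact: subprojective_pullback complete spX1 clY sF FY nfF c0 Ff.
apply: (strictly_singular_complemented p1 fddP fddQ lowP upQ spX1 sY clY nfY).
  move=> x F c sF nfF FY c0; apply: contrapT => nT; apply: neval.
  exists x, F, c; split => //; split => // T FT.
  by rewrite leNgt; apply/negP => h; apply: nT; exists T.
move=> f F c sF nfF FY c0; apply: contrapT => nT; apply: ncomp.
exists f, F, c; split => //; split => // T FT.
by rewrite leNgt; apply/negP => h; apply: nT; exists T.
Qed.
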